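(* Let $d\ge1$, $0<\underline k\le\overline k$, $L\ge0$, and let $c=c(d,\overline k,\underline k)>0$ be a constant depending only on $(d,\overline k,\underline k)$. There exist a constant $C>0$ depending only on $(d,\overline k)$ and a threshold $n(d,\overline k,\underline k,L)$ such that the following holds for all $n\ge n(d,\overline k,\underline k,L)$. Let $\Sigma_1,\dots,\Sigma_n$ be diagonal $d\times d$ matrices with $\underline kI_d\preceq\Sigma_i\preceq\overline kI_d$ for all $i$, let $G^*\in\mathcal{P}(\mathbb{R}^d)$ satisfy $G^*([-L,L]^d)=1$, and let $X_1,\dots,X_n$ be independent with $X_i$ having density $f_{G^*,\Sigma_i}$. Let $\widehat G_n$ be any data-dependent probability measure supported on the minimum axis-aligned bounding box of the data, $\prod_{j=1}^d[\min_iX_{ij},\max_iX_{ij}]$, such that $$\ell_n(G^* )-\ell_n(\widehat G_n)\le c\,\frac{(\log n)^{d+1}}{n}.$$ Then, with probability at least $1-\frac{4d}{n^8}$, $$W_2^2(G^*,\widehat G_n)\le\frac{C}{\log n}.$$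
   Context: $\mathcal{P}(\mathbb{R}^d)$ is the set of Borel probability measures on $\mathbb{R}^d$. $\varphi_\Sigma$ is the $\mathcal{N}(0,\Sigma)$ density on $\mathbb{R}^d$, $f_{G,\Sigma}(x)=\int\varphi_\Sigma(x-\theta)\,dG(\theta)$, and $\ell_n(G)=\frac1n\sum_{i=1}^n\log f_{G,\Sigma_i}(X_i)$. $X_{ij}$ is the $j$-th coordinate of $X_i$. $A\preceq B$ means $B-A$ is positive semidefinite. $W_2^2(G,H)=\min\mathbb{E}\|U-V\|_2^2$, the minimum being over all couplings $(U,V)$ with $U\sim G$, $V\sim H$. *)

(* Defs.v *)
(* MathComp and MathComp-Analysis *)
From HB Require Import structures.
From mathcomp Require Import all_boot all_order all_algebra.
From mathcomp Require Import all_classical all_reals all_analysis.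

Set Implicit Arguments.
Unset Strict Implicit.
Unset Printing Implicit Defensive.

Import Order.TTheory GRing.Theory Num.Theory.
Import numFieldNormedType.Exports.

Local Open Scope classical_set_scope.
Local Open Scope ring_scope.

(* The sigma-algebra on tuples is the one generated by the coordinates, which
   for R^d is the Borel sigma-algebra. *)
Notation Rvec R d := (d.-tuple (measurableTypeR R)).

Section lebesgue_vec.
Context {R : realType}.

Definition cons_vec n (xt : measurableTypeR R * Rvec R n) : Rvec R n.+1 :=
  [tuple of xt.1 :: xt.2].

Let uncons_vec n (t : Rvec R n.+1) : measurableTypeR R * Rvec R n :=
  (thead t, [tuple of behead t]).

Let uncons_vecK n : cancel (@uncons_vec n) (@cons_vec n).
Proof. by move=> t; rewrite /cons_vec /uncons_vec /= -tuple_eta. Qed.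

Let cons_vecK n : cancel (@cons_vec n) (@uncons_vec n).
Proof.
move=> [x t]; rewrite /cons_vec /uncons_vec /= theadE.
by congr pair; apply: val_inj.
Qed.

Let measurable_cons_vec n : measurable_fun [set: _] (@cons_vec n).
Proof. exact: measurable_cons. Qed.

HB.instance Definition _ n :=
  isMeasurableFun.Build _ _ _ _ (@cons_vec n) (@measurable_cons_vec n).

Let measurable_uncons_vec n : measurable_fun [set: _] (@uncons_vec n).
Proof.
apply: measurable_fun_pair; last exact: measurable_behead.
exact: measurable_tnth.
Qed.

Section step.
Local Open Scope ereal_scope.
Variables (n : nat) (mu : {sigma_finite_measure set (Rvec R n) -> \bar R}).

Definition lebesgue_cons : set (Rvec R n.+1) -> \bar R :=
  pushforward (@lebesgue_measure R \x mu) (@cons_vec n).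

Let lebesgue_cons0 : lebesgue_cons set0 = 0.
Proof. exact: measure0. Qed.

Let lebesgue_cons_ge0 A : 0 <= lebesgue_cons A.
Proof. exact: measure_ge0. Qed.

Let lebesgue_cons_sigma_additive : semi_sigma_additive lebesgue_cons.
Proof. exact: measure_semi_sigma_additive. Qed.

HB.instance Definition _ := isMeasure.Build _ _ _ lebesgue_cons
  lebesgue_cons0 lebesgue_cons_ge0 lebesgue_cons_sigma_additive.

Let lebesgue_cons_sigma_finite : sigma_finite setT lebesgue_cons.
Proof.
have /sigma_finiteP[F [TF ndF Foo]] := sigma_finiteT (@lebesgue_measure R).
have /sigma_finiteP[G [TG ndG Goo]] := sigma_finiteT mu.
exists (fun k => @uncons_vec n @^-1` (F k `*` G k)).
  rewrite -preimage_bigcup; apply/esym/seteqP; split=> // t _ /=.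
  have [i _ Fi] : (\bigcup_i F i) (thead t) by rewrite -TF.
  have [j _ Gj] : (\bigcup_j G j) [tuple of behead t] by rewrite -TG.
  exists (maxn i j) => //; split => /=.
  - by move: Fi; exact/subsetPset/ndF/leq_maxl.
  - by move: Gj; exact/subsetPset/ndG/leq_maxr.
move=> k; have [mF Fk] := Foo k; have [mG Gk] := Goo k; split.
  rewrite -[X in measurable X]setTI.
  by apply: measurable_uncons_vec => //; exact: measurableX.
rewrite /lebesgue_cons /pushforward -comp_preimage.
rewrite (_ : _ \o _ = id) ?preimage_id; last first.
  by apply/funext => x; exact: cons_vecK.
by rewrite product_measure1E// lte_mul_pinfty// ge0_fin_numE.
Qed.

HB.instance Definition _ := Measure_isSigmaFinite.Build _ _ _ lebesgue_cons
  lebesgue_cons_sigma_finite.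

End step.

(* d-dimensional Lebesgue measure: d-fold product of lebesgue_measure, starting
   from the unit mass on the one-point space R^0. *)
Fixpoint lebesgue_vec d : {sigma_finite_measure set (Rvec R d) -> \bar R} :=
  match d with
  | 0 => dirac [tuple]
  | d'.+1 => lebesgue_cons (lebesgue_vec d')
  end.

End lebesgue_vec.

Definition psdmx (R : realType) d (A : 'M[R]_d) : Prop :=
  A^T = A /\ forall v : 'rV[R]_d, 0 <= (v *m A *m v^T) ord0 ord0.

Definition loewner_le (R : realType) d (A B : 'M[R]_d) : Prop := psdmx (B - A).

Definition row_of_vec (R : realType) d (t : Rvec R d) : 'rV[R]_d :=
  \row_j (tnth t j : R).

(* Lebesgue density of N(0, Sigma), for positive definite Sigma. *)
Definition gauss_density (R : realType) d (Sigma : 'M[R]_d) (x : 'rV[R]_d) : R :=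
  expR (- ((x *m invmx Sigma *m x^T) ord0 ord0) / 2)
  / Num.sqrt ((2 * pi) ^+ d * \det Sigma).

Definition mixture_density (R : realType) d (G : probability (Rvec R d) R)
    (Sigma : 'M[R]_d) (x : Rvec R d) : R :=
  \int[G]_theta gauss_density Sigma (row_of_vec x - row_of_vec theta).

Definition loglik (R : realType) d n (Sigma : 'I_n -> 'M[R]_d)
    (x : 'I_n -> Rvec R d) (G : probability (Rvec R d) R) : R :=
  n%:R^-1 * \sum_(i < n) ln (mixture_density G (Sigma i) (x i)).

Definition cube (R : realType) d (L : R) : set (Rvec R d) :=
  [set t | forall j, - L <= (tnth t j : R) <= L].

(* For n > 0 the inf and sup range over a nonempty finite set, hence are the
   minimum and the maximum. *)
Definition bounding_box (R : realType) d n (x : 'I_n -> Rvec R d) :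
    set (Rvec R d) :=
  [set t | forall j, inf (range (fun i => tnth (x i) j : R)) <= (tnth t j : R)
                     <= sup (range (fun i => tnth (x i) j : R))].

Definition has_density (R : realType) d dO (Omega : measurableType dO)
    (P : probability Omega R) (X : {RV P >-> Rvec R d}) (f : Rvec R d -> R) :
    Prop :=
  forall A, measurable A ->
    distribution P X A = (\int[lebesgue_vec d]_(x in A) (f x)%:E)%E.

Definition mutually_independent (R : realType) dO (Omega : measurableType dO)
    (P : probability Omega R) dT (T : measurableType dT) n
    (X : 'I_n -> {RV P >-> T}) : Prop :=
  forall (J : {set 'I_n}) (B : 'I_n -> set T),
    (forall i, measurable (B i)) ->
    P (\bigcap_(i in [set` J]) (X i @^-1` B i))
    = (\prod_(i in J) P (X i @^-1` B i))%E.

(* Inner probability: [set w | Q w] itself need not be measurable. *)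
Definition with_probability_at_least (R : realType) dO
    (Omega : measurableType dO) (P : probability Omega R) (p : R)
    (Q : Omega -> Prop) : Prop :=
  exists E, [/\ measurable E, (p%:E <= P E)%E & forall w, E w -> Q w].

Definition coupling (R : realType) d (G H : probability (Rvec R d) R)
    (gamma : probability (Rvec R d * Rvec R d)%type R) : Prop :=
  forall A, measurable A ->
    gamma (fst @^-1` A) = G A /\ gamma (snd @^-1` A) = H A.

Definition W2sq (R : realType) d (G H : probability (Rvec R d) R) : \bar R :=
  ereal_inf [set (\int[gamma]_uv
      (\sum_(j < d) ((tnth uv.1 j : R) - (tnth uv.2 j : R)) ^+ 2)%:E)%E
    | gamma in [set gamma | coupling G H gamma]].

(* Main.v *)
(** The mixing measure is tested only against a partition of unity
    [pou] made of products of nonnegative trigonometric polynomials of degree M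
    in the variables theta_j / ln n. Such a polynomial can be deconvolved
    exactly: multiplying its k-th Fourier coefficient by the inverse of the
    Gaussian characteristic function gives, for each observation i, a function
    h_i with int h_i(x) phi_i(x - theta) dx = pou(theta), and taking
    M^2 of order (ln n)^3 / (d kbar) keeps |h_i| <= n^(1/32).

    Let r_i = (1 + eta h_i) f_i + kappa, where f_i is the true density. From
    ln u <= u / r + ln r - 1 applied to the fitted densities, an almost maximal
    likelihood forces int T dG - 1 + n^-1 sum_i ln (r_i / f_i)(X_i) to be almost
    nonnegative, with T(theta) = n^-1 sum_i (phi_i(. - theta) / r_i)(X_i).
    Exponential Markov bounds give sum_i ln (r_i / f_i)(X_i) <= n eta int pou dG*
    and, uniformly over a fine net of theta, T(theta) <= 1 - eta pou(theta), both up
    to terms smaller than eta by a power of n. Hence the moments int pou dG are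
    estimated with polynomial accuracy, for every member of the partition.

    Two measures with almost equal moments are coupled by matching the mass of
    each member of the partition; since the latter localises theta at scale
    ln n / M, the squared cost is of order (ln n)^2 / M^2, that is 1 / ln n. *)
Require Import Defs.
From HB Require Import structures.
From mathcomp Require Import all_boot all_order all_algebra.
From mathcomp Require Import all_classical all_reals all_analysis.
From mathcomp Require Import measurable_realfun.
From mathcomp Require Import ring lra.
Import Order.TTheory GRing.Theory Num.Theory.
Import numFieldNormedType.Exports.
Local Open Scope classical_set_scope.
Local Open Scope ring_scope.

Set Implicit Arguments.
Unset Strict Implicit.
Unset Printing Implicit Defensive.

(** * Cosine moments of the Gaussian law *)

(** [Ghat] depends on the data, so concentration for a fixed mixing measure says nothing about it.
    What gives uniformity is that the tested statistic, int T dG, is linear in G: a bound on T at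
    every theta of a cube serves all measures on that cube, and a net of polynomial size costs only
    a multiple of ln n in the exponent. The cube has half-side D = ln n because an exponential
    moment of fixed order then already confines all data, hence their bounding box. Its size does
    not hurt the rate: deconvolution costs exp (d M^2 kbar / (2 D^2)), so a budget n^(1/32) fixes (D
    / M)^2 of order d kbar / ln n whatever D is. The parameters kund, L and c enter only factors
    absorbed by powers of n, hence only the threshold. With p = n^(1/32) the scales are |h_i| <= p,
    eta = p^-3, kap = p^-5 and exponential parameter p^-15. They keep every error of order at most
    eta / p = p^-4: the second-order term (eta p)^2, the added mass kap times a volume at most p,
    the variance term p^-15 (Phi / kap)^2 for kernels bounded by Phi, and deviations of order ln n /
    (p^-15 n). *)

Lemma is_derive_gauss_wave_freq (R : realType) (s a y t : R) :
  is_derive t 1 (fun t : R => expR (s * t ^+ 2 / 2 - y ^+ 2 / (2 * s)) * cos (t * y + a))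
   (expR (s * t ^+ 2 / 2 - y ^+ 2 / (2 * s)) * (s * t * cos (t * y + a) - y * sin (t * y + a))).
Proof.
pose g := fun t : R => s * t ^+ 2 / 2 - y ^+ 2 / (2 * s).
pose h := fun t : R => t * y + a.
have dg : is_derive t 1 g (s * t).
  apply: is_derive_eq.
  by rewrite /GRing.scale /=; field.
have dh : is_derive t 1 h y.
  apply: is_derive_eq.
  by rewrite /GRing.scale /= !mulr1 !mulr0 !add0r addr0.
have := is_deriveM (is_derive1_comp (is_derive_expR (g t)) dg) (is_derive1_comp (is_derive_cos (h t)) dh).
move=> H; apply: (is_derive_eq H).
rewrite /GRing.scale /=; rewrite /g /h. ring.
Qed.

(** The factor [expR (s * t ^+ 2 / 2)], inverse of the Gaussian characteristic function, is what
    makes this space derivative agree with the frequency derivative of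
    [is_derive_gauss_wave_freq]. *)
Lemma is_derive_gauss_wave_pos (R : realType) (s m a y t : R) : s != 0 ->
  is_derive y 1 (fun y : R => s * (expR (s * t ^+ 2 / 2 - (y - m) ^+ 2 / (2 * s)) * sin (t * (y - m) + a)))
   (expR (s * t ^+ 2 / 2 - (y - m) ^+ 2 / (2 * s)) * (s * t * cos (t * (y - m) + a) - (y - m) * sin (t * (y - m) + a))).
Proof.
move=> s0.
pose g := fun y : R => s * t ^+ 2 / 2 - (y - m) ^+ 2 / (2 * s).
pose h := fun y : R => t * (y - m) + a.
have dg : is_derive y 1 g (- (y - m) / s).
  apply: is_derive_eq.
  by rewrite /GRing.scale /=; field.
have dh : is_derive y 1 h t.
  apply: is_derive_eq.
  by rewrite /GRing.scale /=; ring.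
have := is_deriveM (is_derive1_comp (is_derive_expR (g y)) dg) (is_derive1_comp (is_derive_sin (h y)) dh).
move=> H; have {}H := is_deriveZ s H; apply: (is_derive_eq H).
rewrite /GRing.scale /=; rewrite /g /h. field. by [].
Qed.

Lemma cvg_Rintegral_itv (R : realType) (f : R -> R) (m : R) :
  (@lebesgue_measure R).-integrable setT (EFin \o f) ->
  \int[@lebesgue_measure R]_(y in `[m - n%:R, m + n%:R]) f y @[n --> \oo] --> \int[@lebesgue_measure R]_y f y.
Proof.
move=> intf; apply/fine_cvg; rewrite fineK; last exact: integrable_fin_num.
pose f_ := fun n : nat => fun y => ((f \_ `[m - n%:R, m + n%:R]) y)%:E.
have mf : measurable_fun setT f by apply/measurable_EFinP; exact: measurable_int intf.
have := @dominated_convergence _ _ R (@lebesgue_measure R) setT measurableT f_ (EFin \o f) (abse \o (EFin \o f)).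
move=> [].
- move=> n; apply/measurable_EFinP; apply/(measurable_restrictT _ _).1 => //.
  exact: measurable_funTS.
- exact: measurable_int intf.
- apply: aeW => y _; apply/fine_cvgP; split; first exact: nearW.
  apply: cvg_near_cst; near=> n.
  rewrite /f_ /= patchE mem_set// /= in_itv/=.
  have : `|y - m| <= n%:R by near: n; exact: nbhs_infty_ger.
  by rewrite ler_norml => /andP[? ?]; apply/andP; split; lra.
- exact: integrable_abse.
- by apply: aeW => y n _; rewrite /f_ /= patchE lee_fin; case: ifP; rewrite ?normr0.
move=> _ _; apply: cvg_trans; apply: near_eq_cvg; near=> n.
rewrite [RHS]integral_mkcond; apply: eq_integral => y _.
by rewrite /f_ restrict_EFin.
Unshelve. all: end_near. Qed.

Section gauss_cos.
Context (R : realType).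
Notation mu := (@lebesgue_measure R).
Variables (s m a : R) (s0 : 0 < s).
Let F (t y : R) := expR (s * t ^+ 2 / 2 - (y - m) ^+ 2 / (2 * s)) * cos (t * (y - m) + a).
(* F1 is the t-derivative of F and also the y-derivative of K, so that the
   integral of F over [m - A, m + A] depends on t only through boundary terms. *)
Let F1 (t y : R) := expR (s * t ^+ 2 / 2 - (y - m) ^+ 2 / (2 * s)) * (s * t * cos (t * (y - m) + a) - (y - m) * sin (t * (y - m) + a)).
Let K (t y : R) := s * (expR (s * t ^+ 2 / 2 - (y - m) ^+ 2 / (2 * s)) * sin (t * (y - m) + a)).


Let dE (t y : R) : is_derive y 1 (fun y : R => expR (s * t ^+ 2 / 2 - (y - m) ^+ 2 / (2 * s)))
  (- (y - m) / s * expR (s * t ^+ 2 / 2 - (y - m) ^+ 2 / (2 * s))).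
Proof.
pose g := fun y : R => s * t ^+ 2 / 2 - (y - m) ^+ 2 / (2 * s).
have dg : is_derive y 1 g (- (y - m) / s).
  apply: is_derive_eq.
  by rewrite /GRing.scale /=; field; rewrite gt_eqF.
by apply: (is_derive_eq (is_derive1_comp (is_derive_expR (g y)) dg)); rewrite /g mulrC.
Qed.

Let dh (t y : R) : is_derive y 1 (fun y : R => t * (y - m) + a) t.
Proof. by apply: is_derive_eq; rewrite /GRing.scale /=; ring. Qed.

Let cE (t : R) : continuous (fun y : R => expR (s * t ^+ 2 / 2 - (y - m) ^+ 2 / (2 * s))).
Proof. by move=> y; apply/differentiable_continuous/derivable1_diffP; have [] := dE t y. Qed.

Let cC (t : R) : continuous (fun y : R => cos (t * (y - m) + a)).
Proof.
move=> y; apply/differentiable_continuous/derivable1_diffP.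
by have [] := @is_derive1_comp R cos _ y _ _ (is_derive_cos (t * (y - m) + a)) (dh t y).
Qed.

Let cS (t : R) : continuous (fun y : R => sin (t * (y - m) + a)).
Proof.
move=> y; apply/differentiable_continuous/derivable1_diffP.
by have [] := @is_derive1_comp R sin _ y _ _ (is_derive_sin (t * (y - m) + a)) (dh t y).
Qed.

Let cF t : continuous (F t).
Proof. by move=> y; apply: cvgM; [exact: cE|exact: cC]. Qed.

Let cF1 t : continuous (F1 t).
Proof.
move=> y; apply: cvgM; first exact: cE.
apply: (@cvgB _ R^o).
  by apply: cvgM; [exact: cvg_cst|exact: cC].
apply: cvgM; last exact: cS.
by apply: (@cvgB _ R^o); [exact: cvg_id|exact: cvg_cst].
Qed.

Let E_le (T t y : R) : `|t| <= T -> expR (s * t ^+ 2 / 2 - (y - m) ^+ 2 / (2 * s)) <= expR (s * T ^+ 2 / 2).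
Proof.
move=> tT; rewrite ler_expR.
rewrite lerBlDr -[leLHS]addr0 lerD //; last first.
  by rewrite divr_ge0 ?sqr_ge0// mulr_ge0// ltW.
rewrite ler_pM2r// ler_pM2l// -(real_normK (num_real t)).
by rewrite lerXn2r// nnegrE // (le_trans _ tT).
Qed.

Let F1_le (A T t y : R) : `|t| <= T -> `|y - m| <= A -> `|F1 t y| <= expR (s * T ^+ 2 / 2) * (s * T + A).
Proof.
move=> tT yA.
have T0 : 0 <= T by rewrite (le_trans _ tT).
rewrite normrM ler_pM//.
  by rewrite ger0_norm ?expR_ge0// E_le.
rewrite (le_trans (ler_normB _ _))// lerD// !normrM.
  rewrite (gtr0_norm s0) -[leRHS]mulr1 ler_pM ?mulr_ge0 ?(ltW s0)//.
    by rewrite ler_pM ?(ltW s0).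
  by rewrite ler_norml cos_geN1 cos_le1.
rewrite -[leRHS]mulr1 ler_pM//.
by rewrite ler_norml sin_geN1 sin_le1.
Qed.

Let intF A t : mu.-integrable `[m - A, m + A] (EFin \o F t).
Proof.
apply: continuous_compact_integrable; first exact: segment_compact.
by apply: continuous_subspaceT; exact: cF.
Qed.

Let I A t := \int[mu]_(y in `[m - A, m + A]) F t y.

Let dI (A t : R) : 0 < A -> is_derive t 1 (I A) (K t (m + A) - K t (m - A)).
Proof.
move=> A0.
(* Differentiation under the integral needs a domination near t: for |x| < T the derivative [F1] is
   bounded by a constant on the interval. *)
pose T := `|t| + 1.
have tT x : `](- T), T[%classic x -> `|x| <= T.
  by rewrite /= in_itv /= -ltr_norml => /ltW.
have d1 x y : derivable (F ^~ y) x 1.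
  by have [] := is_derive_gauss_wave_freq s a (y - m) x.
have p1 x y : partial1of2 F x y = F1 x y.
  rewrite /partial1of2.
  by rewrite derive1E; have [_ ->] := is_derive_gauss_wave_freq s a (y - m) x.
have FTC : \int[mu]_(y in `[m - A, m + A]) F1 t y = K t (m + A) - K t (m - A).
  rewrite /Rintegral (@continuous_FTC2 R (F1 t) (K t)) //.
  - by rewrite ltrD2l gtrN.
  - by apply: continuous_subspaceT; exact: cF1.
  - have dK y : derivable (K t) y 1.
      by have [] := is_derive_gauss_wave_pos m a y t (lt0r_neq0 s0).
    have cK y : {for y, continuous (K t)}.
      by apply/differentiable_continuous/derivable1_diffP.
    split.
    + by move=> y _; exact: dK.
    + by apply: cvg_at_right_filter; exact: cK.
    + by apply: cvg_at_left_filter; exact: cK.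
  - move=> y _; rewrite derive1E.
    by have [_ ->] := is_derive_gauss_wave_pos m a y t (lt0r_neq0 s0).
have := @cvg_differentiation_under_integral R _ _ mu F `[m - A, m + A] _ t (- T) T _ (fun x _ => intF A x) (fun x y _ _ => d1 x y) (fun=> expR (s * T ^+ 2 / 2) * (s * T + A)) _ _ _.
rewrite -FTC => H.
have {}H : h^-1 *: ((I A) (h + t) - (I A) t) @[h --> 0^'] --> \int[mu]_(y in `[m - A, m + A]) F1 t y.
  under [X in _ --> X]eq_Rintegral do rewrite -p1.
  apply: H => //.
  - by rewrite /= in_itv /= -ltr_norml ltrDl.
  - by move=> _; rewrite mulr_ge0 ?expR_ge0// addr_ge0 ?(ltW A0)// mulr_ge0 ?(ltW s0)// addr_ge0.
  - apply: continuous_compact_integrable; first exact: segment_compact.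
    by apply: continuous_subspaceT; exact: cst_continuous.
  - move=> x y xT; rewrite /= in_itv /= => yA; rewrite p1; apply: F1_le; first exact: tT.
    by rewrite ler_norml; move: yA => /andP[? ?]; apply/andP; split; lra.
apply: DeriveDef.
  apply/cvg_ex; exists (\int[mu]_(y in `[m - A, m + A]) F1 t y).
  by under eq_fun do rewrite scaler1.
by rewrite -derive1E /derive1; apply/cvg_lim.
Qed.

(** Mean value theorem in t: each of the two boundary terms of [dI] carries the Gaussian factor at
    distance A, whence the 2. *)
Let I_near (A t : R) : 0 < A -> 0 <= t -> `|I A t - I A 0| <= t * (2 * s * expR (s * t ^+ 2 / 2)) * expR (- A ^+ 2 / (2 * s)).
Proof.
move=> A0; rewrite le_eqVlt => /predU1P[<-|t0].
  by rewrite subrr normr0 !mul0r.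
have [] := @MVT R (I A) _ 0 t t0 (fun x _ => dI x A0).
  by apply: derivable_within_continuous => x _; have [] := dI x A0.
move=> c; rewrite in_itv/= => /andP[c0 ct] ->.
rewrite subr0 normrM (gtr0_norm t0) mulrC -mulrA ler_pM2l//.
have Kle b : `|b| = A -> `|K c (m + b)| <= s * (expR (s * t ^+ 2 / 2) * expR (- A ^+ 2 / (2 * s))).
  move=> bA; rewrite /K normrM (gtr0_norm s0) ler_pM2l// normrM.
  rewrite -[leRHS]mulr1 ler_pM//; last by rewrite ler_norml sin_geN1 sin_le1.
  rewrite ger0_norm ?expR_ge0// -expRD ler_expR.
  have -> : m + b - m = b by ring.
  rewrite -(real_normK (num_real b)) bA mulNr lerD2r ler_pM2r// ler_pM2l//.
  by rewrite lerXn2r// ?nnegrE ltW.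
rewrite (le_trans (ler_normB _ _))//.
have := Kle A (gtr0_norm A0); have := Kle (- A).
rewrite normrN (gtr0_norm A0) => /(_ erefl) k1 k2.
by rewrite (le_trans (lerD k2 k1))// le_eqVlt; apply/orP; left; apply/eqP; ring.
Qed.

Let E0 t y : expR (s * t ^+ 2 / 2 - (y - m) ^+ 2 / (2 * s)) = expR (s * t ^+ 2 / 2) * expR (- (y - m) ^+ 2 / (2 * s)).
Proof. by rewrite -expRD mulNr. Qed.

(** As the interval grows the boundary terms die, so [F t] and [F 0] have the same integral;
    dividing by [expR (s * t ^+ 2 / 2)] gives the characteristic function by real calculus alone. *)
Lemma integral_gauss_wave t : 0 <= t ->
  mu.-integrable setT (fun y => (expR (- (y - m) ^+ 2 / (2 * s)))%:E) ->
  mu.-integrable setT (fun y => (expR (- (y - m) ^+ 2 / (2 * s)) * cos (t * (y - m) + a))%:E) /\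
  \int[mu]_y (expR (- (y - m) ^+ 2 / (2 * s)) * cos (t * (y - m) + a))
  = expR (- (s * t ^+ 2) / 2) * cos a * \int[mu]_y (expR (- (y - m) ^+ 2 / (2 * s))).
Proof.
move=> t0 intE.
have intEc u : mu.-integrable setT (fun y => (expR (- (y - m) ^+ 2 / (2 * s)) * cos (u * (y - m) + a))%:E).
  apply: (le_integrable _ _ _ intE) => //.
    apply/measurable_EFinP; apply: measurable_funM.
      by apply/measurable_EFinP; exact: measurable_int intE.
    exact: continuous_measurable_fun (@cC u).
  move=> y _; rewrite !abse_EFin lee_fin normrM ler_piMr//.
  by rewrite ler_norml cos_geN1 cos_le1.
have FE u : F u = fun y => expR (s * u ^+ 2 / 2) * (expR (- (y - m) ^+ 2 / (2 * s)) * cos (u * (y - m) + a)).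
  by apply/funext => y; rewrite /F E0 mulrA.
have intFT u : mu.-integrable setT (EFin \o F u).
  by rewrite FE; exact: (integrableZl _ _ (intEc u)).
split; first exact: intEc.
have lim u : I n%:R u @[n --> \oo] --> \int[mu]_y F u y by exact: cvg_Rintegral_itv.
have : (I n%:R t - I n%:R 0) @[n --> \oo] --> (0 : R).
  apply: norm_cvg0.
  apply: (@squeeze_cvgr _ _ _ _ (cst 0) (fun n : nat => t * (2 * s * expR (s * t ^+ 2 / 2)) * expR (- n%:R ^+ 2 / (2 * s)))).
  - by near=> n; rewrite normr_ge0 /=; apply: I_near => //; rewrite ltr0n; near: n; exact: nbhs_infty_gt.
  - exact: cvg_cst.
  - rewrite -[X in _ --> X](mulr0 (t * (2 * s * expR (s * t ^+ 2 / 2)))).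
    apply: cvgM; first exact: cvg_cst.
    apply: (@squeeze_cvgr _ _ _ _ (cst 0) (fun n : nat => (2 * s) * n%:R^-1)).
    + near=> n; rewrite expR_ge0 /=.
      have n0 : (0 : R) < n%:R by rewrite ltr0n; near: n; exact: nbhs_infty_gt.
      rewrite mulNr expRN -[leRHS]invrK lef_pV2 ?posrE ?invr_gt0 ?expR_gt0 ?mulr_gt0 ?invr_gt0//.
      rewrite invfM invrK (le_trans _ (expR_ge1Dx _))//.
      rewrite -[leLHS]add0r lerD// mulrC ler_pM2r ?invr_gt0 ?mulr_gt0//.
      by rewrite expr2 ler_peMl ?(ltW n0)// ler1n -(ltr0n R).
    + exact: cvg_cst.
    + rewrite -[X in _ --> X](mulr0 (2 * s)); apply: cvgM; first exact: cvg_cst.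
      by apply/gtr0_cvgV0; [near=> k; rewrite ltr0n; near: k; exact: nbhs_infty_gt|exact: cvgr_idn].
have h1 : (I n%:R t - I n%:R 0) @[n --> \oo] --> \int[mu]_y F t y - \int[mu]_y F 0 y.
  by apply: cvgB; exact: lim.
move=> h2; have : \int[mu]_y F t y - \int[mu]_y F 0 y = 0 by exact: (cvg_unique _ h1 h2).
move/eqP; rewrite subr_eq0 => /eqP.
have FZ u : \int[mu]_y F u y = expR (s * u ^+ 2 / 2) * \int[mu]_y (expR (- (y - m) ^+ 2 / (2 * s)) * cos (u * (y - m) + a)).
  pose w y := expR (- (y - m) ^+ 2 / (2 * s)) * cos (u * (y - m) + a).
  by rewrite FE -/w; exact: (@RintegralZl _ _ _ mu setT w _ measurableT (intEc u)).
rewrite (FZ t) (FZ 0) expr0n /= mulr0 mul0r expR0 mul1r.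
under [X in _ = X -> _]eq_Rintegral do rewrite mul0r add0r.
rewrite (@RintegralZr _ _ _ mu setT (fun y => expR (- (y - m) ^+ 2 / (2 * s))) (cos a) measurableT intE) => H.
rewrite -[RHS]mulrA mulNr expRN [cos a * _]mulrC -H mulKf//.
by rewrite gt_eqF ?expR_gt0.
Unshelve. all: end_near. Qed.

End gauss_cos.

(** The free phase a covers cosine and sine moments at once: this is the characteristic function in
    real form. *)
Lemma Rintegral_normal_pdf_cos (R : realType) (m sg t a : R) : sg != 0 ->
  (@lebesgue_measure R).-integrable setT (fun y => (normal_pdf m sg y * cos (t * (y - m) + a))%:E) /\
  \int[@lebesgue_measure R]_y (normal_pdf m sg y * cos (t * (y - m) + a))
  = expR (- (sg ^+ 2 * t ^+ 2) / 2) * cos a.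
Proof.
move=> sg0.
(* The mean value argument runs on [0, t]; changing the signs of t and a together leaves the cosine
   unchanged. *)
wlog t0 : t a / 0 <= t => [hw|].
  have [t0|/ltW t0] := leP 0 t; first exact: hw.
  have := hw (- t) (- a); rewrite oppr_ge0 => /(_ t0).
  have -> : (fun y => (normal_pdf m sg y * cos (- t * (y - m) - a))%:E) =
            (fun y => (normal_pdf m sg y * cos (t * (y - m) + a))%:E).
    by apply/funext => y; rewrite mulNr -opprD cosN.
  rewrite sqrrN cosN => -[h1 h2]; split => //; rewrite -h2.
  by apply: eq_Rintegral => y _; rewrite mulNr -opprD cosN.
have s0 : 0 < sg ^+ 2 by rewrite exprn_even_gt0.
have fE y : normal_pdf m sg y = normal_peak sg * expR (- (y - m) ^+ 2 / (2 * sg ^+ 2)).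
  by rewrite normal_pdfE // /normal_fun -mulr_natl.
have pk := normal_peak_gt0 sg0.
have intE : (@lebesgue_measure R).-integrable setT (fun y => (expR (- (y - m) ^+ 2 / (2 * sg ^+ 2)))%:E).
  have := integrableZl measurableT (normal_peak sg)^-1 (integrable_normal_pdf m sg).
  apply: eq_integrable => // y _; rewrite -EFinM fE mulKf// gt_eqF//.
have [h1 h2] := integral_gauss_wave a s0 t0 intE.
have e1 : \int[@lebesgue_measure R]_y expR (- (y - m) ^+ 2 / (2 * sg ^+ 2)) = (normal_peak sg)^-1.
  have : \int[@lebesgue_measure R]_y normal_pdf m sg y = 1.
    by rewrite /Rintegral integral_normal_pdf.
  under eq_Rintegral do rewrite fE.
  rewrite (RintegralZl (normal_peak sg) measurableT intE) => H.
  by apply: (mulfI (lt0r_neq0 pk)); rewrite H divff// gt_eqF.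
split.
  have := integrableZl measurableT (normal_peak sg) h1.
  by apply: eq_integrable => // y _; rewrite -EFinM fE mulrA.
under eq_Rintegral do rewrite fE -mulrA.
by rewrite (RintegralZl (normal_peak sg) measurableT h1) h2 e1 mulrCA divff ?mulr1// gt_eqF.
Qed.

(** * Gaussian densities on R^d *)

(** The factors may change sign, as the deconvolution kernels do: Tonelli for the absolute value
    first gives integrability, then Fubini gives the value, one coordinate at a time. *)
Lemma integral_lebesgue_vec_prod (R : realType) d (g : 'I_d -> R -> R) :
  (forall j, (@lebesgue_measure R).-integrable setT (EFin \o g j)) ->
  (lebesgue_vec d).-integrable setT (fun x : Rvec R d => (\prod_j g j (tnth x j))%:E) /\
  (\int[lebesgue_vec d]_x (\prod_j g j (tnth x j))%:E)%E =
  (\prod_j \int[@lebesgue_measure R]_y g j y)%:E.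
Proof.
elim: d g => [|d IH] g ig.
  have -> : (fun x : Rvec R 0 => (\prod_j g j (tnth x j))%:E) = cst 1%E.
    by apply/funext => x; rewrite big_ord0.
  split.
    exact: finite_measure_integrable_cst.
  by rewrite /= integral_dirac // diracT mul1e !big_ord0.
set f := fun x : Rvec R d.+1 => (\prod_j g j (tnth x j))%:E.
have [ih1 ih2] := IH (fun j => g (lift ord0 j)) (fun j => ig (lift ord0 j)).
pose G := fun t : Rvec R d => \prod_j g (lift ord0 j) (tnth t j).
have mf : measurable_fun setT f.
  apply/measurable_EFinP; apply: measurable_prod => j _.
  apply: (measurableT_comp (f := g j)); last exact: measurable_tnth.
  by apply/measurable_EFinP; exact: measurable_int (ig j).
have fE : f \o @cons_vec R d = fun xt => (g ord0 xt.1 * G xt.2)%:E.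
  apply/funext => -[x t]; rewrite /f /= big_ord_recl /G /=; congr (_ * _)%:E.
  by apply: eq_bigr => j _; rewrite /cons_vec tnthS.
have mfc : measurable_fun setT (f \o @cons_vec R d).
  by apply: measurableT_comp => //; exact: measurable_funP.
pose c := (\prod_j \int[@lebesgue_measure R]_y g (lift ord0 j) y).
have ifc : ((@lebesgue_measure R) \x (lebesgue_vec d))%E.-integrable setT (f \o @cons_vec R d).
  apply/integrable12ltyP => //.
  rewrite fE /=.
  under eq_integral => x _.
    under eq_integral => t _ do rewrite normrM EFinM.
    rewrite ge0_integralZl_EFin //; last first.
      by apply/measurable_EFinP; apply: measurableT_comp => //; apply/measurable_EFinP; exact: measurable_int ih1.
    over.
  have /integrableP[_ h1] := ih1; have /integrableP[_ h2] := ig ord0.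
  have : (0 <= \int[lebesgue_vec d]_t `|(G t)%:E|)%E by exact: integral_ge0.
  move: h1; rewrite -/G; set A := (integral _ _ _) => h1 h1'.
  have Af : A \is a fin_num by rewrite ge0_fin_numE.
  rewrite -(fineK Af) ge0_integralZr//.
  - by rewrite lte_mul_pinfty ?ltry ?integral_ge0// ge0_fin_numE ?integral_ge0.
  - by apply/measurable_EFinP; apply: measurableT_comp => //; apply/measurable_EFinP; exact: measurable_int (ig ord0).
  - by rewrite lee_fin fine_ge0.
split.
  apply: (@integrable_pushforward _ _ _ _ R _ (measurable_funP _) ((@lebesgue_measure R) \x (lebesgue_vec d))%E setT f) => //.
rewrite /= (@integral_pushforward _ _ _ _ R (@cons_vec R d) _ ((@lebesgue_measure R) \x (lebesgue_vec d))%E setT f) //.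
rewrite preimage_setT -integral12_prod_meas1// fE /fubini_F /=.
under eq_integral => x _.
  under eq_integral => t _ do rewrite EFinM.
  rewrite integralZl// ih2.
  over.
rewrite integralZr//; last exact: ig.
by rewrite big_ord_recl EFinM /Rintegral fineK//; exact: (integrable_fin_num _ (ig _)).
Qed.

Lemma normal_pdf_expM (R : realType) (m sg lam x : R) : sg != 0 ->
  normal_pdf m sg x * expR (lam * x) =
  expR (lam * m + lam ^+ 2 * sg ^+ 2 / 2) * normal_pdf (m + lam * sg ^+ 2) sg x.
Proof.
move=> sg0; rewrite !normal_pdfE// /normal_fun -[LHS]mulrA [RHS]mulrCA -!expRD.
congr (_ * expR _); rewrite -[sg ^+ 2 *+ 2]mulr_natr; field.
by rewrite sg0.
Qed.

Lemma sqrtr_prod (R : rcfType) n (f : 'I_n -> R) : (forall i, 0 <= f i) ->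
  Num.sqrt (\prod_i f i) = \prod_i Num.sqrt (f i).
Proof.
move=> f0; elim: n f f0 => [|n IH] f f0; first by rewrite !big_ord0 sqrtr1.
by rewrite !big_ord_recl sqrtrM// IH.
Qed.

Lemma loewner_diag_bounds (R : realType) d (S : 'M[R]_d) (k K : R) :
  loewner_le k%:M S -> loewner_le S K%:M -> forall j, k <= S j j <= K.
Proof.
have diag_ge0 (A : 'M[R]_d) j : psdmx A -> 0 <= A j j.
  move=> [_ /(_ (delta_mx 0 j))]; rewrite -rowE trmx_delta -colE !mxE.
  done.
move=> h1 h2 j; have := diag_ge0 _ j h1; have := diag_ge0 _ j h2.
by rewrite !mxE eqxx !mulr1n !subr_ge0 => -> ->.
Qed.

(** A diagonal covariance makes everything tensorise: deconvolution, exponential moments and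
    Lipschitz bounds reduce to dimension one. *)
Lemma gauss_density_prod (R : realType) d (S : 'M[R]_d) (x th : Rvec R d) :
  is_diag_mx S -> (forall j, 0 < S j j) ->
  gauss_density S (row_of_vec x - row_of_vec th) =
  \prod_j normal_pdf (tnth th j : R) (Num.sqrt (S j j)) (tnth x j).
Proof.
move=> /is_diag_mxP dS S0.
pose s := \row_j S j j.
have SE : S = diag_mx s.
  apply/matrixP => i j; rewrite !mxE; have [->|ij] := eqVneq i j; first by rewrite mulr1n.
  by rewrite mulr0n dS.
have iS : invmx S = diag_mx (\row_j (S j j)^-1).
  have h : S *m diag_mx (\row_j (S j j)^-1) = 1%:M.
    rewrite SE mulmx_diag; apply/matrixP => i j; rewrite !mxE.
    have [->|//] := eqVneq i j; rewrite !mulr1n !eqxx mulr1n divff// gt_eqF//.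
  have Su : S \in unitmx by have [] := mulmx1_unit h.
  by rewrite -[LHS]mulmx1 -h mulKmx.
have Q v : (v *m invmx S *m v^T) ord0 ord0 = \sum_j v ord0 j ^+ 2 / S j j.
  rewrite iS mxE; apply: eq_bigr => j _.
  rewrite mul_mx_diag !mxE; ring.
have D : (2 * pi) ^+ d * \det S = \prod_j (S j j * pi *+ 2).
  rewrite SE det_diag -[in X in _ ^+ X](card_ord d) -prodr_const -big_split /=.
  by apply: eq_bigr => j _; rewrite !mxE eqxx mulr1n -[RHS]mulr_natr; ring.
rewrite /gauss_density D sqrtr_prod; last first.
  by move=> j; rewrite mulrn_wge0// mulr_ge0 ?pi_ge0// ltW.
rewrite Q -prodfV -sumrN mulr_suml expR_sum -big_split /=.
apply: eq_bigr => j _.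
rewrite normal_pdfE ?gt_eqF ?sqrtr_gt0// /normal_peak /normal_fun mulrC sqr_sqrtr ?(ltW (S0 j))//.
congr (_ * expR _); rewrite !mxE -mulr_natr; field.
by rewrite gt_eqF.
Qed.

(** * Independent observations with densities *)

Section transfer_integral.
Local Open Scope ereal_scope.
Import HBNNSimple.
Context d1 d2 (Om : measurableType d1) (T : measurableType d2) (R : realType).
Variables (P : {measure set Om -> \bar R}) (mu : {measure set T -> \bar R}).
Variables (X : Om -> T) (Y : Om -> R) (c : R).
Hypotheses (mX : measurable_fun setT X) (mY : measurable_fun setT Y).
Hypotheses (Y0 : forall w, (0 <= Y w)%R) (c0 : (0 <= c)%R).
Hypothesis XY : forall A, measurable A ->
  \int[P]_w ((\1_A (X w) : R) * Y w)%:E = mu A * c%:E.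

Let transfer_nnsfun (h : {nnsfun T >-> R}) :
  \int[P]_w (h (X w) * Y w)%:E = \int[mu]_x (h x)%:E * c%:E.
Proof.
have -> : \int[mu]_x (h x)%:E = \sum_(r \in range h) r%:E * mu (h @^-1` [set r]).
  by rewrite integralT_nnsfun sintegralE.
rewrite ge0_mule_fsuml; last by move=> r; exact: nnsfun_mulemu_ge0.
have -> : (fun w => (h (X w) * Y w)%:E) = (fun w => \sum_(r \in range h) (r * (\1_(h @^-1` [set r]) (X w) * Y w))%:E).
  apply/funext => w; rewrite {1}fimfunE fsumEFin//; congr EFin.
  rewrite mulrC mulr_fsumr; apply: eq_fsbigr => r _.
  by rewrite mulrCA [(Y w * _)%R]mulrC.
have m1 r : measurable_fun setT (fun w => (\1_(h @^-1` [set r]) (X w) * Y w : R)%R).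
  by apply: measurable_funM => //; apply: measurableT_comp.
rewrite ge0_integral_fsum//.
- apply: eq_fsbigr => r /set_mem [x _ <-].
  under eq_integral do rewrite EFinM.
  rewrite ge0_integralZl_EFin//; last 2 first.
  + by move=> w _; rewrite lee_fin mulr_ge0.
  + by apply/measurable_EFinP.
  by rewrite XY// muleA.
- move=> r; apply/measurable_EFinP; exact: measurable_funM.
- move=> r w _; have := nnfun_muleindic_ge0 h r (X w).
  rewrite !lee_fin => H; rewrite mulrA mulr_ge0//.
Qed.

(** From indicators to nonnegative functions by simple approximation and monotone convergence. The
    weight [Y] has two uses: a density, with [X] the identity, and the product of the other
    observations in [integral_prod_independent]. *)
Lemma ge0_integral_transfer (g : T -> R) : measurable_fun setT g -> (forall x, (0 <= g x)%R) ->
  \int[P]_w (g (X w) * Y w)%:E = \int[mu]_x (g x)%:E * c%:E.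
Proof.
move=> mg g0.
have mg' : measurable_fun setT (EFin \o g) by exact/measurable_EFinP.
pose g_ := nnsfun_approx measurableT mg'.
have cvgg x : (g_ n x)%:E @[n --> \oo] --> (g x)%:E.
  by apply: cvg_nnsfun_approx => //= y _; rewrite lee_fin.
have nd x a b : (a <= b)%N -> (g_ a x <= g_ b x)%R.
  by move=> ab; exact/lefP/nd_nnsfun_approx.
have -> : \int[mu]_x (g x)%:E = limn (fun n => \int[mu]_x (g_ n x)%:E).
  rewrite -monotone_convergence//.
  - by apply: eq_integral => x _; apply/esym/cvg_lim => //.
  - by move=> n; apply/measurable_EFinP.
  - by move=> n x _; rewrite lee_fin.
  - by move=> x _ a b ab; rewrite lee_fin nd.
have -> : \int[P]_w (g (X w) * Y w)%:E = limn (fun n => \int[P]_w (g_ n (X w) * Y w)%:E).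
  rewrite -monotone_convergence//.
  - apply: eq_integral => w _; apply/esym/cvg_lim => //.
    by have := cvgeZr (isT : (Y w)%:E \is a fin_num) (cvgg (X w)).
  - by move=> n; apply/measurable_EFinP; apply: measurable_funM => //; exact: measurableT_comp.
  - by move=> n x _; rewrite lee_fin mulr_ge0.
  - by move=> x _ a b ab; rewrite lee_fin ler_wpM2r// nd.
rewrite -limeMr//; last first.
  apply/ereal_nondecreasing_is_cvgn => a b ab; apply: ge0_le_integral => //.
  - by move=> x _; rewrite lee_fin.
  - by apply/measurable_EFinP.
  - by apply/measurable_EFinP.
  - by move=> x _; rewrite lee_fin nd.
by congr (limn _); apply/funext => n /=; rewrite transfer_nnsfun.
Qed.
End transfer_integral.


Lemma ge0_integral_density d (T : measurableType d) (R : realType)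
    (mu nu : {measure set T -> \bar R}) (f : T -> R) :
  measurable_fun setT f -> (forall x, 0 <= f x) ->
  (forall A, measurable A -> nu A = \int[mu]_(x in A) (f x)%:E)%E ->
  forall g : T -> R, measurable_fun setT g -> (forall x, 0 <= g x) ->
  (\int[nu]_x (g x)%:E = \int[mu]_x (g x * f x)%:E)%E.
Proof.
move=> mf f0 nuE g mg g0.
rewrite -[LHS]mule1; apply/esym.
apply: (@ge0_integral_transfer _ _ _ _ _ mu nu id f 1) => // A mA.
rewrite mule1 nuE// [RHS]integral_mkcond; apply: eq_integral => x _.
by rewrite patchE indicE; case: (x \in A); rewrite ?mul1r ?mul0r.
Qed.

(** Independence speaks of events only. The induction on k frees the functions one at a time: those
    of index at least k are still indicators, and [ge0_integral_transfer] replaces the indicator at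
    i0 by an arbitrary function. *)
Lemma integral_prod_independent (R : realType) dO (Om : measurableType dO) (P : probability Om R)
   dT (T : measurableType dT) n (X : 'I_n -> {RV P >-> T}) (g : 'I_n -> T -> R) (e : 'I_n -> R) :
  mutually_independent X ->
  (forall i, measurable_fun setT (g i)) -> (forall i x, 0 <= g i x) ->
  (forall i, (\int[P]_w (g i (X i w))%:E = (e i)%:E)%E) ->
  (\int[P]_w (\prod_i g i (X i w))%:E = (\prod_i e i)%:E)%E.
Proof.
move=> indX mg g0 ge.
suff main : forall k, (k <= n)%N -> forall (h : 'I_n -> T -> R) (a : 'I_n -> R),
    (forall i, measurable_fun setT (h i)) -> (forall i x, 0 <= h i x) ->
    (forall i, (\int[P]_w (h i (X i w))%:E = (a i)%:E)%E) ->
    (forall i : 'I_n, (k <= i)%N -> exists2 B, measurable B & h i = \1_B) ->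
    (\int[P]_w (\prod_i h i (X i w))%:E = (\prod_i a i)%:E)%E.
  by apply: (main n) => // i; rewrite leqNgt ltn_ord.
elim=> [_|k IH kn] h a mh h0 ha hB.
  have hB' : forall i : 'I_n, {B | measurable B /\ h i = \1_B}.
    by move=> i; apply: cid; have [//|B mB hE] := hB i; exists B.
  pose B i := sval (hB' i).
  have mB i : measurable (B i) by have [] := svalP (hB' i).
  have hE i : h i = \1_(B i) by have [] := svalP (hB' i).
  have mXB i : measurable (X i @^-1` B i) by rewrite -[X in measurable X]setTI; exact: measurable_funP.
  have ind1 A : measurable A -> (\int[P]_w (\1_A w)%:E = P A)%E.
    by move=> mA; rewrite integral_indic// setIT.
  have aE i : P (X i @^-1` B i) = (a i)%:E.
    by rewrite -ha hE -ind1.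
  rewrite -prodEFin; under eq_bigr do rewrite -aE.
  have -> : (\prod_(i < n) P (X i @^-1` B i))%E = (\prod_(i in [set: 'I_n]%SET) P (X i @^-1` B i))%E.
    by apply: eq_bigl => i; rewrite finset.in_setT.
  rewrite -indX// -ind1; last first.
    by apply: fin_bigcap_measurable => // i _.
  apply: eq_integral => w _; congr EFin.
  rewrite indicE; have [/set_mem wB|/negP nwB] := boolP (w \in _).
    by apply: big1 => i _; rewrite hE indicE mem_set//; apply: (wB i) => /=; rewrite finset.in_setT.
  have [i nBi] : exists i, ~ B i (X i w).
    apply: contrapT => nex; apply: nwB; apply/mem_set => i _ /=; apply: contrapT => nBi; apply: nex.
    by exists i.
  by rewrite (bigD1 i)//= hE indicE memNset// mul0r.
pose i0 := Ordinal kn.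
have a0 i : 0 <= a i by rewrite -lee_fin -ha; apply: integral_ge0 => w _; rewrite lee_fin.
pose Y w := \prod_(i | i != i0) h i (X i w).
under eq_integral do rewrite (bigD1 i0)//= -/(Y _).
have mX i : measurable_fun setT (X i) by exact: measurable_funP.
rewrite (@ge0_integral_transfer _ _ _ _ _ P (distribution P (X i0)) (X i0) Y (\prod_(i | i != i0) a i))//.
- rewrite [in RHS](bigD1 i0)//= EFinM; congr (_ * _)%E.
  rewrite -ha ge0_integral_pushforward//; first by apply/measurable_EFinP.
  by move=> x _; rewrite lee_fin.
- rewrite /Y; under eq_fun do rewrite big_mkcond/=.
  by apply: measurable_prod => i _; case: (i != i0) => //; apply: measurableT_comp.
- by move=> w; apply: prodr_ge0 => i _.
move=> A mA.
have mXA : measurable (X i0 @^-1` A) by rewrite -[X in measurable X]setTI; exact: mX.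
pose h' i : T -> R := if i == i0 then \1_A else h i.
pose a' i := if i == i0 then fine (P (X i0 @^-1` A)) else a i.
have := IH (ltnW kn) h' a'.
have e1 w : \prod_i h' i (X i w) = \1_A (X i0 w) * Y w.
  rewrite (bigD1 i0)//= /h' eqxx; congr (_ * _).
  by apply: eq_bigr => i /negbTE ->.
have e2 : \prod_i a' i = fine (P (X i0 @^-1` A)) * \prod_(i | i != i0) a i.
  rewrite (bigD1 i0)//= /a' eqxx; congr (_ * _).
  by apply: eq_bigr => i /negbTE ->.
have <- : (fun w => (\prod_i h' i (X i w))%:E) = (fun w => (\1_A (X i0 w) * Y w)%:E).
  by apply/funext => w; rewrite e1.
rewrite e2 EFinM fineK ?fin_num_measure//; apply.
- by move=> i; rewrite /h'; case: ifP.
- by move=> i x; rewrite /h'; case: ifP.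
- move=> i; rewrite /h' /a'; case: ifPn => [/eqP->|//].
  by rewrite fineK ?fin_num_measure// -[X in P X]setIT -integral_indic.
- move=> i; rewrite leq_eqVlt => /predU1P[ki|ki]; rewrite /h'.
    by exists A => //; case: ifPn => // /eqP; case; apply: val_inj.
  by case: ifPn => _; [exists A|exact: hB].
Qed.

Lemma integral_has_density (R : realType) d dO (Om : measurableType dO) (P : probability Om R)
   (X : {RV P >-> Rvec R d}) (f g : Rvec R d -> R) :
  has_density X f -> measurable_fun setT f -> (forall x, 0 <= f x) ->
  measurable_fun setT g -> (forall x, 0 <= g x) ->
  (\int[P]_w (g (X w))%:E = \int[lebesgue_vec d]_x (g x * f x)%:E)%E.
Proof.
move=> Xf mf f0 mg g0.
rewrite -(@ge0_integral_density _ _ R (lebesgue_vec d) (distribution P X) f)//.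
rewrite ge0_integral_pushforward//; first by apply/measurable_EFinP.
by move=> x _; rewrite lee_fin.
Qed.

Lemma markov_expR dO (Om : measurableType dO) (R : realType) (P : probability Om R)
    (q : Om -> R) (t a : R) :
  measurable_fun setT q -> (forall w, 0 <= q w) -> (\int[P]_w (q w)%:E <= (expR t)%:E)%E ->
  let E := [set w | expR (t + a) <= q w] in
  measurable E /\ (P E <= (expR (- a))%:E)%E.
Proof.
move=> mq q0 qt E.
have mE : measurable E.
  have -> : E = [set: Om] `&` q @^-1` `[expR (t + a), +oo[.
    by rewrite setTI; apply/seteqP; split => w /=; rewrite in_itv/= andbT.
  exact: mq.
split => //.
have := @le_integral_abse _ _ _ P setT measurableT (EFin \o q) (expR (t + a)).
move=> /(_ _ (expR_gt0 _)).
have -> : [set: Om] `&` [set x | ((expR (t + a))%:E <= `|(EFin \o q) x|)%E] = E.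
  by rewrite setTI; apply/seteqP; split => w /=; rewrite ger0_norm ?q0.
have -> : (\int[P]_x `|(EFin \o q) x| = \int[P]_x (q x)%:E)%E.
  by apply: eq_integral => w _; rewrite /= ger0_norm ?q0.
move=> /(_ _)/le_trans H.
have {}H : ((expR (t + a))%:E * P E <= (expR t)%:E)%E by apply: H qt; apply/measurable_EFinP.
have PE : P E = (fine (P E))%:E by rewrite fineK// fin_num_measure.
move: H; rewrite PE -EFinM !lee_fin.
rewrite expRD -mulrA ger_pMr ?expR_gt0//.
by rewrite mulrC -ler_pdivlMr ?expR_gt0// expRN div1r.
Qed.

(** Chernoff bound in multiplicative form: by independence the product has expectation at most
    [expR t] to the power n, and Markov's inequality concludes. *)
Lemma prod_density_tail (R : realType) d dO (Om : measurableType dO) (P : probability Om R) n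
   (X : 'I_n -> {RV P >-> Rvec R d}) (f g : 'I_n -> Rvec R d -> R) (t a : R) :
  mutually_independent X -> (forall i, has_density (X i) (f i)) ->
  (forall i, measurable_fun setT (f i)) -> (forall i x, 0 <= f i x) ->
  (forall i, measurable_fun setT (g i)) -> (forall i x, 0 <= g i x) ->
  (forall i, (\int[lebesgue_vec d]_x (g i x * f i x)%:E <= (expR t)%:E)%E) ->
  let E := [set w | expR (n%:R * t + a) <= \prod_i g i (X i w)] in
  measurable E /\ (P E <= (expR (- a))%:E)%E.
Proof.
move=> indX Xf mf f0 mg g0 gt E.
pose e i := fine (\int[P]_w (g i (X i w))%:E)%E.
have ge0 i : (0 <= \int[P]_w (g i (X i w))%:E)%E by apply: integral_ge0 => w _; rewrite lee_fin.
have gE i : (\int[P]_w (g i (X i w))%:E <= (expR t)%:E)%E.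
  by rewrite (integral_has_density (Xf i)).
have eE i : (\int[P]_w (g i (X i w))%:E = (e i)%:E)%E.
  by rewrite fineK// ge0_fin_numE// (le_lt_trans (gE i))// ltry.
have EE := integral_prod_independent indX mg g0 eE.
have mp : measurable_fun setT (fun w => \prod_i g i (X i w)).
  by apply: measurable_prod => i _; apply: measurableT_comp => //; exact: measurable_funP.
apply: markov_expR => //.
  by move=> w; apply: prodr_ge0.
rewrite EE lee_fin expRM_natl -[in leRHS](card_ord n) -prodr_const.
by apply: ler_prod => i _; rewrite -!lee_fin -eE ge0/=; exact: gE.
Qed.

(** * Coupling along a partition of unity *)

Lemma exists_probability_density d (T : measurableType d) (R : realType)
    (mu : {measure set T -> \bar R}) (k : T -> R) :
  measurable_fun setT k -> (forall x, 0 <= k x) -> (\int[mu]_x (k x)%:E = 1)%E ->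
  exists gamma : probability T R, forall A, measurable A -> (gamma A = \int[mu]_(x in A) (k x)%:E)%E.
Proof.
move=> mk k0 k1.
pose nu (A : set T) := (\int[mu]_(x in A) (k x)%:E)%E.
have nu0 : nu set0 = 0%E by rewrite /nu integral_set0.
have nu_ge0 A : (0 <= nu A)%E by apply: integral_ge0 => x _; rewrite lee_fin.
have nusa : semi_sigma_additive nu.
  move=> F mF tF mUF; rewrite /nu ge0_integral_bigcup//.
  - apply: is_cvg_ereal_nneg_natsum_cond => n _ _; exact: nu_ge0.
  - by apply/measurable_EFinP; apply: measurable_funTS.
  - by move=> x _; rewrite lee_fin.
pose M := isMeasure.Build _ _ _ nu nu0 nu_ge0 nusa.
pose nuM : {measure set T -> \bar R} := HB.pack nu M.
pose Pm := @Measure_isProbability.Build _ _ R nuM k1.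
pose nuP : probability T R := HB.pack nu M Pm.
by exists nuP.
Qed.

Lemma integral_tensor d1 d2 (T1 : measurableType d1) (T2 : measurableType d2) (R : realType)
    (G : probability T1 R) (H : probability T2 R) (u : T1 -> R) (v : T2 -> R) :
  measurable_fun setT u -> (forall x, 0 <= u x) -> measurable_fun setT v -> (forall x, 0 <= v x) ->
  (\int[G \x H]_z (u z.1 * v z.2)%:E = \int[G]_x (u x)%:E * \int[H]_y (v y)%:E)%E.
Proof.
move=> mu u0 mv v0.
have mv' : measurable_fun setT (EFin \o v) by apply/measurable_EFinP.
have mu' : measurable_fun setT (EFin \o u) by apply/measurable_EFinP.
have v0' : (0 <= \int[H]_y (v y)%:E)%E by apply: integral_ge0 => y _; rewrite lee_fin.
rewrite fubini_tonelli1.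
- rewrite -ge0_integralZr//; last by move=> x _; rewrite lee_fin.
  apply: eq_integral => x _; rewrite /fubini_F /=.
  under eq_integral do rewrite EFinM.
  by rewrite ge0_integralZl_EFin//; move=> y _; rewrite lee_fin.
- apply/measurable_EFinP; apply: measurable_funM.
    exact: (measurableT_comp mu measurable_fst).
  exact: (measurableT_comp mv measurable_snd).
- by move=> z; rewrite lee_fin mulr_ge0.
Qed.

Lemma integral_sum_tensor d1 d2 (T1 : measurableType d1) (T2 : measurableType d2) (R : realType)
    (G : probability T1 R) (H : probability T2 R) (J : finType)
    (u : J -> T1 -> R) (v : J -> T2 -> R) (U V : J -> R) :
  (forall j, measurable_fun setT (u j)) -> (forall j x, 0 <= u j x) ->
  (forall j, measurable_fun setT (v j)) -> (forall j x, 0 <= v j x) ->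
  (forall j, \int[G]_x (u j x)%:E = (U j)%:E)%E ->
  (forall j, \int[H]_x (v j x)%:E = (V j)%:E)%E ->
  (\int[G \x H]_z (\sum_j u j z.1 * v j z.2)%:E = (\sum_j U j * V j)%:E)%E.
Proof.
move=> mu u0 mv v0 uU vV.
under eq_integral do rewrite -sumEFin.
rewrite ge0_integral_sum//.
- rewrite -sumEFin; apply: eq_bigr => j _.
  by rewrite integral_tensor// uU vV.
- move=> j; apply/measurable_EFinP; apply: measurable_funM.
    exact: (measurableT_comp (mu j) measurable_fst).
  exact: (measurableT_comp (mv j) measurable_snd).
- by move=> j z _; rewrite lee_fin mulr_ge0.
Qed.

Lemma sum_option (V : nmodType) (I : finType) (f : option I -> V) :
  \sum_j f j = f None + \sum_z f (Some z).
Proof.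
rewrite (bigD1 None)//=; congr (_ + _).
by rewrite (reindex_omap Some id) //=; [apply: eq_bigl => z; rewrite eqxx|case].
Qed.

Section coupling_cost.
Context (R : realType) (d : nat) (G H : probability (Rvec R d) R) (I : finType).
Variables (w e : I -> Rvec R d -> R) (K : set (Rvec R d)) (E B tau : R).
Hypotheses (mw : forall z, measurable_fun setT (w z)) (w0 : forall z x, 0 <= w z x)
  (w1 : forall x, \sum_z w z x = 1)
  (me : forall z, measurable_fun setT (e z)) (e0 : forall z x, 0 <= e z x)
  (B0 : 0 <= B) (weE : forall x, \sum_z w z x * e z x <= E)
  (mK : measurable K) (GK : G K = 1%E) (HK : H K = 1%E)
  (tau01 : 0 < tau < 1)
  (pq : forall z, \int[G]_x w z x - \int[H]_x w z x <= tau).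
Let cost (xy : Rvec R d * Rvec R d) : R := \sum_(j < d) ((tnth xy.1 j : R) - (tnth xy.2 j : R)) ^+ 2.
Hypotheses (cost_split : forall x y z, K x -> K y -> cost (x, y) <= e z x + e z y)
  (cost_le : forall x y, K x -> K y -> cost (x, y) <= B).

Let bint (Q : probability (Rvec R d) R) (f : Rvec R d -> R) C :
  measurable_fun setT f -> (forall x, 0 <= f x <= C) ->
  (\int[Q]_x (f x)%:E)%E = (\int[Q]_x f x)%:E /\ 0 <= \int[Q]_x f x <= C.
Proof.
move=> mf f0C.
have mf' : measurable_fun setT (EFin \o f) by apply/measurable_EFinP.
have leC : (\int[Q]_x (f x)%:E <= C%:E)%E.
  rewrite -[leRHS]mule1 -(@probability_setT _ _ _ Q) -integral_cst//.
  apply: ge0_le_integral => //.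
  - by move=> x _; have /andP[] := f0C x; rewrite lee_fin.
  - by move=> x _; have /andP[] := f0C x; rewrite lee_fin.
have ge0 : (0 <= \int[Q]_x (f x)%:E)%E.
  by apply: integral_ge0 => x _; have /andP[] := f0C x; rewrite lee_fin.
have EE : (\int[Q]_x (f x)%:E)%E = (\int[Q]_x f x)%:E.
  by rewrite /Rintegral fineK// ge0_fin_numE// (le_lt_trans leC) ?ltry.
by split=> //; rewrite -!lee_fin -EE ge0 leC.
Qed.

Let w_le1 z x : 0 <= w z x <= 1.
Proof. by rewrite w0 /= -(w1 x) (bigD1 z)//= lerDl sumr_ge0. Qed.

Let p z := \int[G]_x w z x.
Let q z := \int[H]_x w z x.
Let p0 z : 0 <= p z. Proof. by have [_ /andP[]] := bint G (mw z) (w_le1 z). Qed.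
Let q0 z : 0 <= q z. Proof. by have [_ /andP[]] := bint H (mw z) (w_le1 z). Qed.

Let sum_int (Q : probability (Rvec R d) R) : \sum_z \int[Q]_x w z x = 1.
Proof.
apply: EFin_inj; rewrite -sumEFin.
under eq_bigr => z _ do rewrite -(bint Q (mw z) (w_le1 z)).1.
rewrite -ge0_integral_sum//.
- under eq_integral do rewrite sumEFin w1.
  by rewrite integral_cst// mul1e; exact: probability_setT.
- by move=> z; apply/measurable_EFinP.
- by move=> z x _; rewrite lee_fin.
Qed.

(** The common mass is shrunk by 1 - tau so that the leftover mass [rho] is at least tau, hence
    positive: the coupling divides by it, even when G and H have equal moments. *)
Let m z := (1 - tau) * Num.min (p z) (q z).
Let tau0 : 0 < tau. Proof. by case/andP: tau01. Qed.
Let tau1 : 0 < 1 - tau. Proof. by case/andP: tau01 => _; rewrite subr_gt0. Qed.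
Let m0 z : 0 <= m z.
Proof. by rewrite mulr_ge0 ?(ltW tau1)// le_min p0 q0. Qed.
Let mp z : m z <= p z.
Proof.
rewrite (@le_trans _ _ (Num.min (p z) (q z)))//; last by rewrite ge_min lexx.
by rewrite ler_piMl ?le_min ?p0 ?q0// lerBlDr lerDl ltW.
Qed.
Let mq z : m z <= q z.
Proof.
rewrite (@le_trans _ _ (Num.min (p z) (q z)))//; last by rewrite ge_min lexx orbT.
by rewrite ler_piMl ?le_min ?p0 ?q0// lerBlDr lerDl ltW.
Qed.

Let rho := 1 - \sum_z m z.
Let rho_ge : tau <= rho.
Proof.
rewrite lerBrDr -lerBrDl -mulr_sumr -[leRHS]mulr1 ler_wpM2l ?(ltW tau1)//.
rewrite -(sum_int G); apply: ler_sum => z _; by rewrite ge_min lexx.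
Qed.
Let rho_gt0 : 0 < rho. Proof. exact: lt_le_trans tau0 rho_ge. Qed.
(** The one-sided bound p z - q z <= tau gives min (p z, q z) >= p z - tau, and the p z sum to 1.
    The additional tau pays for the shrinking in [m]. *)
Let rho_le : rho <= (#|I|%:R + 1) * tau.
Proof.
have h : 1 - #|I|%:R * tau <= \sum_z Num.min (p z) (q z).
  rewrite -[X in X - _](sum_int G) mulr_natl -sumr_const -sumrB; apply: ler_sum => z _.
  rewrite le_min lerBlDr lerDl (ltW tau0)/=.
  by rewrite lerBlDr -lerBlDl; exact: pq.
have h1 : \sum_z Num.min (p z) (q z) <= 1.
  by rewrite -(sum_int G); apply: ler_sum => z _; rewrite ge_min lexx.
rewrite /rho -mulr_sumr.
set s := \sum_z _ in h h1 *.
have : tau * s <= tau by rewrite ger_pMr.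
lra.
Qed.

Let a x := \sum_z m z / p z * w z x.
Let b x := \sum_z m z / q z * w z x.

(** Cells of zero mass are included: the inverse of 0 is 0. *)
Let ratio01 (u v : R) : 0 <= u -> u <= v -> 0 <= u / v <= 1.
Proof.
move=> u0 uv; have v0 := le_trans u0 uv.
rewrite divr_ge0//=; have [->|vn] := eqVneq v 0; first by rewrite invr0 mulr0.
by rewrite ler_pdivrMr ?mul1r// lt_neqAle eq_sym vn.
Qed.

Let a01 x : 0 <= a x <= 1.
Proof.
apply/andP; split.
  by apply: sumr_ge0 => z _; rewrite mulr_ge0//; have /andP[] := ratio01 (m0 z) (mp z).
rewrite -(w1 x); apply: ler_sum => z _; rewrite ler_piMl//.
by have /andP[] := ratio01 (m0 z) (mp z).
Qed.
Let b01 x : 0 <= b x <= 1.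
Proof.
apply/andP; split.
  by apply: sumr_ge0 => z _; rewrite mulr_ge0//; have /andP[] := ratio01 (m0 z) (mq z).
rewrite -(w1 x); apply: ler_sum => z _; rewrite ler_piMl//.
by have /andP[] := ratio01 (m0 z) (mq z).
Qed.

Let mulK (u v : R) : 0 <= u -> u <= v -> u / v * v = u.
Proof.
move=> u0 uv; have [v0|v0] := eqVneq v 0; last by rewrite divfK.
by rewrite v0 mulr0; apply/eqP; rewrite eq_le u0 -v0 uv.
Qed.

(* The coupling has density k with respect to the product of G and H: a mass m_z
   is coupled independently inside each w_z, and the leftover mass, with index
   [None], is coupled independently as a whole. *)
Let u (j : option I) x := if j is Some z then m z / p z * w z x else (1 - a x) / rho.
Let v (j : option I) y := if j is Some z then w z y / q z else 1 - b y.
(** The crude bound B is split evenly so that for every index, [None] included, the cost is at most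
    e' at x plus e' at y. *)
Let e' (j : option I) x := if j is Some z then e z x else B / 2.
Let k xy := \sum_j u j xy.1 * v j xy.2.
(** The quotient is 1, except for q z = 0, where it is 0 and [v (Some z)] vanishes identically. *)
Let V (j : option I) := if j is Some z then q z / q z else rho.
Let U (j : option I) := if j is Some z then m z else 1.

Let ma : measurable_fun setT a.
Proof. by apply: measurable_sum => z; apply: measurable_funM. Qed.
Let mb : measurable_fun setT b.
Proof. by apply: measurable_sum => z; apply: measurable_funM. Qed.
Let mu j : measurable_fun setT (u j).
Proof. by case: j => [z|]; apply: measurable_funM => //; apply: measurable_funB. Qed.
Let mv j : measurable_fun setT (v j).
Proof. by case: j => [z|]; [apply: measurable_funM|apply: measurable_funB]. Qed.
Let me' j : measurable_fun setT (e' j).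
Proof. by case: j => [z|]; [exact: me|exact: measurable_cst]. Qed.
Let e'0 j x : 0 <= e' j x.
Proof. by case: j => [z|]; rewrite //= divr_ge0. Qed.

Let weE1 z x : 0 <= w z x * e z x <= E.
Proof.
rewrite mulr_ge0//= (le_trans _ (weE x))// (bigD1 z)//= lerDl sumr_ge0// => i _.
by rewrite mulr_ge0.
Qed.

(** [e] itself carries no bound; only its product with [w] does, through [weE]. Such constants make
    all the integrals below finite. *)
Let boundedu j : exists C, forall x, 0 <= u j x <= C /\ e' j x * u j x <= C.
Proof.
case: j => [z|].
  have /andP[r0 r1] := ratio01 (m0 z) (mp z).
  exists (1 + E) => x; have /andP[w0' w1'] := w_le1 z x; have /andP[we0 we1] := weE1 z x.
  have E0 : 0 <= E := le_trans we0 we1.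
  rewrite /u /e' mulr_ge0//=; split.
    by rewrite (@le_trans _ _ 1) ?lerDl// mulr_ile1.
  rewrite mulrCA [e z x * _]mulrC (@le_trans _ _ E)//; last by rewrite lerDr.
  by rewrite (le_trans _ we1)// ler_piMl.
exists (1 / rho + B / 2 * (1 / rho)) => x; have /andP[a0 a1] := a01 x.
have r0 : 0 <= rho^-1 by rewrite invr_ge0 ltW.
have ub : (1 - a x) / rho <= 1 / rho by rewrite ler_wpM2r// lerBlDr lerDl.
have B2 : 0 <= B / 2 by rewrite divr_ge0.
have r1 : 0 <= 1 / rho by rewrite div1r.
rewrite /u /e' mulr_ge0//= ?subr_ge0//; split.
  by rewrite (le_trans ub)// lerDl mulr_ge0.
by rewrite (@le_trans _ _ (B / 2 * (1 / rho))) ?ler_wpM2l// lerDr.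
Qed.

Let boundedv j : exists C, forall x, 0 <= v j x <= C /\ e' j x * v j x <= C.
Proof.
case: j => [z|].
  have r0 : 0 <= (q z)^-1 by rewrite invr_ge0.
  exists ((1 + E) / q z) => x; have /andP[w0' w1'] := w_le1 z x; have /andP[we0 we1] := weE1 z x.
  have E0 : 0 <= E := le_trans we0 we1.
  rewrite /v /e' mulr_ge0//=; split.
    by rewrite ler_wpM2r// (@le_trans _ _ 1) ?lerDl.
  by rewrite mulrA [e z x * _]mulrC ler_wpM2r// (@le_trans _ _ E)// lerDr.
exists (1 + B / 2) => x; have /andP[b0 b1] := b01 x.
have B2 : 0 <= B / 2 by rewrite divr_ge0.
rewrite /v /e' subr_ge0 b1/=; split.
  by rewrite (@le_trans _ _ 1) ?lerDl// lerBlDr lerDl.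
rewrite (@le_trans _ _ (B / 2)) ?lerDr// ler_piMr// lerBlDr lerDl//.
Qed.

Let u0 j x : 0 <= u j x. Proof. by have [C /(_ x)[/andP[]]] := boundedu j. Qed.
Let v0 j x : 0 <= v j x. Proof. by have [C /(_ x)[/andP[]]] := boundedv j. Qed.

Let Rint_lin (Q : probability (Rvec R d) R) (f g : Rvec R d -> R) C c : measurable_fun setT f -> (forall x, 0 <= f x <= C) ->
  (forall x, g x = c * f x) -> \int[Q]_x g x = c * \int[Q]_x f x.
Proof.
move=> mf fC gE; under eq_Rintegral do rewrite gE.
apply: (@RintegralZl _ _ _ Q setT f) => //; apply/integrableP; split; first by apply/measurable_EFinP.
under eq_integral => x _ do rewrite /= ger0_norm ?(andP (fC x)).1//.
by rewrite (bint Q mf fC).1 ltry.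
Qed.

Let Rint_sum (Q : probability (Rvec R d) R) : forall c : I -> R, (forall z, 0 <= c z <= 1) ->
  \int[Q]_x (1 - \sum_z c z * w z x) = 1 - \sum_z c z * \int[Q]_x w z x.
Proof.
move=> c c01.
have iw z : Q.-integrable setT (EFin \o w z).
  apply/integrableP; split; first by apply/measurable_EFinP.
  under eq_integral => x _ do rewrite /= ger0_norm//.
  by rewrite (bint Q (mw z) (w_le1 z)).1 ltry.
have i1 : Q.-integrable setT (EFin \o cst (1:R)) by exact: finite_measure_integrable_cst.
have isum : Q.-integrable setT (EFin \o (fun x => \sum_z c z * w z x)).
  have := @integrable_sum _ _ _ Q setT measurableT I (index_enum I) xpredT (fun z x => (c z * w z x)%:E).
  have -> : (fun x => (\sum_z (c z * w z x)%:E)%E) = EFin \o (fun x => \sum_z c z * w z x).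
    by apply/funext => x; rewrite /= sumEFin.
  by apply => z _; exact: (integrableZl measurableT (c z) (iw z)).
rewrite (RintegralB measurableT i1 isum); congr (_ - _).
  rewrite Rintegral_cst// mul1r; exact: (congr1 fine (@probability_setT _ _ _ Q)).
rewrite /Rintegral; under eq_integral do rewrite -sumEFin.
rewrite integral_sum//; last by move=> z; exact: (integrableZl measurableT (c z) (iw z)).
rewrite -[RHS]/(fine (\sum_z c z * \int[Q]_x w z x)%:E) -sumEFin; congr fine; apply: eq_bigr => z _.
rewrite EFinM -(bint Q (mw z) (w_le1 z)).1; under eq_integral do rewrite EFinM.
exact: (integralZl measurableT (iw z)).
Qed.

Let intU j : \int[G]_x u j x = U j.
Proof.
case: j => [z|]; rewrite /u /U.
  by rewrite (Rint_lin G (mw z) (w_le1 z) (fun x => erefl)) mulK.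
have h : forall x, 0 <= 1 - a x <= 1.
  by move=> x; have /andP[? ?] := a01 x; rewrite subr_ge0; apply/andP; split=> //; lra.
rewrite (@Rint_lin G _ _ _ (rho^-1) _ h (fun x => mulrC _ _)); last exact: measurable_funB.
rewrite /a Rint_sum; last by move=> z; exact: ratio01.
under eq_bigr do rewrite mulK//.
by rewrite mulVf// gt_eqF.
Qed.

Let intV j : \int[H]_x v j x = V j.
Proof.
case: j => [z|]; rewrite /v /V.
  by rewrite (Rint_lin H (mw z) (w_le1 z) (fun x => mulrC _ _)) mulrC.
rewrite /b Rint_sum; last by move=> z; exact: ratio01.
by under eq_bigr do rewrite mulK//.
Qed.

Let margV x : \sum_j u j x * V j = 1.
Proof.
rewrite sum_option /= [X in _ + X](_ : _ = a x); last first.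
  apply: eq_bigr => z _; rewrite mulrAC; congr (_ * _).
  (* If q z = 0 the factor [V (Some z)] is 0 instead of 1, but then m z = 0 as well. *)
  have [qz|qz] := eqVneq (q z) 0; last by rewrite divff// mulr1.
  have -> : m z = 0 by apply/eqP; rewrite eq_le m0 -qz mq.
  by rewrite !mul0r.
by rewrite divfK ?gt_eqF// subrK.
Qed.

Let margU y : \sum_j U j * v j y = 1.
Proof.
rewrite sum_option /= [X in _ + X](_ : _ = b y); last first.
  by apply: eq_bigr => z _; rewrite mulrA mulrAC.
by rewrite mul1r subrK.
Qed.

Let mk : measurable_fun setT k.
Proof.
apply: measurable_sum => j; apply: measurable_funM.
  exact: (measurableT_comp (mu j) measurable_fst).
exact: (measurableT_comp (mv j) measurable_snd).
Qed.

Let k0 xy : 0 <= k xy. Proof. by apply: sumr_ge0 => j _; rewrite mulr_ge0. Qed.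

Let V0 j : 0 <= V j. Proof. by case: j => [z|]; rewrite /= ?divr_ge0// ltW. Qed.
Let U0 j : 0 <= U j. Proof. by case: j => [z|]; [exact: m0|exact: ler01]. Qed.
Let V1 z : V (Some z) <= 1.
Proof. by have /andP[] := ratio01 (q0 z) (lexx (q z)). Qed.

Let intUE j : (\int[G]_x (u j x)%:E = (U j)%:E)%E.
Proof.
have [C hC] := boundedu j.
by rewrite (bint G (mu j) (fun x => (hC x).1)).1 intU.
Qed.
Let intVE j : (\int[H]_x (v j x)%:E = (V j)%:E)%E.
Proof.
have [C hC] := boundedv j.
by rewrite (bint H (mv j) (fun x => (hC x).1)).1 intV.
Qed.

Let finint (Q : probability (Rvec R d) R) (f : Rvec R d -> R) C : measurable_fun setT f ->
  (forall x, 0 <= f x <= C) -> exists r, (\int[Q]_x (f x)%:E = r%:E)%E.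
Proof. by move=> mf fC; exists (\int[Q]_x f x); have [] := bint Q mf fC. Qed.

Let kfst (f : option I -> Rvec R d -> R) (C : option I -> R) : (forall j, measurable_fun setT (f j)) ->
  (forall j x, 0 <= f j x) -> (forall j x, f j x * u j x <= C j) ->
  (\int[G \x H]_z (\sum_j f j z.1 * u j z.1 * v j z.2)%:E = \int[G]_x (\sum_j f j x * u j x * V j)%:E)%E.
Proof.
move=> mf f0 fC.
have mfu j : measurable_fun setT (fun x => f j x * u j x) by apply: measurable_funM.
have fu0 j x : 0 <= f j x * u j x by rewrite mulr_ge0.
have fub j x : 0 <= f j x * u j x <= C j by rewrite fu0 fC.
have H1 j : exists r, (\int[G]_x (f j x * u j x)%:E = r%:E)%E by exact: finint (mfu j) (fub j).
pose r j := sval (cid (H1 j)).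
have rE j : (\int[G]_x (f j x * u j x)%:E = (r j)%:E)%E by exact: svalP (cid (H1 j)).
rewrite (integral_sum_tensor mfu fu0 mv v0 rE intVE).
under [RHS]eq_integral do rewrite -sumEFin.
rewrite ge0_integral_sum//; last 2 first.
- by move=> j; apply/measurable_EFinP; apply: measurable_funM.
- by move=> j x _; rewrite lee_fin mulr_ge0.
rewrite -sumEFin; apply: eq_bigr => j _; under eq_integral do rewrite EFinM.
rewrite ge0_integralZr//; first by rewrite rE.
- exact/measurable_EFinP.
- by move=> x _; rewrite lee_fin.
- by rewrite lee_fin.
Qed.

Let ksnd (f : option I -> Rvec R d -> R) (C : option I -> R) : (forall j, measurable_fun setT (f j)) ->
  (forall j x, 0 <= f j x) -> (forall j x, f j x * v j x <= C j) ->
  (\int[G \x H]_z (\sum_j u j z.1 * (f j z.2 * v j z.2))%:E = \int[H]_x (\sum_j U j * (f j x * v j x))%:E)%E.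
Proof.
move=> mf f0 fC.
have mfv j : measurable_fun setT (fun x => f j x * v j x) by apply: measurable_funM.
have fv0 j x : 0 <= f j x * v j x by rewrite mulr_ge0.
have fvb j x : 0 <= f j x * v j x <= C j by rewrite fv0 fC.
have H1 j : exists r, (\int[H]_x (f j x * v j x)%:E = r%:E)%E by exact: finint (mfv j) (fvb j).
pose r j := sval (cid (H1 j)).
have rE j : (\int[H]_x (f j x * v j x)%:E = (r j)%:E)%E by exact: svalP (cid (H1 j)).
rewrite (integral_sum_tensor mu u0 mfv fv0 intUE rE).
under [RHS]eq_integral do rewrite -sumEFin.
rewrite ge0_integral_sum//; last 2 first.
- by move=> j; apply/measurable_EFinP; apply: measurable_funM.
- by move=> j x _; rewrite lee_fin mulr_ge0.
rewrite -sumEFin; apply: eq_bigr => j _; under eq_integral do rewrite EFinM.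
rewrite ge0_integralZl_EFin//; first by rewrite rE.
- by move=> x _; rewrite lee_fin.
- exact/measurable_EFinP.
Qed.

Let Cu j := sval (cid (boundedu j)).
Let Cv j := sval (cid (boundedv j)).
Let CuP j x : 0 <= u j x <= Cu j /\ e' j x * u j x <= Cu j.
Proof. exact: (svalP (cid (boundedu j))). Qed.
Let CvP j x : 0 <= v j x <= Cv j /\ e' j x * v j x <= Cv j.
Proof. exact: (svalP (cid (boundedv j))). Qed.

Let k_fst A : measurable A -> (\int[G \x H]_(z in fst @^-1` A) (k z)%:E = G A)%E.
Proof.
move=> mA; rewrite integral_mkcond.
transitivity (\int[G \x H]_z (\sum_j (\1_A z.1 : R) * u j z.1 * v j z.2)%:E)%E.
  apply: eq_integral => z _; rewrite patchE.
  have -> : (z \in fst @^-1` A) = (z.1 \in A) by [].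
  under eq_bigr do rewrite -mulrA; rewrite -mulr_sumr indicE.
  by case: (z.1 \in A); rewrite ?mul1r ?mul0r.
rewrite (@kfst (fun _ => \1_A) Cu)//.
- under eq_integral do under eq_bigr do rewrite -mulrA.
  under eq_integral do rewrite -mulr_sumr margV mulr1.
  by rewrite integral_indic// setIT.
- move=> j x; have [/andP[h1 h2] _] := CuP j x; by rewrite (le_trans _ h2)// ler_piMl.
Qed.

Let k_snd A : measurable A -> (\int[G \x H]_(z in snd @^-1` A) (k z)%:E = H A)%E.
Proof.
move=> mA; rewrite integral_mkcond.
transitivity (\int[G \x H]_z (\sum_j u j z.1 * ((\1_A z.2 : R) * v j z.2))%:E)%E.
  apply: eq_integral => z _; rewrite patchE.
  have -> : (z \in snd @^-1` A) = (z.2 \in A) by [].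
  under eq_bigr do rewrite mulrCA; rewrite -mulr_sumr indicE.
  by case: (z.2 \in A); rewrite ?mul1r ?mul0r.
rewrite (@ksnd (fun _ => \1_A) Cv)//.
- under eq_integral do under eq_bigr do rewrite mulrCA.
  under eq_integral do rewrite -mulr_sumr margU mulr1.
  by rewrite integral_indic// setIT.
- move=> j x; have [/andP[h1 h2] _] := CvP j x; by rewrite (le_trans _ h2)// ler_piMl.
Qed.

Let mcost : measurable_fun setT cost.
Proof.
apply: measurable_sum => j; apply: measurable_funX.
apply: measurable_funB.
  exact: (measurableT_comp (measurable_tnth j) measurable_fst).
exact: (measurableT_comp (measurable_tnth j) measurable_snd).
Qed.

Let cost0 xy : 0 <= cost xy.
Proof. by apply: sumr_ge0 => j _; exact: sqr_ge0. Qed.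

Let cost_e' j x y : K x -> K y -> cost (x, y) <= e' j x + e' j y.
Proof.
move=> Kx Ky; case: j => [z|] /=; first exact: cost_split.
by rewrite (le_trans (cost_le Kx Ky))//; lra.
Qed.

Let E0 : 0 <= E.
Proof.
pose x0 : Rvec R d := [tuple (0 : R) | i < d].
by apply: le_trans (weE x0); apply: sumr_ge0 => z _; rewrite mulr_ge0.
Qed.

Let affine (Q : probability (Rvec R d) R) (f : Rvec R d -> R) c r : measurable_fun setT f ->
  (forall x, 0 <= f x) -> 0 <= c -> (\int[Q]_x (f x)%:E = r%:E)%E ->
  (\int[Q]_x (E + c * f x)%:E = (E + c * r)%:E)%E.
Proof.
move=> mf f0 c0 fr; under eq_integral do rewrite EFinD EFinM.
rewrite ge0_integralD//.
- rewrite integral_cst// ge0_integralZl_EFin//; last 2 first.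
  + by move=> x _; rewrite lee_fin.
  + exact/measurable_EFinP.
  by rewrite fr EFinD EFinM; congr (_ + _)%E; rewrite -[RHS]mule1; congr (_ * _)%E; exact: probability_setT.
- by move=> x _; rewrite -EFinM lee_fin mulr_ge0.
- by apply/measurable_EFinP; apply: measurable_funM.
Qed.

Let B20 : 0 <= B / 2. Proof. by rewrite divr_ge0. Qed.

(** In the matched cells the weights are at most w, so [weE] bounds their cost by E; the leftover
    contributes B / 2 * rho times the integral [U None] of [u None], whence the trailing 1. *)
Let term_fst : (\int[G \x H]_z (\sum_j e' j z.1 * u j z.1 * v j z.2)%:E <= (E + B / 2 * rho * 1)%:E)%E.
Proof.
have r0 : 0 <= B / 2 * rho by rewrite mulr_ge0// ltW.
rewrite (kfst me' e'0 (fun j x => (CuP j x).2)).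
rewrite -(affine (mu None) (u0 None) r0 (intUE None)).
apply: ge0_le_integral => //.
- by move=> x _; rewrite lee_fin; apply: sumr_ge0 => j _; rewrite !mulr_ge0.
- by apply/measurable_EFinP; apply: measurable_sum => j; apply: measurable_funM => //; apply: measurable_funM.
- by apply/measurable_EFinP; apply: measurable_funD => //; apply: measurable_funM.
move=> x _; rewrite lee_fin sum_option addrC lerD//.
  apply: le_trans (weE x); apply: ler_sum => z _.
  have /andP[h0 h1] := ratio01 (m0 z) (mp z).
  have /andP[_ h2] := weE1 z x; have /andP[h3 _] := weE1 z x.
  rewrite -[leRHS]mulr1; apply: ler_pM; [|exact: V0| |exact: V1].
    by rewrite mulr_ge0//.
  by rewrite /= mulrCA [e z x * _]mulrC ler_piMl.
by rewrite /= le_eqVlt; apply/orP; left; apply/eqP; ring.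
Qed.

Let term_snd : (\int[G \x H]_z (\sum_j u j z.1 * (e' j z.2 * v j z.2))%:E <= (E + B / 2 * rho)%:E)%E.
Proof.
rewrite (ksnd me' e'0 (fun j x => (CvP j x).2)).
rewrite -(affine (mv None) (v0 None) B20 (intVE None)).
apply: ge0_le_integral => //.
- by move=> x _; rewrite lee_fin; apply: sumr_ge0 => j _; rewrite !mulr_ge0.
- by apply/measurable_EFinP; apply: measurable_sum => j; apply: measurable_funM => //; apply: measurable_funM.
- by apply/measurable_EFinP; apply: measurable_funD => //; apply: measurable_funM.
move=> x _; rewrite lee_fin sum_option addrC lerD//.
  apply: le_trans (weE x); apply: ler_sum => z _.
  have /andP[h0 h1] := ratio01 (m0 z) (mq z).
  have /andP[h3 _] := weE1 z x.
  rewrite /= [leLHS](_ : _ = m z / q z * (w z x * e z x)) ?ler_piMl//.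
  by ring.
by rewrite /= mul1r.
Qed.

(** Since the density is a sum of products in x and y, each index may use its own splitting e' j x +
    e' j y of the cost; either half then integrates to at most E + B / 2 * rho. *)
Lemma W2sq_le_partition : (W2sq G H <= (2 * E + (#|I|%:R + 1) * tau * B)%:E)%E.
Proof.
have k1 : (\int[G \x H]_xy (k xy)%:E = 1)%E.
  by have := k_fst measurableT; rewrite preimage_setT => ->; exact: probability_setT.
have [gam gamE] := exists_probability_density mk k0 k1.
have cpl : coupling G H gam.
  move=> A mA; split; rewrite gamE; [exact: k_fst| |exact: k_snd|].
  - by rewrite -[X in measurable X]setTI; exact: measurable_fst.
  - by rewrite -[X in measurable X]setTI; exact: measurable_snd.
apply: (@le_trans _ _ (\int[gam]_xy (cost xy)%:E)%E).
  by apply: ereal_inf_lbound; exists gam.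
rewrite (ge0_integral_density mk k0 gamE mcost cost0).
apply: (@le_trans _ _ (\int[G \x H]_z ((\sum_j e' j z.1 * u j z.1 * v j z.2)%:E + (\sum_j u j z.1 * (e' j z.2 * v j z.2))%:E))%E).
  (* The cost is controlled on K x K only, so the comparison is made outside a set that is null for
     the product measure. *)
  have mKc : measurable (~` K) by exact: measurableC.
  have GKc : G (~` K) = 0%E by rewrite probability_setC// GK subee.
  have HKc : H (~` K) = 0%E by rewrite probability_setC// HK subee.
  have GKc' : (G (~` K) * H setT = 0)%E by rewrite GKc mul0e.
  have HKc' : (G setT * H (~` K) = 0)%E by rewrite HKc mule0.
  apply: ae_ge0_le_integral => //.
  - by move=> z _; rewrite lee_fin mulr_ge0.
  - by apply/measurable_EFinP; apply: measurable_funM.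
  - by move=> z _; rewrite -EFinD lee_fin addr_ge0//; apply: sumr_ge0 => j _; rewrite !mulr_ge0.
  - apply/measurable_EFinP; apply: measurable_funD; apply: measurable_sum => j.
      apply: measurable_funM; last exact: (measurableT_comp (mv j) measurable_snd).
      by apply: measurable_funM; [exact: (measurableT_comp (me' j) measurable_fst)|exact: (measurableT_comp (mu j) measurable_fst)].
    apply: measurable_funM; first exact: (measurableT_comp (mu j) measurable_fst).
    by apply: measurable_funM; [exact: (measurableT_comp (me' j) measurable_snd)|exact: (measurableT_comp (mv j) measurable_snd)].
  exists ((~` K `*` setT) `|` (setT `*` ~` K)); split.
  - by apply: measurableU; exact: measurableX.
  - apply: null_set_setU; try exact: measurableX.
      by apply: eq_trans; [exact: product_measure1E|exact: GKc'].
    by apply: eq_trans; [exact: product_measure1E|exact: HKc'].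
  move=> [x y] /= nle; have [Kx|nKx] := pselect (K x); last by left.
  have [Ky|nKy] := pselect (K y); last by right.
  exfalso; apply: nle => _; rewrite -EFinD lee_fin mulr_sumr -big_split /=.
  apply: ler_sum => j _.
  rewrite [leRHS](_ : _ = (e' j x + e' j y) * (u j x * v j y)); last by ring.
  by rewrite ler_wpM2r ?mulr_ge0// cost_e'.
rewrite ge0_integralD//; last 4 first.
- by move=> z _; rewrite lee_fin; apply: sumr_ge0 => j _; rewrite !mulr_ge0.
- apply/measurable_EFinP; apply: measurable_sum => j.
  apply: measurable_funM; last exact: (measurableT_comp (mv j) measurable_snd).
  by apply: measurable_funM; [exact: (measurableT_comp (me' j) measurable_fst)|exact: (measurableT_comp (mu j) measurable_fst)].
- by move=> z _; rewrite lee_fin; apply: sumr_ge0 => j _; rewrite !mulr_ge0.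
- apply/measurable_EFinP; apply: measurable_sum => j.
  apply: measurable_funM; first exact: (measurableT_comp (mu j) measurable_fst).
  by apply: measurable_funM; [exact: (measurableT_comp (me' j) measurable_snd)|exact: (measurableT_comp (mv j) measurable_snd)].
apply: (le_trans (leeD term_fst term_snd)).
rewrite -EFinD lee_fin.
have := ler_wpM2r B0 rho_le.
lra.
Qed.

End coupling_cost.

(** * Fejer-type kernels and their deconvolution *)

Section trig_kernel.
Context (R : realType).
Implicit Types (v : R).

(** The squared modulus of sum b_m e^(i m v), in real form. *)
Lemma sum_sqr_trig n (b : 'I_n -> R) v :
  (\sum_m b m * cos (m%:R * v)) ^+ 2 + (\sum_m b m * sin (m%:R * v)) ^+ 2 =
  \sum_m \sum_m' b m * b m' * cos ((m%:R - m'%:R) * v).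
Proof.
rewrite !expr2 !mulr_suml -big_split /=; apply: eq_bigr => m _.
rewrite !mulr_sumr -big_split /=; apply: eq_bigr => m' _.
by rewrite mulrBl cosB; ring.
Qed.

(** Multiplied by 2 sin (p pi / Q), nonzero as 0 < p < Q, the sum telescopes, and its two ends
    differ by p full periods. *)
Lemma sum_cos_grid (Q p : nat) v : (0 < p < Q)%N ->
  \sum_(l < Q) cos (p%:R * (v - l%:R * (2 * pi / Q%:R))) = 0.
Proof.
move=> /andP[p0 pQ].
have Q0 : (0 : R) < Q%:R by rewrite ltr0n (ltn_trans p0).
pose h : R := p%:R * pi / Q%:R.
have s0 : sin h != 0.
  rewrite gt_eqF// sin_gt0_pi//; apply/andP; split.
    by rewrite divr_gt0// mulr_gt0 ?pi_gt0// ltr0n.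
  by rewrite ltr_pdivrMr// mulrC ltr_pM2l ?pi_gt0// ltr_nat.
have s20 : 2 * sin h != 0 by rewrite mulf_neq0// pnatr_eq0.
apply: (mulfI s20); rewrite mulr0 mulr_sumr.
pose g (l : nat) := - sin (p%:R * v - l%:R * (2 * h) + h).
rewrite (eq_bigr (fun l : 'I_Q => g l.+1 - g l)); last first.
  move=> l _; rewrite /g -[l.+1%:R]natr1.
  have -> : p%:R * v - (l%:R + 1) * (2 * h) + h = (p%:R * v - l%:R * (2 * h)) - h by ring.
  have -> : p%:R * (v - l%:R * (2 * pi / Q%:R)) = p%:R * v - l%:R * (2 * h) by rewrite /h; field; rewrite gt_eqF.
  by move: (p%:R * v - _) => y; rewrite sinB sinD; ring.
rewrite -(big_mkord xpredT (fun l => g l.+1 - g l)).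
rewrite telescope_sumr// /g mul0r subr0 opprK.
have -> : p%:R * v - Q%:R * (2 * h) + h = (p%:R * v + h) - pi *+ 2 *+ p.
  have hQ : Q%:R * h = p%:R * pi by rewrite /h mulrC divfK// gt_eqF.
  by rewrite mulrCA hQ -[_ *+ p]mulr_natr; ring.
by rewrite -(periodicn (@sinD2pi R) p (_ - _)) subrK addNr.
Qed.

Lemma sum_cos_grid_diff Q (m m' : 'I_Q) v : m != m' ->
  \sum_(l < Q) cos ((m%:R - m'%:R) * (v - l%:R * (2 * pi / Q%:R))) = 0.
Proof.
wlog mm' : m m' / (m' < m)%N => [hw mm'|_].
  have := mm'; rewrite neq_ltn => /orP[lt|lt]; last exact: hw.
  apply: etrans (hw m' m lt _); last by rewrite eq_sym.
  by apply: eq_bigr => l _; rewrite -[in LHS]cosN -mulNr opprB.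
rewrite -natrB ?(ltnW mm')//; apply: sum_cos_grid.
by rewrite subn_gt0 mm'/= (leq_ltn_trans (leq_subr _ _)).
Qed.

(** Discrete Parseval at an arbitrary offset v: with as many grid points as coefficients, each
    off-diagonal difference is nonzero and below Q in absolute value, so its grid sum vanishes. *)
Lemma parseval_grid Q (b : 'I_Q -> R) v : (0 < Q)%N ->
  \sum_(l < Q) ((\sum_m b m * cos (m%:R * (v - l%:R * (2 * pi / Q%:R)))) ^+ 2 +
                (\sum_m b m * sin (m%:R * (v - l%:R * (2 * pi / Q%:R)))) ^+ 2)
  = Q%:R * \sum_m b m ^+ 2.
Proof.
move=> Q0; under eq_bigr do rewrite sum_sqr_trig.
rewrite exchange_big mulr_sumr /=; apply: eq_bigr => m _.
rewrite exchange_big /= (bigD1 m)//= [X in _ + X]big1 ?addr0.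
  under eq_bigr do rewrite subrr mul0r cos0 mulr1.
  by rewrite big_const_ord iter_addr_0 mulr_natl expr2.
by move=> m' mm'; rewrite -mulr_sumr sum_cos_grid_diff ?mulr0// eq_sym.
Qed.

(** Coefficients of (1 - e^(i v)) sum a_m e^(i m v), the top one, - a_M, vanishing when a_M = 0.
    Multiplication by 2 (1 - cos v) = |1 - e^(i v)|^2 thus amounts to differencing. *)
Definition fejer_diff (a : nat -> R) (m : nat) : R := a m - (if m is m'.+1 then a m' else 0).

Lemma sum_fejer_diff M (a : nat -> R) (g : nat -> R) : a M = 0 ->
  \sum_(m < M.+1) fejer_diff a m * g m = \sum_(m < M.+1) a m * (g m - g m.+1).
Proof.
move=> aM; under eq_bigr do rewrite /fejer_diff mulrBl.
under [RHS]eq_bigr do rewrite mulrBr.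
rewrite !sumrB; congr (_ - _).
by rewrite big_ord_recl /= mul0r add0r [RHS]big_ord_recr /= aM mul0r addr0.
Qed.

Lemma fejer_diff_trig M (a : nat -> R) v : a M = 0 ->
  2 * (1 - cos v) * ((\sum_(m < M.+1) a m * cos (m%:R * v)) ^+ 2 + (\sum_(m < M.+1) a m * sin (m%:R * v)) ^+ 2)
  = (\sum_(m < M.+1) fejer_diff a m * cos (m%:R * v)) ^+ 2 + (\sum_(m < M.+1) fejer_diff a m * sin (m%:R * v)) ^+ 2.
Proof.
move=> aM.
rewrite (sum_fejer_diff (fun m => cos (m%:R * v)) aM) (sum_fejer_diff (fun m => sin (m%:R * v)) aM).
set C := \sum_(m < M.+1) a m * cos _; set S := \sum_(m < M.+1) a m * sin _.
have -> : \sum_(m < M.+1) a m * (cos (m%:R * v) - cos (m.+1%:R * v)) = C - (cos v * C - sin v * S).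
  rewrite /C /S !mulr_sumr -!sumrB; apply: eq_bigr => m _.
  by rewrite -[m.+1%:R]natr1 mulrDl mul1r cosD; ring.
have -> : \sum_(m < M.+1) a m * (sin (m%:R * v) - sin (m.+1%:R * v)) = S - (sin v * C + cos v * S).
  rewrite /C /S !mulr_sumr -big_split -!sumrB; apply: eq_bigr => m _.
  by rewrite -[m.+1%:R]natr1 mulrDl mul1r sinD /=; ring.
have h := cos2Dsin2 v.
have -> : (C - (cos v * C - sin v * S)) ^+ 2 + (S - (sin v * C + cos v * S)) ^+ 2
  = (1 - 2 * cos v + (cos v ^+ 2 + sin v ^+ 2)) * (C ^+ 2 + S ^+ 2) by ring.
by rewrite h; ring.
Qed.

(* For these weights sum (a_m - a_(m-1))^2 / sum a_m^2 is of order M^-2, which is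
   the variance of the kernel. *)
Definition fejer_coef (M m : nat) : R := m%:R * (M%:R - m%:R).

Lemma sum_fejer_coef_sqr M :
  \sum_(m < M.+1) fejer_coef M m ^+ 2 = M%:R * (M%:R ^+ 4 - 1) / 30.
Proof.
(* M is freed as X, since the induction may change only the range of summation. *)
suff H n (X : R) : \sum_(m < n) (m%:R * (X - m%:R)) ^+ 2 =
   X ^+ 2 * ((n%:R - 1) * n%:R * (2 * n%:R - 1) / 6) - 2 * X * (n%:R * (n%:R - 1) / 2) ^+ 2
   + (n%:R - 1) * n%:R * (2 * n%:R - 1) * (3 * n%:R ^+ 2 - 3 * n%:R - 1) / 30.
  by rewrite /fejer_coef H -[M.+1%:R]natr1; field.
elim: n => [|n IH]; first by rewrite big_ord0; field.
by rewrite big_ord_recr IH -[n.+1%:R]natr1 /=; field.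
Qed.

Lemma sum_fejer_diff_sqr M :
  \sum_(m < M.+1) fejer_diff (fejer_coef M) m ^+ 2 = M%:R * (M%:R ^+ 2 - 1) / 3.
Proof.
rewrite big_ord_recl /= {1}/fejer_diff /fejer_coef mul0r subr0 expr0n add0r.
suff H n (X : R) : \sum_(m < n) (X - 1 - 2 * m%:R) ^+ 2 =
   n%:R * (X - 1) ^+ 2 - 2 * (X - 1) * (n%:R * (n%:R - 1)) + 4 * ((n%:R - 1) * n%:R * (2 * n%:R - 1) / 6).
  rewrite (eq_bigr (fun m : 'I_M => (M%:R - 1 - 2 * m%:R) ^+ 2)).
    by rewrite H; field.
  by move=> m _; rewrite /fejer_diff /= /bump /= add1n -[m.+1%:R]natr1; ring.
elim: n => [|n IH]; first by rewrite big_ord0; field.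
by rewrite big_ord_recr IH -[n.+1%:R]natr1 /=; field.
Qed.

Definition grid_step (M : nat) : R := 2 * pi / M.+1%:R.

(** The value of the Parseval sum, so that the M + 1 grid translates of the kernel add up to 1. *)
Definition fejer_norm (M : nat) : R := M.+1%:R * \sum_(m < M.+1) fejer_coef M m ^+ 2.

Definition fejer_kernel (M : nat) (v : R) : R :=
  ((\sum_(m < M.+1) fejer_coef M m * cos (m%:R * v)) ^+ 2 +
   (\sum_(m < M.+1) fejer_coef M m * sin (m%:R * v)) ^+ 2) / fejer_norm M.

(* [fejer_kernel M v] is the case s = 0; the k-th frequency is multiplied by the
   inverse of the characteristic function of N(0, s) at k. *)
Definition fejer_deconv (M : nat) (s v : R) : R :=
  (\sum_(m < M.+1) \sum_(m' < M.+1) fejer_coef M m * fejer_coef M m' *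
     (expR ((m%:R - m'%:R) ^+ 2 * s / 2) * cos ((m%:R - m'%:R) * v))) / fejer_norm M.

Lemma fejer_coef_ge0 M (m : 'I_M.+1) : 0 <= fejer_coef M m.
Proof. by rewrite mulr_ge0// subr_ge0 ler_nat -ltnS. Qed.

Lemma fejer_sqr_gt0 M : (1 < M)%N -> 0 < \sum_(m < M.+1) fejer_coef M m ^+ 2.
Proof.
move=> M1; rewrite sum_fejer_coef_sqr divr_gt0// mulr_gt0 ?ltr0n ?(ltn_trans _ M1)//.
by rewrite subr_gt0 exprn_egt1// ltr1n.
Qed.

Lemma fejer_norm_gt0 M : (1 < M)%N -> 0 < fejer_norm M.
Proof. by move=> M1; rewrite mulr_gt0// fejer_sqr_gt0. Qed.

Lemma fejer_kernel_ge0 M v : (1 < M)%N -> 0 <= fejer_kernel M v.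
Proof. by move=> M1; rewrite divr_ge0 ?addr_ge0 ?sqr_ge0// ltW// fejer_norm_gt0. Qed.

Lemma sum_fejer_kernel M v : (1 < M)%N ->
  \sum_(l < M.+1) fejer_kernel M (v - l%:R * grid_step M) = 1.
Proof.
move=> M1; rewrite -mulr_suml (parseval_grid (fun m : 'I_M.+1 => fejer_coef M m))//.
by rewrite divff// gt_eqF// fejer_norm_gt0.
Qed.

(** Parseval for the differenced coefficients over Parseval for the coefficients: 10 (M^2 - 1) /
    (M^4 - 1) = 10 / (M^2 + 1). *)
Lemma sum_fejer_kernel_var M v : (1 < M)%N ->
  \sum_(l < M.+1) fejer_kernel M (v - l%:R * grid_step M) * (2 * (1 - cos (v - l%:R * grid_step M)))
  <= 10 / M%:R ^+ 2.
Proof.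
move=> M1; have aM : fejer_coef M M = 0 by rewrite /fejer_coef subrr mulr0.
have M0 : (1 : R) < M%:R by rewrite ltr1n.
under eq_bigr do rewrite mulrC mulrA (fejer_diff_trig _ aM).
rewrite -mulr_suml (parseval_grid (fun m : 'I_M.+1 => fejer_diff (fejer_coef M) m))//.
rewrite sum_fejer_diff_sqr /fejer_norm -mulf_div divff ?pnatr_eq0// mul1r sum_fejer_coef_sqr.
have -> : M%:R * (M%:R ^+ 2 - 1) / 3 / (M%:R * (M%:R ^+ 4 - 1) / 30) = 10 / (M%:R ^+ 2 + 1) :> R.
  field; rewrite !gt_eqF//.
  - by rewrite (lt_trans ltr01).
  - by rewrite subr_gt0 exprn_egt1.
rewrite ler_pM2l// lef_pV2 ?posrE ?lerDl// ?addr_gt0//; by rewrite exprn_gt0// (lt_trans ltr01).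
Qed.

(** Cauchy-Schwarz through a b <= (a^2 + b^2) / 2. After normalisation the weights of the double sum
    have total mass at most 1. *)
Lemma sum_fejer_coef_le M : \sum_(m < M.+1) \sum_(m' < M.+1) fejer_coef M m * fejer_coef M m' <= fejer_norm M.
Proof.
have h m m' : fejer_coef M m * fejer_coef M m' <= (fejer_coef M m ^+ 2 + fejer_coef M m' ^+ 2) / 2.
  have := sqr_ge0 (fejer_coef M m - fejer_coef M m'); lra.
have -> : fejer_norm M = \sum_(m < M.+1) \sum_(m' < M.+1) (fejer_coef M m ^+ 2 + fejer_coef M m' ^+ 2) / 2.
  rewrite /fejer_norm.
  under [RHS]eq_bigr do rewrite -mulr_suml big_split /= big_const_ord iter_addr_0.
  rewrite -mulr_suml big_split /= big_const_ord iter_addr_0 sumrMnl.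
  by move: (\sum_(i < M.+1) _) => A; rewrite -[A *+ M.+1]mulr_natl; field.
by apply: ler_sum => m _; apply: ler_sum => m' _.
Qed.

(** All frequencies m - m' are at most M in absolute value. This exponential is the price of
    deconvolution, and it determines M. *)
Lemma fejer_deconv_le M (s v : R) : (1 < M)%N -> 0 <= s ->
  `|fejer_deconv M s v| <= expR (M%:R ^+ 2 * s / 2).
Proof.
move=> M1 s0; rewrite normrM normfV (gtr0_norm (fejer_norm_gt0 M1)) ler_pdivrMr ?fejer_norm_gt0//.
apply: le_trans (ler_wpM2l (expR_ge0 _) (sum_fejer_coef_le M)).
rewrite mulr_sumr (le_trans (ler_norm_sum _ _ _))//; apply: ler_sum => m _.
rewrite mulr_sumr (le_trans (ler_norm_sum _ _ _))//; apply: ler_sum => m' _.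
have a0 := mulr_ge0 (fejer_coef_ge0 m) (fejer_coef_ge0 m').
rewrite normrM (ger0_norm a0) [leLHS]mulrC; apply: ler_pM => //.
rewrite normrM -[leRHS]mulr1 ler_pM//; last by rewrite ler_norml cos_geN1 cos_le1.
rewrite ger0_norm ?expR_ge0// ler_expR ler_pM2r// ler_wpM2r//.
rewrite -(real_normK (num_real (m%:R - m'%:R))) lerXn2r ?nnegrE// ler_norml.
have := ltn_ord m; have := ltn_ord m'; rewrite !ltnS -!(ler_nat R).
have : (0 : R) <= m%:R by []. have : (0 : R) <= m'%:R by [].
by move=> ? ? ? ?; apply/andP; split; lra.
Qed.

Lemma measurable_fejer_kernel M : measurable_fun setT (fejer_kernel M).
Proof.
have mc k : measurable_fun setT (fun v : R => cos (k * v)).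
  apply: (measurableT_comp (f := cos)); first exact: continuous_measurable_fun (@continuous_cos R).
  exact: measurable_funM.
have ms k : measurable_fun setT (fun v : R => sin (k * v)).
  apply: (measurableT_comp (f := sin)); first exact: continuous_measurable_fun (@continuous_sin R).
  exact: measurable_funM.
apply: measurable_funM => //; apply: measurable_funD; apply: measurable_funX;
  by apply: measurable_sum => m; apply: measurable_funM.
Qed.

Lemma measurable_fejer_deconv M s : measurable_fun setT (fejer_deconv M s).
Proof.
have mc k : measurable_fun setT (fun v : R => cos (k * v)).
  apply: (measurableT_comp (f := cos)); first exact: continuous_measurable_fun (@continuous_cos R).
  exact: measurable_funM.
apply: measurable_funM => //; apply: measurable_sum => m; apply: measurable_sum => m'.
by apply: measurable_funM => //; apply: measurable_funM.
Qed.

(** Frequency k in om x is frequency k om in x, where the characteristic function of N(0, sg^2) is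
    exp (- k^2 om^2 sg^2 / 2): exactly the inverse of the factor in [fejer_deconv]. *)
Lemma integral_fejer_deconv M (m sg om ph : R) : sg != 0 ->
  (@lebesgue_measure R).-integrable setT
    (fun x => (normal_pdf m sg x * fejer_deconv M (om ^+ 2 * sg ^+ 2) (om * x - ph))%:E) /\
  \int[@lebesgue_measure R]_x (normal_pdf m sg x * fejer_deconv M (om ^+ 2 * sg ^+ 2) (om * x - ph)) =
  fejer_kernel M (om * m - ph).
Proof.
move=> sg0.
pose c (p q : 'I_M.+1) := fejer_coef M p * fejer_coef M q * expR ((p%:R - q%:R) ^+ 2 * (om ^+ 2 * sg ^+ 2) / 2) / fejer_norm M.
pose W (p q : 'I_M.+1) x := normal_pdf m sg x * cos ((p%:R - q%:R) * om * (x - m) + (p%:R - q%:R) * (om * m - ph)).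
have WP p q := Rintegral_normal_pdf_cos m ((p%:R - q%:R) * om) ((p%:R - q%:R) * (om * m - ph)) sg0.
have E : (fun x => normal_pdf m sg x * fejer_deconv M (om ^+ 2 * sg ^+ 2) (om * x - ph)) =
         (fun x => \sum_p \sum_q c p q * W p q x).
  apply/funext => x; rewrite /fejer_deconv mulrA mulr_sumr mulr_suml; apply: eq_bigr => p _.
  rewrite mulr_sumr mulr_suml; apply: eq_bigr => q _.
  rewrite /c /W; have -> : (p%:R - q%:R) * om * (x - m) + (p%:R - q%:R) * (om * m - ph) = (p%:R - q%:R) * (om * x - ph) by ring.
  by ring.
have icW p q : (@lebesgue_measure R).-integrable setT (fun x => (c p q * W p q x)%:E).
  exact: (integrableZl measurableT (c p q) (WP p q).1).
have is_ p : (@lebesgue_measure R).-integrable setT (fun x => (\sum_q (c p q * W p q x)%:E)%E).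
  by apply: integrable_sum => // q _; exact: icW.
have iss : (@lebesgue_measure R).-integrable setT (fun x => (\sum_p \sum_q (c p q * W p q x)%:E)%E).
  by apply: integrable_sum => // p _; exact: is_.
have EE : (fun x => (\sum_p \sum_q (c p q * W p q x)%:E)%E) = EFin \o (fun x => \sum_p \sum_q c p q * W p q x).
  by apply/funext => x; rewrite /= -sumEFin; apply: eq_bigr => p _; rewrite sumEFin.
split.
  have := iss; rewrite EE; apply: eq_integrable => // x _ /=.
  by rewrite -[in LHS](congr1 (fun f => f x) E).
transitivity (\int[@lebesgue_measure R]_x \sum_p \sum_q c p q * W p q x).
  by apply: eq_Rintegral => x _; rewrite -[in RHS](congr1 (fun f => f x) E).
have := congr1 (fun f => fine (\int[@lebesgue_measure R]_x f x)%E) EE.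
rewrite /= -/(Rintegral _ _ _) => <-.
rewrite integral_sum//.
have e1 p : (\int[@lebesgue_measure R]_x (\sum_q (c p q * W p q x)%:E) =
   (\sum_(q < M.+1) fejer_coef M p * fejer_coef M q * cos ((p%:R - q%:R) * (om * m - ph)) / fejer_norm M)%:E)%E.
  rewrite integral_sum//.
  rewrite -sumEFin; apply: eq_bigr => q _.
  under eq_integral do rewrite EFinM.
  rewrite (integralZl measurableT (WP p q).1).
  have -> : (\int[@lebesgue_measure R]_x (W p q x)%:E)%E = (\int[@lebesgue_measure R]_x W p q x)%:E.
    by rewrite /Rintegral fineK//; exact: (integrable_fin_num _ (WP p q).1).
  rewrite (WP p q).2 -EFinM; congr EFin; rewrite /c.
  have h : expR ((p%:R - q%:R) ^+ 2 * (om ^+ 2 * sg ^+ 2) / 2) * expR (- (sg ^+ 2 * ((p%:R - q%:R) * om) ^+ 2) / 2) = 1.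
    by rewrite -expRD -[RHS]expR0; congr expR; ring.
  set e1 := expR _ in h *; set e2 := expR _ in h *.
  transitivity (fejer_coef M p * fejer_coef M q * (e1 * e2) * cos ((p%:R - q%:R) * (om * m - ph)) / fejer_norm M).
    by ring.
  by rewrite h mulr1.
under eq_bigr do rewrite e1.
rewrite sumEFin /= /fejer_kernel sum_sqr_trig mulr_suml; apply: eq_bigr => p _.
by rewrite mulr_suml.
Qed.

End trig_kernel.

Lemma measurable_box (R : realType) d (a b : 'I_d -> R) :
  measurable [set t : Rvec R d | forall j, a j <= (tnth t j : R) <= b j].
Proof.
have -> : [set t : Rvec R d | forall j, a j <= (tnth t j : R) <= b j] =
    \bigcap_(j in [set: 'I_d]) ((fun t : Rvec R d => tnth t j : R) @^-1` `[a j, b j]).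
  apply/seteqP; split => [t tD j _|t tD j] /=.
    by rewrite in_itv /=; exact: tD.
  by have := tD j I; rewrite /= in_itv.
apply: fin_bigcap_measurable => // j _.
by rewrite -[X in measurable X]setTI; apply: measurable_tnth => //; exact: measurable_itv.
Qed.

Lemma measurable_cube (R : realType) d (D : R) : measurable (cube (d := d) D).
Proof. exact: measurable_box. Qed.

(** For u = |t| / 2 <= 1 one has 2 (1 - cos t) = 4 sin^2 u, and sin u >= u cos 1 by the mean value
    theorem, cos being decreasing on [0, 1]. *)
Lemma sqr_le_1Bcos (R : realType) (t : R) : `|t| <= 2 -> t ^+ 2 * cos 1 ^+ 2 <= 2 * (1 - cos t).
Proof.
move=> t2.
have ct : 2 * (1 - cos t) = 4 * sin (`|t| / 2) ^+ 2.
  have h : cos t = cos (`|t| / 2 + `|t| / 2) by rewrite -splitr cos_norm.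
  rewrite h cosD; have := cos2Dsin2 (`|t| / 2); set c := cos _; set s := sin _.
  move=> cs; have c2 : c ^+ 2 = 1 - s ^+ 2 by lra.
  by rewrite -!expr2 c2; ring.
have [t0|t0] := eqVneq t 0; first by rewrite t0 cos0 subrr expr0n mul0r mulr0.
pose u := `|t| / 2.
have u0 : 0 < u by rewrite divr_gt0 ?normr_gt0.
have u1 : u <= 1 by rewrite ler_pdivrMr ?mul1r.
have [c cu sE] := @MVT R sin cos 0 u u0 (fun x _ => is_derive_sin x) (continuous_subspaceT (@continuous_sin R)).
move: cu; rewrite in_itv/= => /andP[c0 cu].
have pi2 : (1 : R) <= pi / 2 := pihalf_ge1 R.
have cc : cos 1 <= cos c.
  rewrite ltW// ltr_cos ?in_itv/=; first by rewrite (lt_le_trans cu).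
  - by apply/andP; split; [lra|lra].
  - by apply/andP; split; lra.
have c10 : 0 < cos (1:R) by exact: cos1_gt0.
have su : u * cos 1 <= sin u.
  by move: sE; rewrite sin0 !subr0 => ->; rewrite mulrC ler_pM2r.
rewrite ct -/u -(real_normK (num_real t)).
have -> : `|t| = 2 * u by rewrite /u; field.
rewrite exprMn -mulrA -exprMn -natrX ler_pM2l//.
by rewrite lerXn2r// nnegrE; [rewrite mulr_ge0 ?ltW|rewrite (le_trans _ su)// mulr_ge0 ?ltW].
Qed.

Lemma sqr_dist_le_1Bcos (R : realType) (om x y ph : R) : 0 < om -> `|om * (x - y)| <= 2 ->
  (x - y) ^+ 2 <= 2 / (om ^+ 2 * cos 1 ^+ 2) * (2 * (1 - cos (om * x - ph)) + 2 * (1 - cos (om * y - ph))).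
Proof.
move=> om0 h.
have c10 : 0 < cos (1:R) by exact: cos1_gt0.
have K0 : 0 < om ^+ 2 * cos 1 ^+ 2 by rewrite mulr_gt0 ?exprn_gt0.
rewrite mulrAC ler_pdivlMr//.
have := sqr_le_1Bcos h.
have -> : om * (x - y) = (om * x - ph) - (om * y - ph) by ring.
set a := om * x - ph; set b := om * y - ph.
rewrite cosB -/a -/b.
have ha := cos2Dsin2 a; have hb := cos2Dsin2 b.
have -> : (a - b) ^+ 2 * cos 1 ^+ 2 = (x - y) ^+ 2 * (om ^+ 2 * cos 1 ^+ 2) by rewrite /a /b; ring.
move=> /le_trans; apply.
(* Parallelogram identity for e^(i a) - 1 and e^(i b) - 1: the squared chord from e^(i a) to e^(i b)
   is at most twice the sum of their squared chords to 1. *)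
have h1 := sqr_ge0 (cos a - 1 + (cos b - 1)); have h2 := sqr_ge0 (sin a + sin b).
nra.
Qed.

(** * The product partition of unity *)

Section partition_of_unity.
Context (R : realType) (d M : nat) (om : R) (M1 : (1 < M)%N).
Local Notation idx := {ffun 'I_d -> 'I_M.+1}.
Local Notation phase z x j := (om * (tnth x j : R) - (z j)%:R * grid_step R M).

Definition pou (z : idx) (x : Rvec R d) : R := \prod_j fejer_kernel M (phase z x j).

(** Squared chords on the circle from the phases to the centre z: a periodic stand-in for the
    squared distance that Parseval can average. *)
Definition pou_spread (z : idx) (x : Rvec R d) : R := \sum_j 2 * (1 - cos (phase z x j)).

Lemma measurable_phase (z : idx) j : measurable_fun setT (fun x : Rvec R d => phase z x j).
Proof. by apply: measurable_funB => //; apply: measurable_funM => //; exact: measurable_tnth. Qed.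

Lemma measurable_pou z : measurable_fun setT (pou z).
Proof.
apply: measurable_prod => j _.
exact: (measurableT_comp (measurable_fejer_kernel M) (measurable_phase z j)).
Qed.

Lemma pou_ge0 z x : 0 <= pou z x.
Proof. by apply: prodr_ge0 => j _; exact: fejer_kernel_ge0. Qed.

Lemma sum_pou x : \sum_z pou z x = 1.
Proof.
rewrite /pou -(bigA_distr_bigA (fun j (l : 'I_M.+1) => fejer_kernel M (om * (tnth x j : R) - l%:R * grid_step R M))).
by apply: big1 => j _; exact: sum_fejer_kernel.
Qed.

Lemma measurable_pou_spread z : measurable_fun setT (pou_spread z).
Proof.
apply: measurable_sum => j; apply: measurable_funM => //; apply: measurable_funB => //.
apply: (measurableT_comp (f := cos)); first exact: continuous_measurable_fun (@continuous_cos R).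
exact: measurable_phase.
Qed.

Lemma pou_spread_ge0 z x : 0 <= pou_spread z x.
Proof. by apply: sumr_ge0 => j _; rewrite mulr_ge0// subr_ge0 cos_le1. Qed.

Lemma sum_pou_spread x : \sum_z pou z x * pou_spread z x <= d%:R * (10 / M%:R ^+ 2).
Proof.
under eq_bigr do rewrite mulr_sumr.
rewrite exchange_big /= -[d in leRHS](card_ord d) mulr_natl -sumr_const.
apply: ler_sum => j _.
(* Only coordinate j carries the spread; in the product the other coordinates sum to 1. *)
pose F i (l : 'I_M.+1) := fejer_kernel M (om * (tnth x i : R) - l%:R * grid_step R M) *
  (if i == j then 2 * (1 - cos (om * (tnth x i : R) - l%:R * grid_step R M)) else 1).
rewrite (eq_bigr (fun z : idx => \prod_i F i (z i))); last first.
  move=> z _; rewrite big_split /=; congr (_ * _).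
  by rewrite (bigD1 j)//= eqxx big1 ?mulr1// => i /negbTE ->.
rewrite -(bigA_distr_bigA F) (bigD1 j)//= [X in _ * X]big1 ?mulr1; last first.
  move=> i /negbTE ij; rewrite /F; under eq_bigr do rewrite ij mulr1.
  exact: sum_fejer_kernel.
rewrite /F; under eq_bigr do rewrite eqxx.
exact: sum_fejer_kernel_var.
Qed.

Definition pou_deconv (sg : 'I_d -> R) (z : idx) (x : Rvec R d) : R :=
  \prod_j fejer_deconv M (om ^+ 2 * sg j ^+ 2) (phase z x j).

Lemma measurable_pou_deconv sg z : measurable_fun setT (pou_deconv sg z).
Proof.
apply: measurable_prod => j _.
exact: (measurableT_comp (measurable_fejer_deconv M _) (measurable_phase z j)).
Qed.

Lemma pou_deconv_le sg z x K : (forall j, sg j ^+ 2 <= K) ->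
  `|pou_deconv sg z x| <= expR (d%:R * (M%:R ^+ 2 * (om ^+ 2 * K) / 2)).
Proof.
move=> sK; rewrite normr_prod expRM_natl -[d in leRHS](card_ord d) -prodr_const.
apply: ler_prod => j _; rewrite normr_ge0 /=.
have s2 : 0 <= om ^+ 2 * sg j ^+ 2 by rewrite mulr_ge0 ?sqr_ge0.
rewrite (le_trans (fejer_deconv_le _ M1 s2))//.
by rewrite ler_expR ler_pM2r// ler_wpM2l ?sqr_ge0// ler_wpM2l ?sqr_ge0.
Qed.

Lemma integral_pou_deconv sg z (th : Rvec R d) : (forall j, sg j != 0) ->
  (lebesgue_vec d).-integrable setT (fun x : Rvec R d =>
    (pou_deconv sg z x * \prod_j normal_pdf (tnth th j : R) (sg j) (tnth x j))%:E) /\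
  (\int[lebesgue_vec d]_x (pou_deconv sg z x * \prod_j normal_pdf (tnth th j : R) (sg j) (tnth x j))%:E)%E =
  (pou z th)%:E.
Proof.
move=> sg0.
pose g j y := normal_pdf (tnth th j : R) (sg j) y * fejer_deconv M (om ^+ 2 * sg j ^+ 2) (om * y - (z j)%:R * grid_step R M).
have h j := integral_fejer_deconv M (tnth th j : R) om ((z j)%:R * grid_step R M) (sg0 j).
have [i1 i2] := @integral_lebesgue_vec_prod R d g (fun j => (h j).1).
have E : (fun x : Rvec R d => (pou_deconv sg z x * \prod_j normal_pdf (tnth th j : R) (sg j) (tnth x j))%:E) =
  (fun x : Rvec R d => (\prod_j g j (tnth x j))%:E).
  by apply/funext => x; rewrite /pou_deconv -big_split /=; congr EFin; apply: eq_bigr => j _; rewrite /g mulrC.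
rewrite E; split=> //; rewrite i2; congr EFin; apply: eq_bigr => j _; exact: (h j).2.
Qed.

End partition_of_unity.

(* On the cube |x_j - y_j| / D <= 2 stays below the period 2 pi, which is why the
   trigonometric spread controls the distance. *)
Lemma W2sq_le_pou (R : realType) (d M : nat) (D tau : R) (G H : probability (Rvec R d) R) :
  (1 < M)%N -> 0 < D -> 0 < tau < 1 -> G (cube D) = 1%E -> H (cube D) = 1%E ->
  (forall z : {ffun 'I_d -> 'I_M.+1}, \int[G]_x pou D^-1 z x - \int[H]_x pou D^-1 z x <= tau) ->
  (W2sq G H <= (40 * d%:R * D ^+ 2 / (cos 1 ^+ 2 * M%:R ^+ 2) +
     (M.+1%:R ^+ d + 1) * tau * (4 * d%:R * D ^+ 2))%:E)%E.
Proof.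
move=> M1 D0 tau01 GD HD pq.
have c10 : 0 < cos (1:R) by exact: cos1_gt0.
have om0 : 0 < D^-1 by rewrite invr_gt0.
pose K := 2 / (D^-1 ^+ 2 * cos 1 ^+ 2).
have K0 : 0 <= K by rewrite divr_ge0// mulr_ge0 ?sqr_ge0.
have dist (x y : Rvec R d) j : cube D x -> cube D y -> `|(tnth x j : R) - (tnth y j : R)| <= 2 * D.
  move=> /(_ j)/andP[x1 x2] /(_ j)/andP[y1 y2]; rewrite ler_norml; apply/andP; split; lra.
have := @W2sq_le_partition R d G H _ (@pou R d M D^-1) (fun z x => K * pou_spread D^-1 z x) (cube D)
  (K * (d%:R * (10 / M%:R ^+ 2))) (4 * d%:R * D ^+ 2) tau
  (@measurable_pou R d M D^-1) (fun z x => pou_ge0 _ M1 z x) (fun x => sum_pou _ M1 x).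
move=> W; apply: le_trans; first apply: W => //.
- by move=> z; apply: measurable_funM => //; exact: measurable_pou_spread.
- by move=> z x; rewrite mulr_ge0// pou_spread_ge0.
- by rewrite mulr_ge0 ?sqr_ge0// mulr_ge0.
- move=> x; under eq_bigr do rewrite mulrCA; rewrite -mulr_sumr ler_wpM2l//.
  exact: sum_pou_spread.
- exact: measurable_cube.
- move=> x y z Kx Ky /=; rewrite -mulrDr -big_split mulr_sumr; apply: ler_sum => j _.
  apply: sqr_dist_le_1Bcos => //.
  by rewrite normrM gtr0_norm// mulrC ler_pdivrMr//; exact: dist.
- move=> x y Kx Ky /=.
  have -> : 4 * d%:R * D ^+ 2 = \sum_(j < d) (2 * D) ^+ 2.
    by rewrite big_const_ord iter_addr_0 -[RHS]mulr_natl; ring.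
  apply: ler_sum => j _; rewrite -(real_normK (num_real (_ - _))) lerXn2r ?nnegrE ?mulr_ge0 ?(ltW D0)//.
  exact: dist.
rewrite lee_fin card_ffun !card_ord natrX.
rewrite le_eqVlt; apply/orP; left; apply/eqP; congr (_ + _).
rewrite /K; field.
by rewrite !gt_eqF// ltr0n (ltn_trans _ M1).
Qed.

(** * Integrals against probability measures *)

Lemma Rintegral_bounded d (T : measurableType d) (R : realType) (Q : probability T R) (f : T -> R) C :
  measurable_fun setT f -> (forall x, `|f x| <= C) ->
  Q.-integrable setT (EFin \o f) /\ (\int[Q]_x (f x)%:E = (\int[Q]_x f x)%:E)%E.
Proof.
move=> mf fC.
have i : Q.-integrable setT (EFin \o f).
  apply: (@le_integrable _ _ _ Q setT measurableT _ (EFin \o cst C)).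
  - exact/measurable_EFinP.
  - by move=> x _; rewrite lee_fin /= (le_trans (fC x))// ler_norm.
  - exact: finite_measure_integrable_cst.
by split => //; rewrite /Rintegral fineK//; exact: integrable_fin_num.
Qed.

Lemma Rintegral_probability_gt0 d (T : measurableType d) (R : realType) (Q : probability T R) (f : T -> R) C :
  measurable_fun setT f -> (forall x, 0 < f x <= C) -> 0 < \int[Q]_x f x.
Proof.
move=> mf f0.
have fC x : `|f x| <= C by have /andP[h1 h2] := f0 x; rewrite gtr0_norm.
have [i e] := Rintegral_bounded Q mf fC.
rewrite lt_neqAle; apply/andP; split; last first.
  by apply: Rintegral_ge0 => x _; have /andP[/ltW] := f0 x.
apply/eqP => h0.
have : (\int[Q]_x `|(EFin \o f) x| = 0)%E.
  under eq_integral => x _ do rewrite /= gtr0_norm ?(andP (f0 x)).1//.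
  by rewrite e -h0.
have mf' : measurable_fun setT (EFin \o f) by apply/measurable_EFinP.
move=> /(ae_eq_integral_abs _ measurableT mf').1 [N [mN N0 subN]].
have : Q N = 1%E.
  rewrite -(@probability_setT _ _ _ Q); congr (_ _); apply/seteqP; split => // x _.
  apply: subN => /= H; have [h] := H I; have := f0 x; by rewrite h ltxx.
by rewrite N0 => /eqP; rewrite eqe eq_sym oner_eq0.
Qed.

Lemma measurable_funV_gt0 d (T : measurableType d) (R : realType) (f : T -> R) :
  measurable_fun setT f -> (forall x, 0 < f x) -> measurable_fun setT (fun x => (f x)^-1).
Proof.
move=> mf f0; rewrite (_ : (fun _ => _) = fun x => expR (- ln (f x))).
  by apply: measurableT_comp => //; apply: measurableT_comp => //; apply: measurableT_comp.
by apply/funext => x; rewrite expRN lnK// posrE.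
Qed.

Lemma Rintegral_ge0_ae d (T : measurableType d) (R : realType) (Q : probability T R) (f : T -> R) K :
  Q.-integrable setT (EFin \o f) -> measurable K -> Q K = 1%E -> (forall x, K x -> 0 <= f x) ->
  0 <= \int[Q]_x f x.
Proof.
move=> fi mK QK f0; rewrite /Rintegral.
have QC : Q (~` K) = 0%E by rewrite probability_setC// QK subee.
rewrite (negligible_integral (measurableC mK) measurableT fi QC) setTD setCK.
by apply: fine_ge0; apply: integral_ge0 => x Kx; rewrite lee_fin f0.
Qed.

Lemma Rintegral_sum d (T : measurableType d) (R : realType) (Q : {measure set T -> \bar R})
    (I : Type) (s : seq I) (f : I -> T -> R) :
  (forall i, Q.-integrable setT (EFin \o f i)) ->
  Q.-integrable setT (EFin \o (fun x => \sum_(i <- s) f i x)) /\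
  \int[Q]_x (\sum_(i <- s) f i x) = \sum_(i <- s) \int[Q]_x f i x.
Proof.
move=> fi; elim: s => [|a s [IHi IH]].
  rewrite (_ : EFin \o _ = cst 0%E); last by apply/funext => x; rewrite /= big_nil.
  split; first exact: integrable0.
  by under eq_Rintegral do rewrite big_nil; rewrite Rintegral_cst ?mul0r// big_nil.
have E : EFin \o (fun x => \sum_(i <- a :: s) f i x) =
    fun x => ((EFin \o f a) x + (EFin \o (fun x => (\sum_(i <- s) f i x)%R)) x)%E.
  by apply/funext => x; rewrite /= big_cons EFinD.
split; first by rewrite E; exact: (integrableD measurableT (fi a) IHi).
under eq_Rintegral do rewrite big_cons.
by rewrite (RintegralD measurableT (fi a) IHi) IH big_cons.
Qed.

(** exp y <= 1 / (1 - y), and (1 - y) (1 + y + 2 y^2) = 1 + y^2 (1 - 2 y) >= 1. *)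
Lemma expR_le1Dxx2 (R : realType) (y : R) : 0 <= y <= 2^-1 -> expR y <= 1 + y + 2 * y ^+ 2.
Proof.
move=> /andP[y0 y1].
have h : 1 - y <= expR (- y) by have := expR_ge1Dx (- y); rewrite addrC.
have p : 0 < 1 - y by lra.
rewrite -[y in expR y]opprK expRN -div1r ler_pdivrMr ?expR_gt0//.
have : 0 <= 1 + y + 2 * y ^+ 2 by nra.
move=> /(ler_wpM2l) /(_ _ _ h); apply: le_trans.
have : 0 <= y ^+ 2 * (1 - 2 * y) by apply: mulr_ge0; [exact: sqr_ge0|lra].
nra.
Qed.

Lemma union_bound d (T : measurableType d) (R : realType) (Q : {measure set T -> \bar R})
    (I : finType) (E : I -> set T) (c : R) :
  (forall i, measurable (E i)) -> (forall i, (Q (E i) <= c%:E)%E) ->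
  measurable (\bigcup_i E i) /\ (Q (\bigcup_i E i) <= (#|I|%:R * c)%:E)%E.
Proof.
move=> mE Ec; rewrite cardE.
have -> : \bigcup_i E i = \big[setU/set0]_(i <- enum I) E i.
  rewrite -bigcup_seq; congr (\bigcup_(i in _) _); apply/seteqP; split => // i _ /=.
  by rewrite mem_enum.
elim: (enum I) => [|i s [mU QU]]; first by rewrite big_nil measure0 mul0r.
rewrite big_cons; split; first exact: measurableU.
apply: le_trans; first exact: measureU2.
by rewrite /= -[(size s).+1%:R]natr1 mulrDl mul1r addrC EFinD leeD.
Qed.

(** * Likelihood and moments of the mixing measure *)

Section likelihood.
Context (R : realType) (d n : nat).
Variables (ker : 'I_n -> Rvec R d -> Rvec R d -> R) (h : 'I_n -> Rvec R d -> R) (w : Rvec R d -> R).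
Variables (Gs : probability (Rvec R d) R) (box : set (Rvec R d)) (Phi S V eta kap : R).
Hypotheses (mker : forall i, measurable_fun setT (fun p : Rvec R d * Rvec R d => ker i p.1 p.2))
  (ker_gt0 : forall i x th, 0 < ker i x th <= Phi)
  (ker1 : forall i th, (\int[lebesgue_vec d]_x (ker i x th)%:E = 1)%E)
  (mh : forall i, measurable_fun setT (h i)) (hS : forall i x, `|h i x| <= S)
  (hker : forall i th, (lebesgue_vec d).-integrable setT (fun x => (h i x * ker i x th)%:E) /\
     (\int[lebesgue_vec d]_x (h i x * ker i x th)%:E = (w th)%:E)%E)
  (mw : measurable_fun setT w) (w01 : forall x, 0 <= w x <= 1)
  (mbox : measurable box) (boxV : lebesgue_vec d box = V%:E)
  (eta0 : 0 < eta) (kap0 : 0 < kap) (etaS : eta * S <= 2^-1).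
Let lam := @lebesgue_vec R d.

Definition mix (G : probability (Rvec R d) R) i x : R := \int[G]_th ker i x th.
Let f := mix Gs.
Let mu := \int[Gs]_th w th.
(* The tilt by eta makes this density sensitive to int w dG; kap keeps it away
   from 0, so that ker / ref_density is bounded. *)
Definition ref_density i x : R := (1 + eta * h i x) * f i x + kap.
Let r := ref_density.

Let mkerx i th : measurable_fun setT (fun x => ker i x th).
Proof. by have := measurableT_comp (mker i) (pair2_measurable th). Qed.
Let mkerth i x : measurable_fun setT (ker i x).
Proof. by have := measurableT_comp (mker i) (pair1_measurable x). Qed.

Let kerC i x th : `|ker i x th| <= Phi.
Proof. by have /andP[h1 h2] := ker_gt0 i x th; rewrite gtr0_norm. Qed.

Let ker0 i x th : 0 <= ker i x th.
Proof. by have /andP[/ltW] := ker_gt0 i x th. Qed.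

Lemma mixE (G : probability (Rvec R d) R) i x : (\int[G]_th (ker i x th)%:E = (mix G i x)%:E)%E.
Proof. by have [] := Rintegral_bounded G (mkerth i x) (kerC i x). Qed.

Lemma mix_gt0 (G : probability (Rvec R d) R) i x : 0 < mix G i x.
Proof. exact: Rintegral_probability_gt0 (mkerth i x) (ker_gt0 i x). Qed.

Lemma measurable_mix (G : probability (Rvec R d) R) i : measurable_fun setT (mix G i).
Proof.
apply/measurable_EFinP.
have -> : EFin \o mix G i = fun x => (\int[G]_th (ker i x th)%:E)%E.
  by apply/funext => x; rewrite /= mixE.
apply: (measurable_fun_fubini_tonelli_F (fun p => (ker i p.1 p.2)%:E)) => //.
- by apply/measurable_EFinP.
- by move=> p; rewrite lee_fin.
Qed.

Let etah i x : - 2^-1 <= eta * h i x <= 2^-1.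
Proof.
rewrite -ler_norml normrM gtr0_norm// (le_trans _ etaS)// ler_pM2l//.
Qed.

Let integral_lin i th a b : (lam.-integrable setT (fun x => ((a + b * h i x) * ker i x th)%:E)) /\
  (\int[lam]_x ((a + b * h i x) * ker i x th)%:E = (a + b * w th)%:E)%E.
Proof.
have ik : lam.-integrable setT (fun x => (ker i x th)%:E).
  apply/integrableP; split; first by apply/measurable_EFinP.
  under eq_integral => x _ do rewrite gee0_abs ?lee_fin//.
  by rewrite ker1 ltry.
have [ih hE] := hker i th.
have E : (fun x => ((a + b * h i x) * ker i x th)%:E) = (fun x => a%:E * (ker i x th)%:E + b%:E * (h i x * ker i x th)%:E)%E.
  by apply/funext => x; rewrite -!EFinM -EFinD; congr EFin; ring.
have i1 := integrableZl measurableT a ik; have i2 := integrableZl measurableT b ih.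
rewrite E; split; first exact: (integrableD measurableT i1 i2).
rewrite (integralD measurableT i1 i2) (integralZl measurableT ik) (integralZl measurableT ih).
by rewrite ker1 hE mule1 -EFinM -EFinD.
Qed.

(** Integrating in x first turns h into w under the mixing measure; the sign condition allows
    Tonelli. *)
Let integral_f_lin i a b : (forall x, 0 <= a + b * h i x) ->
  (\int[lam]_x ((a + b * h i x) * f i x)%:E = (a + b * mu)%:E)%E.
Proof.
move=> ab0.
transitivity (\int[lam]_x \int[Gs]_th ((a + b * h i x) * ker i x th)%:E)%E.
  apply: eq_integral => x _; under [RHS]eq_integral do rewrite EFinM.
  rewrite ge0_integralZl_EFin//; first by rewrite mixE.
  - by move=> th _; rewrite lee_fin.
  - by apply/measurable_EFinP.
have := @fubini_tonelli _ _ _ _ R lam Gs (fun p => ((a + b * h i p.1) * ker i p.1 p.2)%:E).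
move=> ->; last 2 first.
- apply/measurable_EFinP; apply: measurable_funM => //.
  apply: measurable_funD => //; apply: measurable_funM => //.
  exact: (measurableT_comp (mh i) measurable_fst).
- by move=> p; rewrite lee_fin mulr_ge0.
under eq_integral do rewrite (integral_lin i _ a b).2.
have wC x : `|w x| <= 1 by have /andP[h1 h2] := w01 x; rewrite ger0_norm.
have [iw wE] := Rintegral_bounded Gs mw wC.
have i1 : Gs.-integrable setT (EFin \o cst a) by exact: finite_measure_integrable_cst.
have i2 := integrableZl measurableT b iw.
under eq_integral do rewrite EFinD EFinM.
rewrite (integralD measurableT i1 i2) (integralZl measurableT iw) wE -EFinM EFinD; congr (_ + _)%E.
rewrite (_ : EFin \o cst a = cst a%:E)// integral_cst// -[RHS]mule1; congr (_ * _)%E; exact: probability_setT.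
Qed.

Let f_gt0 i x : 0 < f i x. Proof. exact: mix_gt0. Qed.
Let mf i : measurable_fun setT (f i). Proof. exact: measurable_mix. Qed.

Let r_ge i x : kap <= r i x.
Proof.
rewrite /r /ref_density lerDr mulr_ge0 ?(ltW (f_gt0 _ _))//.
by have /andP[] := etah i x; lra.
Qed.
Let r_gt0 i x : 0 < r i x. Proof. exact: lt_le_trans kap0 (r_ge i x). Qed.
Let mr i : measurable_fun setT (r i).
Proof.
apply: measurable_funD => //; apply: measurable_funM => //.
by apply: measurable_funD => //; apply: measurable_funM.
Qed.

Context (dO : measure_display) (Om : measurableType dO) (P : probability Om R) (X : 'I_n -> {RV P >-> Rvec R d}).
Hypotheses (indX : mutually_independent X) (Xf : forall i, has_density (X i) (f i)).

(** Under f the ratio r / f has on the box the integral of r as expectation, at most 1 + eta mu +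
    kap V <= exp (eta mu + kap V). *)
Lemma ratio_tail a : exists E : set Om, [/\ measurable E, (P E <= (expR (- a))%:E)%E &
  forall om, ~ E om -> (forall i, box (X i om)) ->
   \sum_i ln (r i (X i om) / f i (X i om)) <= n%:R * (eta * mu + kap * V) + a].
Proof.
(* The constant kap is integrated over the box only; for data in the box the indicator is 1. *)
pose g i x : R := \1_box x * (r i x / f i x).
have mfV i : measurable_fun setT (fun x => (f i x)^-1).
  exact: measurable_funV_gt0.
have [] := @prod_density_tail R d dO Om P n X f g (eta * mu + kap * V) a indX Xf mf (fun i x => ltW (f_gt0 i x)).
- by move=> i; apply: measurable_funM => //; apply: measurable_funM.
- by move=> i x; rewrite mulr_ge0// divr_ge0// ltW.
- move=> i.
  have E x : (g i x * f i x)%:E = ((\1_box x * ((1 + eta * h i x) * f i x))%:E + kap%:E * (\1_box x)%:E)%E.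
    rewrite /g -EFinM -EFinD; congr EFin; rewrite -mulrA divfK ?gt_eqF// /r /ref_density; ring.
  have p0 x : 0 <= 1 + eta * h i x by have /andP[] := etah i x; lra.
  under eq_integral do rewrite E.
  rewrite ge0_integralD//; last 4 first.
  + by move=> x _; rewrite lee_fin !mulr_ge0// ltW.
  + apply/measurable_EFinP; apply: measurable_funM => //; apply: measurable_funM => //.
    by apply: measurable_funD => //; apply: measurable_funM.
  + by move=> x _; rewrite -EFinM lee_fin mulr_ge0// ltW.
  + by apply/measurable_EFinP; apply: measurable_funM.
  rewrite ge0_integralZl_EFin//; last 2 first.
  + by apply/measurable_EFinP.
  + exact: ltW.
  have -> : (\int[lebesgue_vec d]_x (\1_box x)%:E = V%:E)%E by rewrite integral_indic// setIT; exact: boxV.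
  apply: (@le_trans _ _ ((1 + eta * mu)%:E + kap%:E * V%:E)%E); last first.
    by rewrite -EFinM -EFinD lee_fin -addrA expR_ge1Dx.
  rewrite leeD2r// -(integral_f_lin p0); apply: ge0_le_integral => //.
  + by move=> x _; rewrite lee_fin !mulr_ge0// ltW.
  + apply/measurable_EFinP; apply: measurable_funM => //; apply: measurable_funM => //.
    by apply: measurable_funD => //; apply: measurable_funM.
  + apply/measurable_EFinP; apply: measurable_funM => //.
    by apply: measurable_funD => //; apply: measurable_funM.
  + move=> x _; rewrite lee_fin ler_piMl ?mulr_ge0 ?(ltW (f_gt0 _ _))//.
move=> mE PE; exists [set om | expR (n%:R * (eta * mu + kap * V) + a) <= \prod_i g i (X i om)]; split => //.
move=> om /= /negP; rewrite -ltNge => lt bx.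
rewrite -ler_expR ltW// expR_sum; apply: le_lt_trans lt.
rewrite le_eqVlt; apply/orP; left; apply/eqP; apply: eq_bigr => i _.
by rewrite /g indicE mem_set// mul1r lnK// posrE divr_gt0.
Qed.

(** The mean of ker / r under f is at most int ker / (1 + eta h); then 1 / (1 + v) <= 1 - v + 2 v^2
    and int h ker = w give 1 - eta w(th) up to 2 (eta S)^2. The fluctuation is bounded crudely by
    ker / r <= Phi / kap. *)
Lemma net_tail th lamb a : 0 < lamb -> lamb * (Phi / kap) <= 2^-1 ->
  exists E : set Om, [/\ measurable E, (P E <= (expR (- a))%:E)%E &
  forall om, ~ E om -> (forall i, box (X i om)) ->
   lamb * \sum_i (ker i (X i om) th / r i (X i om)) <=
   n%:R * (lamb * (1 + 2 * (eta * S) ^+ 2 - eta * w th) + 2 * (lamb * (Phi / kap)) ^+ 2) + a].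
Proof.
move=> lamb0 lambB.
pose u i x : R := \1_box x * (ker i x th / r i x).
pose t := lamb * (1 + 2 * (eta * S) ^+ 2 - eta * w th) + 2 * (lamb * (Phi / kap)) ^+ 2.
have ind01 x : 0 <= (\1_box x : R) <= 1 by rewrite indicE; case: (_ \in _); rewrite ?lexx ?ler01.
have kr0 i x : 0 <= ker i x th / r i x by rewrite divr_ge0// ltW.
have u0 i x : 0 <= u i x by rewrite mulr_ge0//; have /andP[] := ind01 x.
have uB i x : u i x <= Phi / kap.
  apply: (@le_trans _ _ (ker i x th / r i x)); first by rewrite ler_piMl//; have /andP[] := ind01 x.
  have /andP[_ h1] := ker_gt0 i x th.
  apply: (@le_trans _ _ (Phi / r i x)); first by rewrite ler_pM2r ?invr_gt0.
  rewrite ler_pM2l ?lef_pV2 ?posrE ?r_ge//.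
  by have /andP[h2 h3] := ker_gt0 i x th; exact: lt_le_trans h3.
have lu i x : 0 <= lamb * u i x <= 2^-1.
  rewrite mulr_ge0// ?(ltW lamb0)//=; apply: le_trans lambB; by rewrite ler_pM2l.
have mu_ i : measurable_fun setT (u i).
  by apply: measurable_funM => //; apply: measurable_funM => //; exact: measurable_funV_gt0.
have uf i x : u i x * f i x <= (1 + 2 * (eta * S) ^+ 2 + (- eta) * h i x) * ker i x th.
  apply: (@le_trans _ _ (ker i x th / r i x * f i x)).
    by rewrite ler_pM2r ?f_gt0// ler_piMl//; have /andP[] := ind01 x.
  rewrite -mulrA [leRHS]mulrC ler_wpM2l// mulrC ler_pdivrMr//.
  have /andP[v1 v2] := etah i x.
  have vS : (eta * h i x) ^+ 2 <= (eta * S) ^+ 2.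
    rewrite -[leLHS]real_normK ?num_real// ler_pXn2r ?nnegrE//; last first.
      by rewrite mulr_ge0 ?(ltW eta0)// (le_trans _ (hS i x)).
    by rewrite normrM gtr0_norm// ler_wpM2l ?(ltW eta0).
  rewrite /r /ref_density; move: v1 v2 vS; rewrite mulNr; set v := eta * h i x; set q := (eta * S) ^+ 2 => v1 v2 vS.
  have q0 : 0 <= q by exact: sqr_ge0.
  have k0 : 0 <= (1 + 2 * q - v) * kap by apply: mulr_ge0; [lra|exact: ltW].
  have f0 := f_gt0 i x.
  have c1 : 1 <= (1 + 2 * q - v) * (1 + v).
    have : 0 <= (q - v ^+ 2) * (1 + v) by apply: mulr_ge0; lra.
    have : 0 <= v ^+ 2 * (1 + 2 * v) by apply: mulr_ge0; [exact: sqr_ge0|lra].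
    nra.
  have : 0 <= ((1 + 2 * q - v) * (1 + v) - 1) * f i x by apply: mulr_ge0; [lra|exact: ltW].
  lra.
(* exp y <= 1 + y + 2 y^2: the quadratic term is integrated against the probability density f, the
   linear one goes through [uf]. *)
have ef i x : expR (lamb * u i x) * f i x <= (1 + 2 * (lamb * (Phi / kap)) ^+ 2 + 0 * h i x) * f i x
   + lamb * ((1 + 2 * (eta * S) ^+ 2 + (- eta) * h i x) * ker i x th).
  have f0 := f_gt0 i x.
  have h1 := expR_le1Dxx2 (lu i x).
  have h2 : (lamb * u i x) ^+ 2 <= (lamb * (Phi / kap)) ^+ 2.
    have /andP[l0 _] := lu i x.
    rewrite ler_pXn2r ?nnegrE//; first by rewrite ler_pM2l.
    by apply: (le_trans l0); rewrite ler_pM2l.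
  have h3 := uf i x; rewrite -(ler_pM2l lamb0) in h3.
  apply: (@le_trans _ _ ((1 + lamb * u i x + 2 * (lamb * (Phi / kap)) ^+ 2) * f i x)).
    rewrite ler_pM2r//; lra.
  rewrite mul0r; lra.
have [] := @prod_density_tail R d dO Om P n X f (fun i x => expR (lamb * u i x)) t a indX Xf mf (fun i x => ltW (f_gt0 i x)).
- by move=> i; apply: measurableT_comp => //; apply: measurable_funM.
- by move=> i x; exact: expR_ge0.
- move=> i.
  have p1 x : 0 <= 1 + 2 * (lamb * (Phi / kap)) ^+ 2 + 0 * h i x.
    by rewrite mul0r addr0 addr_ge0// mulr_ge0// sqr_ge0.
  have p2 x : 0 <= 1 + 2 * (eta * S) ^+ 2 + (- eta) * h i x.
    have : 0 <= (eta * S) ^+ 2 by exact: sqr_ge0.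
    by have /andP[v1 v2] := etah i x; rewrite mulNr; lra.
  apply: (@le_trans _ _ (\int[lebesgue_vec d]_x (((1 + 2 * (lamb * (Phi / kap)) ^+ 2 + 0 * h i x) * f i x)%:E
   + lamb%:E * ((1 + 2 * (eta * S) ^+ 2 + (- eta) * h i x) * ker i x th)%:E))%E).
    apply: ge0_le_integral => //.
    + by move=> x _; rewrite lee_fin mulr_ge0 ?expR_ge0// ltW.
    + apply/measurable_EFinP; apply: measurable_funM => //; apply: measurableT_comp => //.
      exact: measurable_funM.
    + apply/measurable_EFinP; apply: measurable_funD.
        apply: measurable_funM => //; apply: measurable_funD => //; exact: measurable_funM.
      apply: measurable_funM => //; apply: measurable_funM => //.
      apply: measurable_funD => //; exact: measurable_funM.
    + by move=> x _; rewrite -EFinM -EFinD lee_fin.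
  rewrite ge0_integralD//; last 4 first.
  + by move=> x _; rewrite lee_fin mulr_ge0// ltW.
  + apply/measurable_EFinP; apply: measurable_funM => //; apply: measurable_funD => //; exact: measurable_funM.
  + by move=> x _; rewrite -EFinM lee_fin !mulr_ge0// ltW.
  + apply/measurable_EFinP; apply: measurable_funM => //; apply: measurable_funM => //.
    apply: measurable_funD => //; exact: measurable_funM.
  rewrite (integral_f_lin p1) (integralZl measurableT (integral_lin i th _ _).1) (integral_lin i th _ _).2.
  rewrite -EFinM -EFinD lee_fin mul0r addr0 /t; apply: le_trans (expR_ge1Dx _).
  lra.
move=> mE PE; exists [set om | expR (n%:R * t + a) <= \prod_i expR (lamb * u i (X i om))]; split => //.
move=> om /= /negP; rewrite -ltNge -expR_sum ltr_expR => /ltW lt bx.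
apply: le_trans lt; rewrite mulr_sumr; apply: ler_sum => i _.
by rewrite /u indicE mem_set// mul1r.
Qed.

(** The exceptional event is fixed before G: the bounds at net points extend to K by the Lipschitz
    slacks and integrate against any G carried by K, so G may depend on the data. *)
Lemma likelihood_moment_bound (I : finType) (net : I -> Rvec R d) (K : set (Rvec R d)) Lip Lw lamb a a' :
  measurable K -> (0 < n)%N -> 0 <= Lip -> 0 < lamb -> lamb * (Phi / kap) <= 2^-1 ->
  (forall th, K th -> exists k, (forall i x, box x -> ker i x th <= ker i x (net k) + Lip) /\ w th <= w (net k) + Lw) ->
  exists E : set Om, [/\ measurable E, (P E <= (expR (- a) + #|I|%:R * expR (- a'))%:E)%E &
  forall om, ~ E om -> (forall i, box (X i om)) ->
  forall (G : probability (Rvec R d) R) eps, G K = 1%E ->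
   \sum_i ln (f i (X i om)) - \sum_i ln (mix G i (X i om)) <= n%:R * eps ->
   eta * (\int[G]_th w th - mu) <= eps + kap * V + a / n%:R + 2 * (eta * S) ^+ 2 + eta * Lw
      + 2 * lamb * (Phi / kap) ^+ 2 + a' / (lamb * n%:R) + Lip / kap].
Proof.
move=> mK n0 Lip0 lamb0 lambB netP.
have [E0 [mE0 PE0 E0P]] := ratio_tail a.
have /choice[E1 E1P] : forall k, exists E : set Om, [/\ measurable E, (P E <= (expR (- a'))%:E)%E &
  forall om, ~ E om -> (forall i, box (X i om)) ->
   lamb * \sum_i (ker i (X i om) (net k) / r i (X i om)) <=
   n%:R * (lamb * (1 + 2 * (eta * S) ^+ 2 - eta * w (net k)) + 2 * (lamb * (Phi / kap)) ^+ 2) + a'].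
  by move=> k; apply: net_tail.
have [mU PU] := union_bound (fun k => let: And3 h _ _ := E1P k in h) (fun k => let: And3 _ h _ := E1P k in h).
exists (E0 `|` \bigcup_k E1 k); split.
- exact: measurableU.
- by apply: le_trans; [exact: measureU2|rewrite EFinD leeD].
move=> om /= nE bx G eps GK lik.
have nE0 : ~ E0 om by move=> e; apply: nE; left.
have nE1 k : ~ E1 k om by move=> e; apply: nE; right; exists k.
have H0 := E0P om nE0 bx.
have H1 k := let: And3 _ _ h := E1P k in h om (nE1 k) bx.
have n0R : 0 < n%:R :> R by rewrite ltr0n.
have wC x : `|w x| <= 1 by have /andP[h1 h2] := w01 x; rewrite ger0_norm.
have [iw _] := Rintegral_bounded G mw wC.
have ik i : G.-integrable setT (EFin \o ker i (X i om)) by have [] := Rintegral_bounded G (mkerth i (X i om)) (kerC i (X i om)).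
have ikr i : G.-integrable setT (EFin \o (fun th => (r i (X i om))^-1 * ker i (X i om) th)).
  exact: (integrableZl measurableT _ (ik i)).
have [isum sumE] := Rintegral_sum (index_enum 'I_n) ikr.
(* Chosen so that c - n eta w bounds sum_i ker / r on K: the net bound divided by lamb, plus the
   slacks [Lw] and [Lip / kap], the latter since r >= kap. *)
pose c := n%:R * (1 + 2 * (eta * S) ^+ 2 + eta * Lw + 2 * lamb * (Phi / kap) ^+ 2 + Lip / kap) + a' / lamb.
have Kc th : K th -> 0 <= c - n%:R * eta * w th - \sum_i ((r i (X i om))^-1 * ker i (X i om) th).
  move=> Kth; have [k [kk wk]] := netP th Kth.
  rewrite subr_ge0.
  apply: (@le_trans _ _ (\sum_i (ker i (X i om) (net k) / r i (X i om) + Lip / kap))).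
    apply: ler_sum => i _.
    have h1 := kk i _ (bx i).
    rewrite mulrC; apply: (@le_trans _ _ ((ker i (X i om) (net k) + Lip) / r i (X i om))).
      by rewrite ler_pM2r ?invr_gt0.
    by rewrite mulrDl lerD2l ler_wpM2l// lef_pV2 ?posrE.
  rewrite big_split/= sumr_const card_ord -[_ *+ n]mulr_natl.
  have := H1 k; set s := \sum_i _ => H1k.
  have h2 : s <= n%:R * (1 + 2 * (eta * S) ^+ 2 - eta * w (net k) + 2 * lamb * (Phi / kap) ^+ 2) + a' / lamb.
    rewrite -(ler_pM2l lamb0); apply: (le_trans H1k).
    rewrite [leRHS]mulrDr [lamb * (a' / _)]mulrC divfK ?gt_eqF// lerD2r.
    rewrite le_eqVlt; apply/orP; left; apply/eqP; ring.
  have h3 : 0 <= n%:R * eta * (w (net k) + Lw - w th).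
    by apply: mulr_ge0; [rewrite mulr_ge0// ltW|rewrite subr_ge0].
  rewrite /c; lra.
have i1 : G.-integrable setT (EFin \o cst c) by exact: finite_measure_integrable_cst.
have i2 : G.-integrable setT (EFin \o (fun th => n%:R * eta * w th)) by exact: (integrableZl measurableT _ iw).
have i3 : G.-integrable setT (EFin \o (fun th => c - n%:R * eta * w th)) by exact: (integrableB measurableT i1 i2).
have := Rintegral_ge0_ae (integrableB measurableT i3 isum) mK GK Kc.
rewrite (RintegralB measurableT i3 isum) (RintegralB measurableT i1 i2) (RintegralZl _ measurableT iw) sumE.
rewrite Rintegral_cst// (_ : fine (G setT) = 1); last by rewrite (@probability_setT _ _ _ G).
rewrite mulr1.
under eq_bigr => i _ do rewrite (RintegralZl _ measurableT (ik i)) -/(mix G i (X i om)).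
(* ln u <= u - 1 at u = mix / r, arranged so that ln (r / f) appears. *)
have lnmix i : ln (mix G i (X i om)) <= (r i (X i om))^-1 * mix G i (X i om) + ln (r i (X i om) / f i (X i om)) + ln (f i (X i om)) - 1.
  have m0 := mix_gt0 G i (X i om).
  rewrite ln_div ?posrE//.
  have q0 : 0 < mix G i (X i om) / r i (X i om) by rewrite divr_gt0.
  have := @le_ln1Dx R (mix G i (X i om) / r i (X i om) - 1).
  rewrite subrKC ln_div ?posrE// => /(_ _) h5.
  have := h5 ltac:(lra); lra.
have : \sum_i ln (mix G i (X i om)) <= \sum_i ((r i (X i om))^-1 * mix G i (X i om) + ln (r i (X i om) / f i (X i om)) + ln (f i (X i om)) - 1).
  by apply: ler_sum => i _.
rewrite !big_split/= sumr_const card_ord -[_ *+ n]mulr_natl.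
move: lik H0.
set s1 := \sum_i ln (f _ _); set s2 := \sum_i ln (mix _ _ _); set s3 := \sum_i ln (_ / _); set s4 := \sum_i _.
set Iw := \int[G]_x w x => lik H0 h6 h7.
have h8 : 0 <= n%:R * eps + c - n%:R * eta * Iw - n%:R + n%:R * (eta * mu + kap * V) + a by lra.
rewrite -(ler_pM2l n0R).
have -> : a' / (lamb * n%:R) = a' / lamb / n%:R by rewrite invfM mulrA.
rewrite (_ : n%:R * (_ + _ + _) = n%:R * eps + n%:R * kap * V + n%:R * (a / n%:R) + n%:R * 2 * (eta * S) ^+ 2 + n%:R * eta * Lw
  + n%:R * 2 * lamb * (Phi / kap) ^+ 2 + n%:R * (a' / lamb / n%:R) + n%:R * (Lip / kap)); last by ring.
have E1' x : n%:R * (x / n%:R) = x :> R by rewrite mulrC divfK ?gt_eqF.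
rewrite !E1'; move: h8; rewrite /c; lra.
Qed.
End likelihood.

(** * Gaussian mixtures *)

Lemma ler_dist_prod (R : realDomainType) (I : Type) (s : seq I) (a b : I -> R) (e : R) :
  (forall i, 0 <= a i <= 1) -> (forall i, 0 <= b i <= 1) -> (forall i, `|a i - b i| <= e) ->
  `|\prod_(i <- s) a i - \prod_(i <- s) b i| <= (size s)%:R * e.
Proof.
move=> a01 b01 ab; elim: s => [|i s IH]; first by rewrite !big_nil subrr normr0 mul0r.
have b1 : 0 <= \prod_(i <- s) b i <= 1.
  rewrite prodr_ge0 => [|j _]; last by have /andP[] := b01 j.
  by apply: prodr_ile1 => j _.
rewrite !big_cons /= -[(size s).+1%:R]natr1 mulrDl mul1r.
set A := \prod_(_ <- s) a _ in IH *; set B := \prod_(_ <- s) b _ in IH b1 *.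
have -> : a i * A - b i * B = a i * (A - B) + (a i - b i) * B by ring.
rewrite (le_trans (ler_normD _ _))// !normrM lerD//.
- apply: le_trans IH; have /andP[h1 h2] := a01 i; by rewrite (ger0_norm h1) ler_piMl.
- have /andP[h1 h2] := b1; apply: le_trans (ab i).
  by rewrite (ger0_norm h1) ler_piMr.
Qed.

Lemma lipschitz_cos (R : realType) (x y : R) : `|cos x - cos y| <= `|x - y|.
Proof.
wlog xy : x y / x <= y => [H|].
  by have [/H//|/ltW/H] := leP x y; rewrite distrC [in leRHS]distrC.
rewrite distrC [leRHS]distrC.
have [|c _ ->] := @MVT_segment R cos (fun t => - sin t) x y xy.
- by apply: continuous_subspaceT => t; exact: continuous_cos.
by rewrite normrM ler_piMl// normrN ler_norml sin_geN1 sin_le1.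
Qed.

Lemma lipschitz_expRN (R : realType) (x y : R) : 0 <= x -> 0 <= y -> `|expR (- x) - expR (- y)| <= `|x - y|.
Proof.
wlog xy : x y / x <= y => [H x0 y0|x0 y0].
  have [xy|/ltW xy] := leP x y; first exact: H.
  by rewrite distrC [leRHS]distrC; exact: H.
have e1 : expR (- y) <= expR (- x) by rewrite ler_expR lerN2.
rewrite ger0_norm ?subr_ge0// distrC ger0_norm ?subr_ge0//.
have h1 : expR (- x) <= 1 by rewrite -expR0 ler_expR oppr_le0.
have h2 : 1 - (y - x) <= expR (- (y - x)) by have := expR_ge1Dx (- (y - x)).
have -> : expR (- y) = expR (- x) * expR (- (y - x)) by rewrite -expRD; congr expR; ring.
have h3 : expR (- x) * (1 - (y - x)) <= expR (- x) * expR (- (y - x)) by rewrite ler_wpM2l ?expR_ge0.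
have h4 : 0 <= (1 - expR (- x)) * (y - x) by rewrite mulr_ge0 ?subr_ge0.
lra.
Qed.

Section kernel_lipschitz.
Context (R : realType).

Lemma fejer_kernelE M (v : R) : fejer_kernel M v =
  (\sum_(m < M.+1) \sum_(m' < M.+1) fejer_coef R M m * fejer_coef R M m' * cos ((m%:R - m'%:R) * v)) / fejer_norm R M.
Proof. by rewrite /fejer_kernel (sum_sqr_trig (fun m : 'I_M.+1 => fejer_coef R M m)). Qed.

Lemma fejer_kernel_le1 M (v : R) : (1 < M)%N -> fejer_kernel M v <= 1.
Proof.
move=> M1; rewrite -(sum_fejer_kernel v M1) (bigD1 ord0)//= mul0r subr0 lerDl.
by apply: sumr_ge0 => l _; exact: fejer_kernel_ge0.
Qed.

(** The frequencies are at most M and the normalised weights have total mass at most 1. *)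
Lemma lipschitz_fejer_kernel M (u v : R) : (1 < M)%N ->
  `|fejer_kernel M u - fejer_kernel M v| <= M%:R * `|u - v|.
Proof.
move=> M1; have N0 := fejer_norm_gt0 R M1.
rewrite !fejer_kernelE -mulrBl normrM normfV (gtr0_norm N0) ler_pdivrMr//.
rewrite mulrC; apply: le_trans (_ : (\sum_(m < M.+1) \sum_(m' < M.+1) fejer_coef R M m * fejer_coef R M m') * (M%:R * `|u - v|) <= _); last first.
  by rewrite ler_wpM2r ?mulr_ge0// sum_fejer_coef_le.
rewrite -sumrB mulr_suml (le_trans (ler_norm_sum _ _ _))//; apply: ler_sum => m _.
rewrite -sumrB mulr_suml (le_trans (ler_norm_sum _ _ _))//; apply: ler_sum => m' _.
have a0 := mulr_ge0 (fejer_coef_ge0 R m) (fejer_coef_ge0 R m').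
rewrite -mulrBr normrM (ger0_norm a0) ler_wpM2l// (le_trans (lipschitz_cos _ _))// -mulrBr normrM ler_wpM2r//.
rewrite ler_norml.
have := ltn_ord m; have := ltn_ord m'; rewrite !ltnS -!(ler_nat R).
have : (0 : R) <= m%:R by []. have : (0 : R) <= m'%:R by [].
by move=> ? ? ? ?; apply/andP; split; lra.
Qed.

Lemma lipschitz_pou d M (om e : R) (z : {ffun 'I_d -> 'I_M.+1}) (x y : Rvec R d) :
  (1 < M)%N -> 0 <= om -> (forall j, `|(tnth x j : R) - tnth y j| <= e) ->
  `|pou om z x - pou om z y| <= d%:R * (M%:R * (om * e)).
Proof.
move=> M1 om0 xy; have := @ler_dist_prod R 'I_d (index_enum 'I_d).
have -> : size (index_enum 'I_d) = d by rewrite -[RHS](card_ord d) cardT enumT.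
apply.
- by move=> j; rewrite fejer_kernel_ge0// fejer_kernel_le1.
- by move=> j; rewrite fejer_kernel_ge0// fejer_kernel_le1.
move=> j; rewrite (le_trans (lipschitz_fejer_kernel _ _ M1))// ler_wpM2l//.
have -> : om * (tnth x j : R) - (z j)%:R * grid_step R M - (om * (tnth y j : R) - (z j)%:R * grid_step R M)
  = om * ((tnth x j : R) - tnth y j) by ring.
by rewrite normrM ger0_norm// ler_wpM2l.
Qed.

Lemma pou_le1 d M (om : R) (z : {ffun 'I_d -> 'I_M.+1}) (x : Rvec R d) :
  (1 < M)%N -> pou om z x <= 1.
Proof.
by move=> M1; apply: prodr_ile1 => j _; rewrite fejer_kernel_ge0// fejer_kernel_le1.
Qed.

End kernel_lipschitz.

Section gauss_kernel.
Context (R : realType) (d : nat) (sg : 'I_d -> R) (k : R).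
Hypotheses (k0 : 0 < k) (sg_gt0 : forall j, 0 < sg j) (sgk : forall j, k <= sg j ^+ 2).

Definition gauss_kernel (x th : Rvec R d) : R :=
  \prod_j normal_pdf (tnth th j : R) (sg j) (tnth x j).

Let sg0 j : sg j != 0. Proof. by rewrite gt_eqF. Qed.

Lemma measurable_gauss_kernel :
  measurable_fun setT (fun p : Rvec R d * Rvec R d => gauss_kernel p.1 p.2).
Proof.
apply: measurable_prod => j _.
under eq_fun do rewrite normal_pdfE//.
apply: measurable_funM => //; apply: measurableT_comp => //.
apply: measurable_funM => //; apply: measurableT_comp => //; apply: measurable_funX.
apply: measurable_funB.
- exact: (measurableT_comp (measurable_tnth j) measurable_fst).
- exact: (measurableT_comp (measurable_tnth j) measurable_snd).
Qed.

Let peak : R := normal_peak (Num.sqrt k).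

Let peak_le j : normal_peak (sg j) <= peak.
Proof.
rewrite /peak /normal_peak sqr_sqrtr ?(ltW k0)// lef_pV2 ?posrE ?sqrtr_gt0; last 2 first.
- by rewrite mulrn_wgt0// mulr_gt0 ?pi_gt0// exprn_gt0.
- by rewrite mulrn_wgt0// mulr_gt0 ?pi_gt0.
by rewrite ler_sqrt ?lerMn2r//= ?ler_pM2r ?pi_gt0// mulrn_wge0// mulr_ge0 ?pi_ge0// sqr_ge0.
Qed.

Lemma gauss_kernel_bounds x th : 0 < gauss_kernel x th <= peak ^+ d.
Proof.
apply/andP; split.
  by apply: prodr_gt0 => j _; rewrite normal_pdfE// mulr_gt0 ?normal_peak_gt0 ?expR_gt0.
rewrite -[d in leRHS](card_ord d) -prodr_const; apply: ler_prod => j _.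
by rewrite normal_pdf_ge0 /= (le_trans (normal_pdf_ub _ _ (sg0 j))).
Qed.

Lemma integral_gauss_kernel th : (\int[lebesgue_vec d]_x (gauss_kernel x th)%:E = 1)%E.
Proof.
have [_ ->] := @integral_lebesgue_vec_prod R d (fun j => normal_pdf (tnth th j : R) (sg j)) (fun j => integrable_normal_pdf _ _).
by congr EFin; apply: big1 => j _; rewrite /Rintegral integral_normal_pdf.
Qed.

(** exp is 1-Lipschitz on the negative half-line, and inside the cube each quadratic exponent moves
    by at most 4 D e / (2 k). *)
Lemma lipschitz_gauss_kernel (D e : R) x th th' : cube D x -> cube D th -> cube D th' ->
  (forall j, `|(tnth th j : R) - tnth th' j| <= e) ->
  gauss_kernel x th <= gauss_kernel x th' + peak ^+ d * (d%:R * (2 * D * e / k)).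
Proof.
move=> xD tD tD' tt'.
have gE t : gauss_kernel x t = (\prod_j normal_peak (sg j)) * \prod_j normal_fun (tnth t j : R) (sg j) (tnth x j).
  by rewrite -big_split; apply: eq_bigr => j _; rewrite normal_pdfE.
rewrite -lerBlDl !gE -mulrBr.
have n01 t j : 0 <= normal_fun (tnth t j : R) (sg j) (tnth x j) <= 1.
  by rewrite normal_fun_ge0 /normal_fun -expR0 ler_expR mulNr oppr_le0 divr_ge0 ?sqr_ge0// mulrn_wge0// sqr_ge0.
have nl j : `|normal_fun (tnth th j : R) (sg j) (tnth x j) - normal_fun (tnth th' j : R) (sg j) (tnth x j)| <= 2 * D * e / k.
  have s2 := lt_le_trans k0 (sgk j).
  rewrite /normal_fun !mulNr; apply: (le_trans (lipschitz_expRN _ _)).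
  - by rewrite divr_ge0 ?sqr_ge0// mulrn_wge0// sqr_ge0.
  - by rewrite divr_ge0 ?sqr_ge0// mulrn_wge0// sqr_ge0.
  rewrite -mulrBl normrM normfV (gtr0_norm (_ : 0 < sg j ^+ 2 *+ 2)) ?mulrn_wgt0//.
  have -> : ((tnth x j : R) - tnth th j) ^+ 2 - ((tnth x j : R) - tnth th' j) ^+ 2 =
     - ((tnth th j : R) - tnth th' j) * (2 * tnth x j - tnth th j - tnth th' j) by ring.
  rewrite ler_pdivrMr ?mulrn_wgt0// normrM normrN.
  have h4 : `|2 * (tnth x j : R) - tnth th j - tnth th' j| <= 4 * D.
    have /andP[a1 a2] := xD j; have /andP[b1 b2] := tD j; have /andP[c1 c2] := tD' j.
    by rewrite ler_norml; apply/andP; split; lra.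
  apply: (@le_trans _ _ (e * (4 * D))); first by rewrite ler_pM.
  have e0 := le_trans (normr_ge0 _) (tt' j).
  have D0 : 0 <= 4 * D by exact: le_trans h4.
  have : e * (4 * D) * 1 <= e * (4 * D) * (sg j ^+ 2 / k).
    by apply: ler_wpM2l; [exact: mulr_ge0|rewrite ler_pdivlMr// mul1r].
  rewrite -[sg j ^+ 2 *+ 2]mulr_natr; lra.
have := @ler_dist_prod R 'I_d (index_enum 'I_d) _ _ _ (n01 th) (n01 th') nl.
have -> : size (index_enum 'I_d) = d by rewrite -[RHS](card_ord d) cardT enumT.
move=> H; have H1 := le_trans (ler_norm _) H.
have p0 : 0 <= \prod_j normal_peak (sg j) by apply: prodr_ge0 => j _; exact: normal_peak_ge0.
apply: (le_trans (ler_wpM2l p0 H1)).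
rewrite ler_wpM2r//; first exact: le_trans H.
rewrite -[d in leRHS](card_ord d) -prodr_const; apply: ler_prod => j _.
by rewrite normal_peak_ge0 peak_le.
Qed.

Lemma integral_gauss_kernel_expR (s : R) j th :
  (\int[lebesgue_vec d]_x (expR (s * tnth x j) * gauss_kernel x th)%:E =
  (expR (s * tnth th j + s ^+ 2 * sg j ^+ 2 / 2))%:E)%E.
Proof.
pose g i x := (if i == j then expR (s * (tnth th i : R) + s ^+ 2 * sg i ^+ 2 / 2) else 1) *
   normal_pdf ((tnth th i : R) + (if i == j then s * sg i ^+ 2 else 0)) (sg i) x.
have gi i : (@lebesgue_measure R).-integrable setT (EFin \o g i).
  exact: (integrableZl measurableT _ (integrable_normal_pdf _ _)).
have [_ E] := integral_lebesgue_vec_prod gi.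
transitivity (\int[lebesgue_vec d]_x (\prod_j0 g j0 (tnth x j0))%:E)%E.
  apply: eq_integral => x _; congr EFin; rewrite /gauss_kernel (bigD1 j)//= [in RHS](bigD1 j)//= mulrA; congr (_ * _).
    by rewrite /g eqxx mulrC normal_pdf_expM.
  by apply: eq_bigr => i /negPf ij; rewrite /g ij mul1r addr0.
rewrite E; congr EFin.
have Ig i : \int[@lebesgue_measure R]_y g i y = (if i == j then expR (s * (tnth th i : R) + s ^+ 2 * sg i ^+ 2 / 2) else 1).
  rewrite (RintegralZl _ measurableT (integrable_normal_pdf _ _)) /Rintegral integral_normal_pdf.
  by rewrite /= mulr1.
by under eq_bigr do rewrite Ig; rewrite -big_mkcond big_pred1_eq.
Qed.

End gauss_kernel.

Lemma lebesgue_vec_cube (R : realType) d (D : R) : 0 <= D ->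
  lebesgue_vec d (cube D) = ((2 * D) ^+ d)%:E.
Proof.
move=> D0.
have mI : measurable (`[- D, D] : set R) by exact: measurable_itv.
have muI : @lebesgue_measure R `[- D, D] = (2 * D)%:E.
  rewrite lebesgue_measure_itv /= lte_fin.
  case: ifPn => [_|]; first by rewrite -EFinB; congr EFin; ring.
  by rewrite -leNgt => h; congr EFin; lra.
have II : (\int[@lebesgue_measure R]_x (\1_(`[- D, D] : set R) x)%:E = (2 * D)%:E)%E.
  by rewrite integral_indic// setIT; exact: muI.
have gi (j : 'I_d) : (@lebesgue_measure R).-integrable setT (EFin \o (\1_`[- D, D] : R -> R)).
  apply/integrableP; split; first exact/measurable_EFinP.
  under eq_integral do rewrite gee0_abs ?lee_fin//.
  by rewrite II ltry.
have [_] := integral_lebesgue_vec_prod gi.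
have -> : (fun x : Rvec R d => (\prod_(j < d) (\1_`[- D, D] (tnth x j) : R))%:E) = fun x => (\1_(cube D) x)%:E.
  apply/funext => x; congr EFin; rewrite indicE.
  have [xD|xD] := boolP (x \in cube D).
    apply: big1 => j _; rewrite indicE mem_set//= in_itv /=; move/set_mem: xD; exact.
  have : exists j, ~ (- D <= (tnth x j : R) <= D).
    by apply/not_existsP => H; move/negP: xD; apply; apply/mem_set => j; apply: contrapT.
  by move=> [j xj]; rewrite (bigD1 j)//= indicE memNset ?mul0r//= in_itv.
rewrite integral_indic ?setIT//; last exact: measurable_cube.
move=> ->; congr EFin; rewrite -[d in RHS](card_ord d) -prodr_const; apply: eq_bigr => j _.
by rewrite /Rintegral II.
Qed.

(** Turns the random support of the estimator into a fixed one as soon as the data lie in the cube;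
    n > 0 makes the infimum and supremum range over a nonempty set. *)
Lemma bounding_box_cube (R : realType) d n (D : R) (x : 'I_n -> Rvec R d) (G : probability (Rvec R d) R) :
  (0 < n)%N -> (forall i, cube D (x i)) -> G (bounding_box x) = 1%E -> G (cube D) = 1%E.
Proof.
move=> n0 xD G1; apply/eqP; rewrite eq_le; apply/andP; split.
  by apply: probability_le1; exact: measurable_cube.
apply: (@le_trans _ _ (G (bounding_box x))); first by rewrite G1.
apply: le_measure; rewrite ?inE; [exact: measurable_box|exact: measurable_cube|].
move=> t tb j; have /andP[t1 t2] := tb j.
have ne : range (fun i => tnth (x i) j : R) !=set0 by exists (tnth (x (Ordinal n0)) j); exists (Ordinal n0).
apply/andP; split.
- by apply: le_trans t1; apply: lb_le_inf => // _ [i _ <-]; have /andP[] := xD i j.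
- by apply: (le_trans t2); apply: ge_sup => // _ [i _ <-]; have /andP[] := xD i j.
Qed.

Lemma density_tail (R : realType) d dO (Om : measurableType dO) (P : probability Om R)
   (X : {RV P >-> Rvec R d}) (f g : Rvec R d -> R) (t a : R) :
  has_density X f -> measurable_fun setT f -> (forall x, 0 <= f x) ->
  measurable_fun setT g -> (forall x, 0 <= g x) ->
  (\int[lebesgue_vec d]_x (g x * f x)%:E <= (expR t)%:E)%E ->
  let E := [set w | expR (t + a) <= g (X w)] in
  measurable E /\ (P E <= (expR (- a))%:E)%E.
Proof.
move=> Xf mf f0 mg g0 gt E.
apply: markov_expR => //; last by rewrite (integral_has_density Xf).
by apply: measurableT_comp => //; exact: measurable_funP.
Qed.

Lemma ge0_integral_le_ae d (T : measurableType d) (R : realType) (Q : probability T R) (f : T -> R) K c :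
  measurable_fun setT f -> (forall x, 0 <= f x) -> measurable K -> Q K = 1%E ->
  0 <= c -> (forall x, K x -> f x <= c) -> (\int[Q]_x (f x)%:E <= c%:E)%E.
Proof.
move=> mf f0 mK QK c0 fc.
have QC : Q (~` K) = 0%E by rewrite probability_setC// QK subee.
rewrite (ge0_negligible_integral (measurableC mK) measurableT _ _ QC); last 2 first.
- exact/measurable_EFinP.
- by move=> x _; rewrite lee_fin.
rewrite setTD setCK; apply: (@le_trans _ _ (\int[Q]_(x in K) (cst c%:E x))%E).
  apply: ge0_le_integral => //.
  - by move=> x _; rewrite lee_fin.
  - by apply/measurable_EFinP; exact: measurable_funTS.
by rewrite integral_cst// -[leRHS]mule1; rewrite lee_wpmul2l ?lee_fin// probability_le1.
Qed.

(** * Confinement of the data to a cube *)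

Section gaussian_data.
Context (R : realType) (d n : nat) (sg : 'I_n -> 'I_d -> R) (k K L : R).
Variable (Gs : probability (Rvec R d) R).
Hypotheses (k0 : 0 < k) (sg_gt0 : forall i j, 0 < sg i j)
  (sgk : forall i j, k <= sg i j ^+ 2 <= K) (GL : Gs (cube L) = 1%E).

Let ker i := gauss_kernel (sg i).

Let kle i j : k <= sg i j ^+ 2. Proof. by have /andP[] := sgk i j. Qed.
Let ker_bounds i x th : 0 < ker i x th <= normal_peak (Num.sqrt k) ^+ d :=
  gauss_kernel_bounds k0 (sg_gt0 i) (kle i) x th.
Let mker i : measurable_fun setT (fun p : Rvec R d * Rvec R d => ker i p.1 p.2) :=
  measurable_gauss_kernel (sg_gt0 i).

Lemma integral_mix_expR_le i j (s : R) :
  (\int[lebesgue_vec d]_x (expR (s * tnth x j) * mix ker Gs i x)%:E <=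
    (expR (`|s| * L + s ^+ 2 * K / 2))%:E)%E.
Proof.
have me : measurable_fun setT (fun x : Rvec R d => expR (s * tnth x j)).
  by apply: measurableT_comp => //; apply: measurable_funM => //; exact: measurable_tnth.
have -> : (\int[lebesgue_vec d]_x (expR (s * tnth x j) * mix ker Gs i x)%:E =
    \int[lebesgue_vec d]_x \int[Gs]_th (expR (s * tnth x j) * ker i x th)%:E)%E.
  apply: eq_integral => x _; under [RHS]eq_integral do rewrite EFinM.
  rewrite ge0_integralZl_EFin ?expR_ge0//; first by rewrite (mixE mker ker_bounds).
  - by move=> th _; rewrite lee_fin; have /andP[/ltW] := ker_bounds i x th.
  - by apply/measurable_EFinP; have := measurableT_comp (mker i) (pair1_measurable x).
rewrite (@fubini_tonelli _ _ _ _ R (lebesgue_vec d) Gs (fun p => (expR (s * tnth p.1 j) * ker i p.1 p.2)%:E)); last 2 first.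
- apply/measurable_EFinP; apply: measurable_funM => //.
  exact: (measurableT_comp me measurable_fst).
- by move=> p; rewrite lee_fin mulr_ge0 ?expR_ge0//; have /andP[/ltW] := ker_bounds i p.1 p.2.
under eq_integral do rewrite (integral_gauss_kernel_expR (sg_gt0 i)).
apply: (ge0_integral_le_ae _ _ (@measurable_cube R d L) GL) => //.
- apply: measurableT_comp => //; apply: measurable_funD => //; apply: measurable_funM => //.
  exact: measurable_tnth.
move=> th thL; rewrite ler_expR lerD//.
- rewrite (le_trans (ler_norm _))// normrM ler_wpM2l// ler_norml; exact: thL.
- by rewrite ler_pM2r// ler_wpM2l ?sqr_ge0//; have /andP[] := sgk i j.
Qed.

Context (dO : measure_display) (Om : measurableType dO) (P : probability Om R) (X : 'I_n -> {RV P >-> Rvec R d}).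
Hypothesis (Xf : forall i, has_density (X i) (mix ker Gs i)).

(** Chernoff with a fixed s: as D will be ln n, the factor expR (- s * D) is already a power of n.
    The boolean in the union selects the side of each coordinate. *)
Lemma data_in_cube (s D : R) : 0 < s -> exists E : set Om, [/\ measurable E,
   (P E <= (n%:R * d%:R * 2 * expR (s * L + s ^+ 2 * K / 2 - s * D))%:E)%E &
   forall om, ~ E om -> forall i, cube D (X i om)].
Proof.
move=> s0.
pose t := s * L + s ^+ 2 * K / 2.
pose g (b : bool) j (x : Rvec R d) := expR ((if b then s else - s) * tnth x j).
pose E (ijb : 'I_n * 'I_d * bool) := [set w | expR (t + (s * D - t)) <= g ijb.2 ijb.1.2 (X ijb.1.1 w)].
have EP ijb : measurable (E ijb) /\ (P (E ijb) <= (expR (- (s * D - t)))%:E)%E.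
  case: ijb => [[i j] b]; apply: (density_tail (s * D - t) (Xf i)).
  - exact: measurable_mix mker ker_bounds _ _.
  - by move=> x; rewrite ltW// (mix_gt0 mker ker_bounds).
  - by apply: measurableT_comp => //; apply: measurable_funM => //; exact: measurable_tnth.
  - by move=> x; exact: expR_ge0.
  - rewrite /g; apply: (le_trans (integral_mix_expR_le i j _)); rewrite lee_fin ler_expR /t.
    by case: b; rewrite ?normrN ?sqrrN gtr0_norm.
have [mU PU] := union_bound (fun i => (EP i).1) (fun i => (EP i).2).
exists (\bigcup_i E i); split => //.
  apply: (le_trans PU); rewrite lee_fin !card_prod !card_ord card_bool !natrM.
  by rewrite opprB /t.
move=> om nE i j.
have h b : (if b then s else - s) * tnth (X i om) j <= s * D.
  rewrite -ler_expR leNgt; apply/negP => /ltW lt; apply: nE; exists (i, j, b) => //.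
  by rewrite /E /= subrKC.
have h1 := h true; have h2 := h false; rewrite /= in h1 h2.
rewrite mulNr -mulrN in h2; rewrite !(ler_pM2l s0) in h1 h2.
by rewrite lerNl h2 h1.
Qed.

End gaussian_data.

(** * Logarithms against powers of n, and nets of polynomial size *)

Lemma near_ln_ge (R : realType) (A : R) : \forall n \near \oo, A <= ln (n%:R : R).
Proof.
near=> n.
have : expR A <= n%:R by near: n; exact: nbhs_infty_ger.
by move=> h; rewrite -[A]expRK ler_ln ?posrE ?expR_gt0// (lt_le_trans _ h) ?expR_gt0.
Unshelve. all: by end_near. Qed.

(** exp x >= x^(m+1) / (m+1)! leaves a spare factor ln n, which eventually exceeds any constant. *)
Lemma near_ln_pow_le (R : realType) (A : R) m (q : nat) : (0 < q)%N ->
  \forall n \near \oo, A * ln (n%:R : R) ^+ m <= expR (ln n%:R / q%:R).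
Proof.
move=> q0; near=> n.
have l1 : 1 <= ln (n%:R : R) by near: n; exact: near_ln_ge.
have lA : A * (q%:R ^+ m.+1 * m.+1`!%:R) <= ln (n%:R : R) by near: n; exact: near_ln_ge.
move: l1 lA; set l := ln _ => l1 lA.
have q0R : (0 : R) < q%:R by rewrite ltr0n.
have lq0 : 0 <= l / q%:R by rewrite divr_ge0 ?ltW// (lt_le_trans _ l1).
apply: le_trans (expR_ge1Dxn m lq0).
apply: (@le_trans _ _ ((l / q%:R) ^+ m.+1 / m.+1`!%:R)); last by rewrite lerDr.
have f0 : (0 : R) < m.+1`!%:R by rewrite ltr0n fact_gt0.
rewrite ler_pdivlMr// expr_div_n ler_pdivlMr ?exprn_gt0//.
rewrite [leRHS]exprSr [leRHS]mulrC.
have -> : A * l ^+ m * m.+1`!%:R * q%:R ^+ m.+1 = A * (q%:R ^+ m.+1 * m.+1`!%:R) * l ^+ m by ring.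
by rewrite ler_wpM2r// exprn_ge0// (le_trans _ l1).
Unshelve. all: by end_near. Qed.

Lemma cube_net (R : realType) d n (D : R) : (0 < n)%N -> 0 < D ->
  exists net : {ffun 'I_d -> 'I_n.+1} -> Rvec R d, (forall k, cube D (net k)) /\
    forall th, cube D th -> exists k, forall j, `|(tnth th j : R) - tnth (net k) j| <= 2 * D / n%:R.
Proof.
move=> n0 D0; have n0R : 0 < n%:R :> R by rewrite ltr0n.
have D2 : 0 < 2 * D / n%:R by rewrite divr_gt0// mulr_gt0.
pose net (k : {ffun 'I_d -> 'I_n.+1}) : Rvec R d := [tuple (2 * D / n%:R * (k j)%:R - D : measurableTypeR R) | j < d].
exists net; split => [k j|th thD].
  rewrite tnth_mktuple.
  have h1 : 2 * D / n%:R * (k j)%:R <= 2 * D.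
    by rewrite mulrAC ler_pdivrMr// ler_wpM2l ?mulr_ge0 ?(ltW D0)// ler_nat -ltnS.
  have h2 : 0 <= 2 * D / n%:R * (k j)%:R by rewrite mulr_ge0// ltW.
  by apply/andP; split; lra.
pose u j := ((tnth th j : R) + D) / (2 * D / n%:R).
have u0 j : 0 <= u j.
  by have /andP[h1 h2] := thD j; rewrite divr_ge0 ?(ltW D2)//; lra.
have un j : u j <= n%:R.
  have /andP[h1 h2] := thD j; rewrite ler_pdivrMr// mulrC divfK ?gt_eqF//; lra.
exists [ffun j => inord (Num.trunc (u j))] => j.
rewrite tnth_mktuple ffunE inordK; last first.
  by rewrite ltnS -(ler_nat R) (le_trans _ (un j))//; have /andP[] := truncn_itv (u0 j).
have /andP[h1 h2] := truncn_itv (u0 j).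
have E : (tnth th j : R) = 2 * D / n%:R * u j - D.
  by rewrite /u mulrC divfK ?gt_eqF// addrK.
rewrite [in X in X - _]E.
have -> : 2 * D / n%:R * u j - D - (2 * D / n%:R * (Num.trunc (u j))%:R - D) = 2 * D / n%:R * (u j - (Num.trunc (u j))%:R) by ring.
rewrite normrM gtr0_norm// ger0_norm ?subr_ge0// ler_piMr// ?(ltW D2)//.
by rewrite lerBlDl natr1 ltW.
Qed.

Section gaussian_moment.
Context (R : realType) (d n : nat) (sg : 'I_n -> 'I_d -> R) (k K : R).
Variable (Gs : probability (Rvec R d) R).
Hypotheses (k0 : 0 < k) (sg_gt0 : forall i j, 0 < sg i j)
  (sgk : forall i j, k <= sg i j ^+ 2 <= K).
Let ker i := gauss_kernel (sg i).
Let Phi : R := normal_peak (Num.sqrt k) ^+ d.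
Context (dO : measure_display) (Om : measurableType dO) (P : probability Om R) (X : 'I_n -> {RV P >-> Rvec R d}).
Hypotheses (indX : mutually_independent X) (Xf : forall i, has_density (X i) (mix ker Gs i)).

(** Cell z plays w, and its deconvolution, which varies with i through [sg i], plays h: the target
    is common although the noise levels differ. The mesh 2 D / n makes both Lipschitz errors of
    order 1 / n up to slowly growing factors. *)
Lemma pou_moment_bound (M : nat) (z : {ffun 'I_d -> 'I_M.+1}) (D S eta kap lamb a a' : R) :
  (0 < n)%N -> (1 < M)%N -> 0 < D -> 0 < eta -> 0 < kap -> 0 < lamb ->
  expR (d%:R * (M%:R ^+ 2 * (D^-1 ^+ 2 * K) / 2)) <= S -> eta * S <= 2^-1 ->
  lamb * (Phi / kap) <= 2^-1 ->
  exists E : set Om, [/\ measurable E, (P E <= (expR (- a) + n.+1%:R ^+ d * expR (- a'))%:E)%E &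
  forall om, ~ E om -> (forall i, cube D (X i om)) ->
  forall (G : probability (Rvec R d) R) eps, G (cube D) = 1%E ->
   \sum_i ln (mix ker Gs i (X i om)) - \sum_i ln (mix ker G i (X i om)) <= n%:R * eps ->
   eta * (\int[G]_th pou D^-1 z th - \int[Gs]_th pou D^-1 z th) <=
     eps + kap * (2 * D) ^+ d + a / n%:R + 2 * (eta * S) ^+ 2
      + eta * (d%:R * (M%:R * (D^-1 * (2 * D / n%:R))))
      + 2 * lamb * (Phi / kap) ^+ 2 + a' / (lamb * n%:R)
      + Phi * (d%:R * (2 * D * (2 * D / n%:R) / k)) / kap].
Proof.
move=> n0 M1 D0 eta0 kap0 lamb0 hS etaS lambB.
have kle i j : k <= sg i j ^+ 2 by have /andP[] := sgk i j.
have [net [netD netP]] := cube_net d n0 D0.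
have n0R : 0 < n%:R :> R by rewrite ltr0n.
have V0 := lebesgue_vec_cube d (ltW D0).
have Phi0 : 0 <= Phi by rewrite exprn_ge0// normal_peak_ge0.
have := @likelihood_moment_bound R d n ker (fun i => pou_deconv D^-1 (sg i) z) (pou D^-1 z) Gs (cube D) Phi S ((2 * D) ^+ d) eta kap
  (fun i => measurable_gauss_kernel (sg_gt0 i)) (fun i => gauss_kernel_bounds k0 (sg_gt0 i) (kle i))
  (fun i => integral_gauss_kernel (sg i)) (fun i => measurable_pou_deconv D^-1 (sg i) z) _ _ (measurable_pou D^-1 z) _
  (@measurable_cube R d D) V0 eta0 kap0 etaS dO Om P X indX Xf _ net (cube D)
  (Phi * (d%:R * (2 * D * (2 * D / n%:R) / k))) (d%:R * (M%:R * (D^-1 * (2 * D / n%:R)))) lamb a a'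
  (@measurable_cube R d D) n0 _ lamb0 lambB.
rewrite card_ffun !card_ord natrX; apply.
- move=> i x; apply: le_trans hS; apply: pou_deconv_le => // j.
  by have /andP[] := sgk i j.
- by move=> i th; apply: integral_pou_deconv => // j; rewrite gt_eqF.
- by move=> x; rewrite pou_ge0// pou_le1.
- by rewrite !mulr_ge0 ?invr_ge0// ltW.
move=> th thD; have [kk kP] := netP th thD; exists kk; split.
- move=> i x xD; exact: lipschitz_gauss_kernel.
- rewrite -lerBlDl; apply: le_trans (ler_norm _) _.
  by apply: lipschitz_pou => //; rewrite invr_ge0 ltW.
Qed.

End gaussian_moment.

(* The integrals of the members of the partition sum to 1, so upper bounds for
   all of them give lower bounds. *)
Lemma pou_flip (R : realType) d M (om t : R) (G H : probability (Rvec R d) R) : (1 < M)%N -> 0 <= t ->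
  (forall z : {ffun 'I_d -> 'I_M.+1}, \int[G]_x pou om z x - \int[H]_x pou om z x <= t) ->
  forall z : {ffun 'I_d -> 'I_M.+1}, \int[H]_x pou om z x - \int[G]_x pou om z x <= M.+1%:R ^+ d * t.
Proof.
move=> M1 t0 GH z.
have sum1 (Q : probability (Rvec R d) R) : \sum_(z : {ffun 'I_d -> 'I_M.+1}) \int[Q]_x pou om z x = 1.
  have ip (y : {ffun 'I_d -> 'I_M.+1}) : Q.-integrable setT (EFin \o pou om y).
    have pC x : `|pou om y x| <= 1 by rewrite ger0_norm ?pou_ge0// pou_le1.
    by have [] := Rintegral_bounded Q (measurable_pou om y) pC.
  have [_ <-] := Rintegral_sum (index_enum {ffun 'I_d -> 'I_M.+1}) ip.
  under eq_Rintegral do rewrite sum_pou//.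
  by rewrite Rintegral_cst// (_ : fine (Q setT) = 1) ?mulr1// (@probability_setT _ _ _ Q).
have := sum1 G; have := sum1 H; rewrite (bigD1 z)//= => hH; rewrite (bigD1 z)//= => hG.
have -> : \int[H]_x pou om z x - \int[G]_x pou om z x = \sum_(y | y != z) (\int[G]_x pou om y x - \int[H]_x pou om y x).
  by rewrite sumrB; lra.
apply: (@le_trans _ _ (\sum_(y : {ffun 'I_d -> 'I_M.+1} | y != z) t)); first by apply: ler_sum => y _.
apply: (@le_trans _ _ (\sum_(y : {ffun 'I_d -> 'I_M.+1}) t)).
  by rewrite [leRHS](bigD1 z)//= lerDr.
by rewrite sumr_const card_ffun !card_ord -natrX mulr_natl.
Qed.

(** * Rates *)

(* Here p = n^(1/32). *)
Lemma moment_terms_le (R : realType) (p n I eps V a W Phi a' Lp : R) :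
  1 <= p -> n = p ^+ 32 -> eps <= p / n -> V <= p -> a <= p -> W <= p / n ->
  2 * Phi ^+ 2 <= p -> a' <= p -> Lp <= p / n ->
  p ^- 3 * I <= eps + p ^- 5 * V + a / n + 2 * (p ^- 3 * p) ^+ 2 + p ^- 3 * W
    + 2 * p ^- 15 * (Phi / p ^- 5) ^+ 2 + a' / (p ^- 15 * n) + Lp / p ^- 5 ->
  I <= 9 / p.
Proof.
move=> p1 -> heps hV ha hW hPhi ha' hL.
have p0 : 0 < p by exact: lt_le_trans p1.
rewrite !invfM; rewrite -!exprVn invrK in heps hW hL *.
set x := p^-1 in heps hW hL *.
have x0 : 0 < x by rewrite invr_gt0.
have x1 : x <= 1 by rewrite invf_le1.
have pk i j : p ^+ i * x ^+ (i + j) = x ^+ j.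
  by rewrite exprD mulrA -exprMn divff ?gt_eqF// expr1n mul1r.
have le4 i : x ^+ (4 + i) <= x ^+ 4 by rewrite exprD ler_piMr ?exprn_ge0 ?(ltW x0)// exprn_ile1// ltW.
have xk0 i : 0 <= x ^+ i by rewrite exprn_ge0// ltW.
have p31 : p * x ^+ 32 = x ^+ 31 := pk 1%N 31.
rewrite p31 in heps hW hL.
have T2 : x ^+ 5 * V <= x ^+ 4.
  by apply: le_trans (ler_wpM2l (xk0 5) hV) _; rewrite mulrC (pk 1%N 4).
have T3 : a * x ^+ 32 <= x ^+ 4.
  by apply: le_trans (ler_wpM2r (xk0 32) ha) _; rewrite p31 (le4 27).
have T4 : 2 * (x ^+ 3 * p) ^+ 2 = 2 * x ^+ 4.
  by rewrite [x ^+ 3 * p]mulrC (pk 1%N 2) -exprM.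
have T5 : x ^+ 3 * W <= x ^+ 4.
  by apply: le_trans (ler_wpM2l (xk0 3) hW) _; rewrite -exprD (le4 30).
have T6 : 2 * x ^+ 15 * (Phi * p ^+ 5) ^+ 2 <= x ^+ 4.
  have -> : 2 * x ^+ 15 * (Phi * p ^+ 5) ^+ 2 = 2 * Phi ^+ 2 * (p ^+ 10 * x ^+ (10 + 5)) by rewrite exprMn -exprM; ring.
  by rewrite pk; apply: le_trans (ler_wpM2r (xk0 5) hPhi) _; rewrite (pk 1%N 4).
have T7 : a' * (p ^+ 15 * x ^+ 32) <= x ^+ 4.
  rewrite (pk 15%N 17); apply: le_trans (ler_wpM2r (xk0 17) ha') _.
  by rewrite (pk 1%N 16) (le4 12).
have T8 : Lp * p ^+ 5 <= x ^+ 4.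
  apply: le_trans (ler_wpM2r _ hL) _; first by rewrite exprn_ge0// ltW.
  by rewrite mulrC (pk 5%N 26) (le4 22).
have T1 := le_trans heps (le4 27).
move=> H; rewrite -(ler_pM2l (exprn_gt0 3 x0)).
(* Eight terms, each at most x^4 except the fourth, which is 2 x^4. *)
have -> : x ^+ 3 * (9 * x) = 9 * x ^+ 4 by ring.
lra.
Qed.

(** The summands are the tails of the 2 n d signed coordinates and, for each of m cells, the failure
    n^-9 of [ratio_tail] and n^-(d+10) for at most (2 n)^d net points. Multiplied by n^8 they are at
    most d, 1 and 1. *)
Lemma bad_probability_le (R : realType) (d : nat) (n p m E : R) : (0 < d)%N -> 1 <= p -> n = p ^+ 32 ->
  m <= p -> 0 <= m -> 2 ^+ d <= p -> 2 * E <= p -> 0 <= E ->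
  n * d%:R * 2 * (E * n ^- 12) + m * (n ^- 9 + (2 * n) ^+ d * n ^- (d + 10)) <= (4 * d)%:R / n ^+ 8.
Proof.
move=> d0 p1 np mp m0 dp Ep E0.
have p0 : 0 < p by exact: lt_le_trans p1.
have n1 : 1 <= n by rewrite np exprn_ege1.
have n0 : 0 < n by exact: lt_le_trans n1.
have pn : p <= n by rewrite np -[leLHS]expr1 ler_weXn2l.
have p2n : p ^+ 2 <= n by rewrite np ler_weXn2l.
rewrite ler_pdivlMr ?exprn_gt0//.
have nk i j : n ^- (i + j) * n ^+ i = n ^- j.
  by rewrite exprD invfM mulrAC mulVf ?mul1r// expf_neq0// gt_eqF.
have -> : (n * d%:R * 2 * (E * n ^- 12) + m * (n ^- 9 + (2 * n) ^+ d * n ^- (d + 10))) * n ^+ 8 =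
   d%:R * (2 * E) * (n * (n ^- (8 + 4) * n ^+ 8)) + m * (n ^- (8 + 1) * n ^+ 8) + m * 2 ^+ d * (n ^- (d + 10) * n ^+ d * n ^+ 8).
  by rewrite exprMn; ring.
rewrite !nk (nk 8%N 2%N) [n * _]mulrC (nk 1%N 3%N).
have inv_le1 (u v : R) : u <= v -> 0 < v -> u * v^-1 <= 1 by move=> h v0; rewrite ler_pdivrMr// mul1r.
have h1 : 2 * E * n ^- 3 <= 1.
  apply: inv_le1; last by rewrite exprn_gt0.
  by rewrite (le_trans Ep)// (le_trans pn)// -[leLHS]expr1 ler_weXn2l.
have h2 : m * n ^- 1 <= 1 by apply: inv_le1; rewrite expr1// (le_trans mp).
have h3 : m * 2 ^+ d * n ^- 2 <= 1.
  apply: inv_le1; last by rewrite exprn_gt0.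
  by rewrite (le_trans (ler_pM m0 (exprn_ge0 _ _) mp dp))// -expr2 (le_trans p2n)// -[leLHS]expr1 ler_weXn2l.
have h4 : d%:R * (2 * E * n ^- 3) <= d%:R by rewrite ler_piMr.
have d1 : (1 : R) <= d%:R by rewrite ler1n.
rewrite natrM -mulrA; lra.
Qed.

(** These are the conditions eta S <= 1/2 and lamb Phi / kap <= 1/2 at S = p, eta = p^-3, kap =
    p^-5, lamb = p^-15. *)
Lemma small_scales (R : realType) (p Phi : R) : 2 <= p -> 0 <= Phi -> 2 * Phi <= p ->
  p ^- 3 * p <= 2^-1 /\ p ^- 15 * (Phi / p ^- 5) <= 2^-1.
Proof.
move=> p2 Phi0 hPhi.
have p0 : 0 < p by lra.
have pp j : p <= p ^+ j.+1 by rewrite -[leLHS]expr1 ler_weXn2l//; lra.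
split.
  have -> : p ^- 3 * p = p ^- 2 by rewrite exprS invfM mulrAC mulVf ?mul1r// gt_eqF.
  by rewrite lef_pV2 ?posrE ?exprn_gt0// (le_trans p2).
have -> : p ^- 15 * (Phi / p ^- 5) = Phi / p ^+ 10 by field; rewrite gt_eqF.
by rewrite ler_pdivrMr ?exprn_gt0//; have := pp 9%N; lra.
Qed.

(** * The transport bound at a fixed sample size *)

Section gaussian_W2.
Context (R : realType) (d n : nat) (sg : 'I_n -> 'I_d -> R) (k K L : R).
Variable (Gs : probability (Rvec R d) R).
Hypotheses (k0 : 0 < k) (sg_gt0 : forall i j, 0 < sg i j)
  (sgk : forall i j, k <= sg i j ^+ 2 <= K) (GL : Gs (cube L) = 1%E).
Let ker i := gauss_kernel (sg i).
Let Phi : R := normal_peak (Num.sqrt k) ^+ d.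
Context (dO : measure_display) (Om : measurableType dO) (P : probability Om R) (X : 'I_n -> {RV P >-> Rvec R d}).
Hypotheses (indX : mutually_independent X) (Xf : forall i, has_density (X i) (mix ker Gs i)).
Variables (Ghat : ('I_n -> Rvec R d) -> probability (Rvec R d) R) (M : nat) (c : R).
Let l : R := ln n%:R.
Let p : R := expR (l / 32).
Hypothesis lik : {ae P, forall om, Ghat (X ^~ om) (bounding_box (X ^~ om)) = 1%E /\
  \sum_i ln (mix ker Gs i (X i om)) - \sum_i ln (mix ker (Ghat (X ^~ om)) i (X i om)) <= n%:R * (c * (l ^+ d.+1 / n%:R))}.
Hypotheses (n0 : (0 < n)%N) (d0 : (0 < d)%N) (M1 : (1 < M)%N) (l0 : 0 < l) (Ll : L <= l)
  (hM : d%:R * (M%:R ^+ 2 * (l^-1 ^+ 2 * K) / 2) <= l / 32) (p2 : 2 <= p)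
  (hc : c * l ^+ d.+1 <= p) (hV : (2 * l) ^+ d <= p) (ha : 9 * l <= p)
  (hW : 2 * d%:R * M%:R <= p) (hPhi : 2 * Phi ^+ 2 <= p) (hPhi1 : 2 * Phi <= p)
  (hLip : Phi * d%:R * 4 / k * l ^+ 2 <= p) (ha' : (d + 10)%:R * l <= p)
  (hMp : M.+1%:R ^+ d <= p) (h2d : 2 ^+ d <= p) (hE : 2 * expR (12 * L + 72 * K) <= p)
  (htau : M.+1%:R ^+ d * (9 / p) < 1).

Lemma W2sq_gaussian : with_probability_at_least P (1 - (4 * d)%:R / n%:R ^+ 8)
  (fun om => (W2sq Gs (Ghat (X ^~ om)) <= (40 * d%:R * l ^+ 2 / (cos 1 ^+ 2 * M%:R ^+ 2) +
     (M.+1%:R ^+ d + 1) * (M.+1%:R ^+ d * (9 / p)) * (4 * d%:R * l ^+ 2))%:E)%E).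
Proof.
have n0R : 0 < n%:R :> R by rewrite ltr0n.
have np : n%:R = p ^+ 32 :> R.
  by rewrite /p -expRM_natl mulrC divfK// lnK// posrE.
have p0 : 0 < p by exact: expR_gt0.
have p1 : 1 <= p by apply: le_trans p2; rewrite ler1n.
have expn j : expR (- (j%:R * l)) = n%:R ^- j by rewrite expRN expRM_natl lnK.
have Phi0 : 0 <= Phi by rewrite exprn_ge0// normal_peak_ge0.
(* Order 12 gives tails expR (- 12 * l) = n^-12 with constant exp (12 L + 72 K), as 12^2 / 2 =
   72. *)
have s12 : (0 : R) < 12 by [].
have [E0 [mE0 PE0 E0P]] := data_in_cube k0 sg_gt0 sgk GL Xf l s12.
have [etaS lamB] := small_scales p2 Phi0 hPhi1.
have px j : 0 < p ^- j by rewrite invr_gt0 exprn_gt0.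
have hS : expR (d%:R * (M%:R ^+ 2 * (l^-1 ^+ 2 * K) / 2)) <= p by rewrite ler_expR.
(* The powers 3, 5, 15 give eta, kap, lamb. Level 9 l leaves n^-9 per cell; (d + 10) l leaves about
   n^-10 after the union over (n + 1)^d net points. *)
have /choice[E1 E1P] := fun z : {ffun 'I_d -> 'I_M.+1} => pou_moment_bound k0 sg_gt0 sgk indX Xf z (9 * l) ((d + 10)%:R * l) n0 M1 l0 (px 3%N) (px 5%N) (px 15%N) hS etaS lamB.
have [mU PU] := union_bound (fun z => let: And3 h _ _ := E1P z in h) (fun z => let: And3 _ h _ := E1P z in h).
have [N [mN N0 NP]] := lik.
pose B := (E0 `|` \bigcup_z E1 z) `|` N.
have mB : measurable B by apply: measurableU => //; exact: measurableU.
have PB : (P B <= ((4 * d)%:R / n%:R ^+ 8)%:E)%E.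
  rewrite measureU0//; last exact: measurableU.
  apply: le_trans; first exact: measureU2.
  apply: (@le_trans _ _ (_%:E + _%:E)%E); first by apply: leeD; [exact: PE0|exact: PU].
  rewrite -EFinD lee_fin.
  apply: le_trans (bad_probability_le (m := M.+1%:R ^+ d) (E := expR (12 * L + 72 * K)) d0 p1 np hMp _ h2d hE _); last 2 first.
  - by rewrite exprn_ge0.
  - exact: expR_ge0.
  rewrite card_ffun !card_ord natrX; apply: lerD.
    rewrite -expn -expRD le_eqVlt; apply/orP; left; apply/eqP; congr (_ * expR _).
    by field.
  rewrite ler_wpM2l ?exprn_ge0// !expn lerD2l ler_wpM2r ?invr_ge0 ?exprn_ge0 ?ler0n//.
  rewrite lerXn2r ?nnegrE ?mulr_ge0// mulr_natl mulr2n -natr1 lerD2l ler1n//.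
exists (~` B); split.
- exact: measurableC.
- rewrite probability_setC// EFinB leeB//.
move=> om nB.
have nE0 : ~ E0 om by move=> e; apply: nB; left; left.
have nE1 z : ~ E1 z om by move=> e; apply: nB; left; right; exists z.
have [bb li] : Ghat (X ^~ om) (bounding_box (X ^~ om)) = 1%E /\
  \sum_i ln (mix ker Gs i (X i om)) - \sum_i ln (mix ker (Ghat (X ^~ om)) i (X i om)) <= n%:R * (c * (l ^+ d.+1 / n%:R)).
  by apply: contrapT => H; apply: nB; right; exact: NP.
have xD := E0P om nE0.
have HD := bounding_box_cube n0 xD bb.
have tauz (z : {ffun 'I_d -> 'I_M.+1}) : \int[Ghat (X ^~ om)]_x pou l^-1 z x - \int[Gs]_x pou l^-1 z x <= 9 / p.
  have [_ _ H] := E1P z; have := H om (nE1 z) xD _ _ HD li.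
  apply: (moment_terms_le p1 np) => //.
  - by rewrite mulrA ler_pM2r ?invr_gt0.
  - rewrite (_ : _ * _ = 2 * d%:R * M%:R / n%:R); last by field; rewrite !gt_eqF.
    by rewrite ler_pM2r ?invr_gt0.
  - move: hLip; rewrite /Phi; set F := normal_peak _ ^+ d => hL.
    rewrite (_ : _ * _ = F * d%:R * 4 / k * l ^+ 2 / n%:R); last by field; rewrite !gt_eqF.
    by rewrite ler_pM2r ?invr_gt0.
apply: W2sq_le_pou => //.
- by rewrite htau mulr_gt0 ?exprn_gt0 ?ltr0n// divr_gt0.
- apply/eqP; rewrite eq_le; apply/andP; split.
    by apply: probability_le1; exact: measurable_cube.
  apply: (@le_trans _ _ (Gs (cube L))); first by rewrite GL.
  apply: le_measure; rewrite ?inE; [exact: measurable_cube|exact: measurable_cube|].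
  move=> t tL j; have /andP[t1 t2] := tL j.
  by rewrite (le_trans t2 Ll) andbT (le_trans _ t1)// lerN2.
(* The likelihood bounds the cell masses of the estimator from above; coupling from [Gs] asks for
   the opposite sign, at the price of the number of cells. *)
- by apply: pou_flip => //; rewrite ltW// divr_gt0.
Qed.

End gaussian_W2.

(** M is the integer part of sqrt (l^3 / (16 d K)), the largest integer keeping the deconvolution
    exponent below l / 32. As the root is at least 2, rounding loses at most a factor 2, whence 64 =
    4 * 16; M <= l^2 keeps the number of cells polylogarithmic in n. *)
Lemma frequency_bounds (R : realType) (d : nat) (K l : R) : (0 < d)%N -> 0 < K ->
  1 <= l -> 64 * d%:R * K <= l -> (16 * d%:R * K)^-1 <= l ->
  exists M : nat, [/\ (1 < M)%N, d%:R * (M%:R ^+ 2 * (l^-1 ^+ 2 * K) / 2) <= l / 32,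
    l ^+ 3 <= 64 * d%:R * K * M%:R ^+ 2 & M%:R <= l ^+ 2].
Proof.
move=> d0 K0 l1 hl1 hl2.
have d0R : (0 : R) < d%:R by rewrite ltr0n.
have dK : 0 < 16 * d%:R * K by rewrite !mulr_gt0.
have l0 : 0 < l by exact: lt_le_trans l1.
pose u := Num.sqrt (l ^+ 3 / (16 * d%:R * K)).
have u2 : u ^+ 2 = l ^+ 3 / (16 * d%:R * K) by rewrite sqr_sqrtr// divr_ge0 ?exprn_ge0// ltW.
have u0 : 0 <= u by exact: sqrtr_ge0.
have l3 : l <= l ^+ 3 by rewrite -[leLHS]expr1 ler_weXn2l.
have u_ge2 : 2 <= u.
  rewrite -(@ler_pXn2r _ 2)// ?nnegrE// u2 ler_pdivlMr//; lra.
have /andP[Mu uM] := truncn_itv u0.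
set M := Num.trunc u in Mu uM.
have M2 : M%:R ^+ 2 <= u ^+ 2 by rewrite lerXn2r ?nnegrE.
have uM2 : u <= 2 * M%:R.
  have : (1 : R) <= M%:R by rewrite ler1n truncn_gt0; lra.
  by move: uM; rewrite -natr1; lra.
exists M; split.
- by rewrite -(ler_nat R) -[2%:R]/(2 : R) ler_nat truncn_ge_nat.
- rewrite u2 ler_pdivlMr// in M2.
  have -> : d%:R * (M%:R ^+ 2 * (l^-1 ^+ 2 * K) / 2) = M%:R ^+ 2 * (16 * d%:R * K) / (32 * l ^+ 2).
    by field; rewrite gt_eqF.
  rewrite ler_pdivrMr ?mulr_gt0 ?exprn_gt0//.
  by rewrite (_ : l / 32 * _ = l ^+ 3)//; field.
- have : u ^+ 2 <= (2 * M%:R) ^+ 2 by rewrite lerXn2r ?nnegrE// mulr_ge0.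
  rewrite u2 ler_pdivrMr// exprMn; lra.
- rewrite -(@ler_pXn2r _ 2)// ?nnegrE ?exprn_ge0 ?(ltW l0)//.
  apply: (le_trans M2); rewrite u2 mulrC -exprM [leRHS]exprS.
  by rewrite ler_wpM2r ?exprn_ge0// ltW.
Qed.

(** The threshold is where kund, L and c enter, through [k], [L], [c], [F] and [e]. Powers such as l
    ^+ 0 give the bounds by p the common shape of [near_ln_pow_le] with q = 32. *)
Lemma eventual_scales (R : realType) (d : nat) (K L c F e k : R) :
  \forall n \near \oo, let l := ln (n%:R : R) in let p := expR (l / 32) in
    (0 < n)%N /\ [/\ 1 <= l, L <= l, 64 * d%:R * K <= l & (16 * d%:R * K)^-1 <= l] /\
    [/\ c * l ^+ d.+1 <= p, 2 ^+ d * l ^+ d <= p, 9 * l ^+ 1 <= p & 2 * d%:R * l ^+ 2 <= p] /\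
    [/\ 2 * F ^+ 2 * l ^+ 0 <= p, 2 * F * l ^+ 0 <= p, F * d%:R * 4 / k * l ^+ 2 <= p &
      (d + 10)%:R * l ^+ 1 <= p] /\
    [/\ 10 * 2 ^+ d * l ^+ (2 * d) <= p, 2 * e * l ^+ 0 <= p &
      72 * d%:R * (2 ^+ d) ^+ 2 * l ^+ (4 * d + 3) <= p].
Proof.
near=> n; split; first by near: n; exact: nbhs_infty_gt.
split; first by split; near: n; exact: near_ln_ge.
by split; [|split]; split; near: n; exact: (@near_ln_pow_le R _ _ 32).
Unshelve. all: by end_near. Qed.

(** The localisation term is of order 1 / l because l^3 <= 64 d K m^2; the leftover mass costs a
    power of l over p, which the last hypothesis makes at most 1 / l. *)
Lemma W2_bound_le (R : realType) (d : nat) (K l p m : R) : (0 < d)%N -> 0 < K -> 1 <= l -> 0 < p -> 0 < m ->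
  l ^+ 3 <= 64 * d%:R * K * m ^+ 2 -> m <= l ^+ 2 ->
  72 * d%:R * (2 ^+ d) ^+ 2 * l ^+ (4 * d + 3) <= p ->
  40 * d%:R * l ^+ 2 / (cos 1 ^+ 2 * m ^+ 2) +
     ((m + 1) ^+ d + 1) * ((m + 1) ^+ d * (9 / p)) * (4 * d%:R * l ^+ 2) <=
  (40 * 64 * d%:R ^+ 2 * K / cos 1 ^+ 2 + 1) / l.
Proof.
move=> d0 K0 l1 p0 m0 hm ml hp.
have d0R : (0 : R) < d%:R by rewrite ltr0n.
have l0 : 0 < l by exact: lt_le_trans l1.
have c0 : 0 < cos (1 : R) by exact: cos1_gt0.
rewrite [leRHS]mulrDl div1r; apply: lerD.
  rewrite ler_pdivlMr// mulrAC ler_pdivrMr ?mulr_gt0 ?exprn_gt0//.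
  rewrite (_ : 40 * 64 * _ * _ / _ * _ = 40 * d%:R * (64 * d%:R * K * m ^+ 2)); last first.
    by field; rewrite gt_eqF.
  rewrite (_ : _ * l ^+ 2 * l = 40 * d%:R * l ^+ 3); last by ring.
  by rewrite ler_wpM2l// mulr_ge0// ltW.
(* m + 1 <= 2 l^2, so q dominates the number of cells; then 72 = 2 * 9 * 4, and 4 d + 3 collects
   q^2, the squared side l^2 and the target 1 / l. *)
set q := 2 ^+ d * l ^+ (2 * d).
have mq : (m + 1) ^+ d <= q.
  have -> : q = (2 * l ^+ 2) ^+ d by rewrite exprMn -exprM.
  have : 1 <= l ^+ 2 by rewrite exprn_ege1.
  by move=> h; rewrite lerXn2r ?nnegrE; lra.
have q1 : 1 <= q by apply: mulr_ege1; rewrite exprn_ege1// ler1n.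
have mq0 : 0 <= (m + 1) ^+ d by rewrite exprn_ge0//; lra.
rewrite -[leRHS]mul1r ler_pdivlMr//.
apply: (@le_trans _ _ ((2 * q) * (q * (9 / p)) * (4 * d%:R * l ^+ 2) * l)).
  rewrite ler_wpM2r ?(ltW l0)// ler_wpM2r ?mulr_ge0 ?exprn_ge0 ?(ltW l0)//.
  rewrite ler_pM//; [lra|by rewrite mulr_ge0// divr_ge0// ltW|lra|].
  by rewrite ler_wpM2r// divr_ge0// ltW.
rewrite (_ : 2 * q * _ * _ * _ = (72 * d%:R * (2 ^+ d) ^+ 2 * l ^+ (4 * d + 3)) / p).
  by rewrite ler_pdivrMr// mul1r.
have -> : l ^+ (4 * d + 3) = (l ^+ (2 * d)) ^+ 2 * l ^+ 3 by rewrite -exprM -exprD mulnAC.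
by rewrite /q; field; rewrite gt_eqF.
Qed.

(** Here t is 2^d, q is 2^d l^(2 d) and r is the number of cells; the strict inequality provides tau
    < 1 for the coupling. *)
Lemma tenfold_bounds (R : realFieldType) (t q r p : R) :
  1 <= t -> t <= q -> r <= q -> 10 * q <= p -> [/\ 2 <= p, t <= p, r <= p & r * 9 < p].
Proof. by move=> *; split; lra. Qed.

Unset Implicit Arguments.

Theorem theorem11 (R : realType) (d : nat) (hd : (1 <= d)%N)
    (kbar : R) (hkbar : 0 < kbar) :
  exists C : R, 0 < C /\
  forall (kund L c : R), 0 < kund -> kund <= kbar -> 0 <= L -> 0 < c ->
  exists n0 : nat, forall n : nat, (n0 <= n)%N ->
  forall Sigma : 'I_n -> 'M[R]_d,
    (forall i, is_diag_mx (Sigma i)) ->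
    (forall i, loewner_le kund%:M (Sigma i) /\
               loewner_le (Sigma i) kbar%:M) ->
  forall Gstar : probability (Rvec R d) R, Gstar (cube L) = 1%E ->
  forall (dO : measure_display) (Omega : measurableType dO)
    (P : probability Omega R) (X : 'I_n -> {RV P >-> Rvec R d}),
    mutually_independent X ->
    (forall i, has_density (X i) (mixture_density Gstar (Sigma i))) ->
  forall Ghat : ('I_n -> Rvec R d) -> probability (Rvec R d) R,
    {ae P, forall w,
      Ghat (X ^~ w) (bounding_box (X ^~ w)) = 1%E /\
      loglik Sigma (X ^~ w) Gstar - loglik Sigma (X ^~ w) (Ghat (X ^~ w))
        <= c * (ln n%:R ^+ d.+1 / n%:R)} ->
  with_probability_at_least P (1 - (4 * d)%:R / n%:R ^+ 8)
    (fun w => (W2sq Gstar (Ghat (X ^~ w)) <= (C / ln n%:R)%:E)%E).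
Proof.
have c1 : 0 < cos (1 : R) ^+ 2 by rewrite exprn_gt0// cos1_gt0.
(* Fixed before kund, L and c: the constant of the localisation term, plus 1 for the leftover
   mass. *)
exists (40 * 64 * d%:R ^+ 2 * kbar / cos 1 ^+ 2 + 1); split.
  by apply: ltr_wpDl => //; apply: divr_ge0; [rewrite !mulr_ge0 ?(ltW hkbar)|exact: ltW].
move=> kund L c kund0 kk L0 c0.
have [n0 _ scales] := eventual_scales d kbar L c (normal_peak (Num.sqrt kund) ^+ d) (expR (12 * L + 72 * kbar)) kund.
exists n0 => n nn0 Sigma Sdiag Sbd Gs GL dO Om P X indX Xf Ghat lik.
have [npos [[l1 Ll hl1 hl2] [[hc hV ha hW] [[hPhi hPhi1 hLip ha'] [hMp hE hfin]]]]] := scales n nn0.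
have Sb i j : kund <= Sigma i j j <= kbar by have [h1 h2] := Sbd i; exact: loewner_diag_bounds.
have S0 i j : 0 < Sigma i j j by have /andP[h1 _] := Sb i j; exact: lt_le_trans h1.
pose sg i j := Num.sqrt (Sigma i j j).
have sg0 i j : 0 < sg i j by rewrite sqrtr_gt0.
have sgk i j : kund <= sg i j ^+ 2 <= kbar by rewrite sqr_sqrtr// ltW.
have mixE G i x : mixture_density G (Sigma i) x = mix (fun i => gauss_kernel (sg i)) G i x.
  by apply: eq_Rintegral => th _; rewrite gauss_density_prod.
have [M [M1 hM hM3 hM2]] := frequency_bounds hd hkbar l1 hl1 hl2.
have l0 : 0 < ln (n%:R : R) by exact: lt_le_trans l1.
have n0R : 0 < n%:R :> R by rewrite ltr0n.
have Xf' i : has_density (X i) (mix (fun i => gauss_kernel (sg i)) Gs i).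
  by rewrite (_ : mix _ Gs i = mixture_density Gs (Sigma i))//; apply/funext => x; rewrite mixE.
have lik' : {ae P, forall om, Ghat (X ^~ om) (bounding_box (X ^~ om)) = 1%E /\
  \sum_i ln (mix (fun i => gauss_kernel (sg i)) Gs i (X i om)) -
  \sum_i ln (mix (fun i => gauss_kernel (sg i)) (Ghat (X ^~ om)) i (X i om))
    <= n%:R * (c * (ln n%:R ^+ d.+1 / n%:R))}.
  apply: filterS lik => om [bb li]; split => //.
  move: li; rewrite /loglik -mulrBr mulrC ler_pdivrMr// mulrC.
  by under eq_bigr do rewrite mixE; under [X in _ - X]eq_bigr do rewrite mixE.
set l := ln (n%:R : R) in l1 Ll hl1 hl2 hc hV ha hW hPhi hPhi1 hLip ha' hMp hE hfin hM hM3 hM2 l0 lik' *.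
set p := expR (l / 32) in hc hV ha hW hPhi hPhi1 hLip ha' hMp hE hfin *.
have p0 : 0 < p by exact: expR_gt0.
rewrite !expr0 !mulr1 in hPhi hPhi1 hE; rewrite !expr1 in ha ha'.
have q2 : 2 ^+ d <= 2 ^+ d * l ^+ (2 * d) by rewrite ler_peMr ?exprn_ge0// exprn_ege1.
have q1 : (1 : R) <= 2 ^+ d by rewrite exprn_ege1// ler1n.
have Mq : M.+1%:R ^+ d <= 2 ^+ d * l ^+ (2 * d).
  rewrite exprM -exprMn -natr1 lerXn2r ?nnegrE ?addr_ge0 ?mulr_ge0 ?exprn_ge0 ?(ltW l0)//.
  have l2 : 1 <= l ^+ 2 by rewrite exprn_ege1.
  by rewrite (mulrDl 1 1) !mul1r lerD.
have := W2sq_gaussian kund0 sg0 sgk GL indX Xf' lik' npos hd M1 l0 Ll hM.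
have hV' : (2 * l) ^+ d <= p by rewrite exprMn.
have hW' : 2 * d%:R * M%:R <= p by apply: le_trans hW; rewrite ler_wpM2l ?mulr_ge0.
have hMp' : 10 * (2 ^+ d * l ^+ (2 * d)) <= p by rewrite mulrA.
have [hp2 h2d hMd htau] := tenfold_bounds q1 q2 Mq hMp'.
rewrite -(mul1r p) -ltr_pdivrMr// -mulrA in htau.
move=> /(_ hp2 hc hV' ha hW' hPhi hPhi1 hLip ha' hMd h2d hE htau) [E [mE PE EP]]; exists E; split => // om Eom.
apply: le_trans (EP om Eom) _; rewrite lee_fin -[M.+1%:R]natr1.
by apply: W2_bound_le => //; rewrite ltr0n (ltn_trans _ M1).
Qed.
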